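(* Let $\sigma, N$ be integers with $1 \le \sigma \le N$, and let ${\bf T}$ be a read-only string of length $N$ over the integer alphabet $[1,\dots,\sigma]$ in which each of the $\sigma$ characters occurs, and whose last character ${\bf T}[N]$ is strictly smaller than every other character of ${\bf T}$. Then there is an algorithm in the word RAM model (word size $\lceil \log N\rceil$ bits, constant-time arithmetic and bit operations) that computes both the suffix array ${\bf SA}$ and the LCP array ${\bf LCP}$ of ${\bf T}$ in $O(N)$ time and in-place, i.e. using only $O(1)$ words of working memory in addition to the read-only input ${\bf T}$ and the two output arrays of $N$ words each that are to hold ${\bf SA}$ and ${\bf LCP}$.
   Context: For $1\le i\le N$, the suffix $\mathrm{suf}(i)$ is ${\bf T}[i\dots N]$. The suffix array ${\bf SA}$ is the integer array of length $N$ such that ${\bf SA}[r]=i$ iff $\mathrm{suf}(i)$ is the $r$-th lexicographically smallest suffix of ${\bf T}$. The LCP array is the integer array of length $N$ with ${\bf LCP}[1]=0$ and, for $1<r\le N$, ${\bf LCP}[r]$ equal to the length of the longest common prefix of $\mathrm{suf}({\bf SA}[r])$ and $\mathrm{suf}({\bf SA}[r-1])$. ''In-place'' means the algorithm uses only a constant number of extra machine words beyond the input string and the output arrays; the output arrays may be used as working space during the computation.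
   Formalization: The word size is taken as ⌊log N⌋+1 bits instead of ⌈log N⌉; the two differ only when N is a power of two, where ⌈log N⌉ bits cannot hold the value N, which always occurs as the entry SA[1]. *)

(* Defs.v *)
From mathcomp Require Import all_boot.
Set Implicit Arguments. Unset Strict Implicit. Unset Printing Implicit Defensive.

(* A string T[1..N] is a seq nat; T[i] (1-based) is  nth 0 T i.-1.      *)

Definition suf (T : seq nat) (i : nat) : seq nat := drop i.-1 T.

Fixpoint lex_lt (s t : seq nat) : bool :=
  match s, t with
  | [::], [::] => false
  | [::], _ :: _ => true
  | _ :: _, [::] => false
  | a :: s', b :: t' => (a < b) || ((a == b) && lex_lt s' t')
  end.

Fixpoint lcp (s t : seq nat) : nat :=
  match s, t with
  | a :: s', b :: t' => if a == b then (lcp s' t').+1 else 0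
  | _, _ => 0
  end.

(* SA (0-based seq, SA`_(r-1) = SA[r]) is the suffix array of T:
   a permutation of 1..N listing the suffixes in increasing lex order *)
Definition is_suffix_array (T SA : seq nat) : bool :=
  perm_eq SA (iota 1 (size T)) &&
  sorted (fun i j => lex_lt (suf T i) (suf T j)) SA.

Definition lcp_array (T SA : seq nat) : seq nat :=
  mkseq (fun r => if r == 0 then 0
                  else lcp (suf T (nth 0 SA r)) (suf T (nth 0 SA r.-1)))
        (size T).

Definition valid_text (sigma : nat) (T : seq nat) : Prop :=
  [/\ 1 <= sigma <= size T,
      all (fun c => 1 <= c <= sigma) T,
      (forall c, 1 <= c <= sigma -> c \in T) &
      (forall i, i < (size T).-1 -> nth 0 T (size T).-1 < nth 0 T i)].

(*  - word size w bits; all register / array values are < 2^w;         *)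
(*  - a finite program (hence O(1) registers: only the registers named *)
(*    in the program are accessible);                                  *)
(*  - memory: the read-only input T (addresses 0..N-1 hold T[1..N]),   *)
(*    and two writable output arrays of N words (for SA and LCP);      *)
(*    no other memory exists.                                          *)
(* Every instruction costs one time unit.                              *)

Inductive binop := OAdd | OSub | OMul | ODiv | OMod | OAnd | OOr | OXor
                 | OShl | OShr | OLt | OEq.

Definition eval_binop (w : nat) (o : binop) (a b : nat) : nat :=
  match o with
  | OAdd => (a + b) %% 2 ^ w
  | OSub => (a + 2 ^ w - b) %% 2 ^ w
  | OMul => (a * b) %% 2 ^ w
  | ODiv => if b == 0 then 0 else a %/ b
  | OMod => if b == 0 then 0 else a %% b
  | OAnd => Nat.land a b
  | OOr  => Nat.lor a b
  | OXor => Nat.lxor a b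
  | OShl => (a * 2 ^ b) %% 2 ^ w
  | OShr => a %/ 2 ^ b
  | OLt  => nat_of_bool (a < b)
  | OEq  => nat_of_bool (a == b)
  end.

Inductive arr := ASA | ALCP.

Inductive instr :=
  | IConst (d : nat) (c : nat)
  | IMov (d s : nat)
  | IOp (o : binop) (d a b : nat)
  | ILoadT (d a : nat)
  | ILoad (k : arr) (d a : nat)
  | IStore (k : arr) (a s : nat)
  | IJz (r : nat) (target : nat)
  | IJmp (target : nat)
  | IHalt.

Definition program := seq instr.

Record state := State {
  pc : nat;
  regs : nat -> nat;
  mSA : seq nat;
  mLCP : seq nat }.

Definition upd_reg (rg : nat -> nat) (d v : nat) : nat -> nat :=
  fun x => if x == d then v else rg x.

Definition get_arr (s : state) (k : arr) : seq nat :=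
  match k with ASA => mSA s | ALCP => mLCP s end.

Definition set_arr (s : state) (k : arr) (m : seq nat) : state :=
  match k with
  | ASA => State (pc s) (regs s) m (mLCP s)
  | ALCP => State (pc s) (regs s) (mSA s) m
  end.

Definition step (w : nat) (P : program) (T : seq nat) (s : state) : option state :=
  let rg := regs s in
  let nx := (pc s).+1 in
  if pc s < size P then
  match nth IHalt P (pc s) with
  | IConst d c => Some (State nx (upd_reg rg d (c %% 2 ^ w)) (mSA s) (mLCP s))
  | IMov d r => Some (State nx (upd_reg rg d (rg r)) (mSA s) (mLCP s))
  | IOp o d a b =>
      Some (State nx (upd_reg rg d (eval_binop w o (rg a) (rg b))) (mSA s) (mLCP s))
  | ILoadT d a =>
      if rg a < size T then
        Some (State nx (upd_reg rg d (nth 0 T (rg a))) (mSA s) (mLCP s))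
      else None
  | ILoad k d a =>
      if rg a < size (get_arr s k) then
        Some (State nx (upd_reg rg d (nth 0 (get_arr s k) (rg a))) (mSA s) (mLCP s))
      else None
  | IStore k a r =>
      if rg a < size (get_arr s k) then
        Some (set_arr (State nx rg (mSA s) (mLCP s)) k
                      (set_nth 0 (get_arr s k) (rg a) (rg r)))
      else None
  | IJz r t => Some (State (if rg r == 0 then t else nx) rg (mSA s) (mLCP s))
  | IJmp t => Some (State t rg (mSA s) (mLCP s))
  | IHalt => Some s
  end
  else None.

Definition halted (P : program) (s : state) : bool :=
  (pc s < size P) &&
  (if nth IHalt P (pc s) is IHalt then true else false).

Fixpoint exec (w : nat) (P : program) (T : seq nat) (n : nat) (s : state)
  : option state :=
  match n with
  | 0 => Some s
  | n'.+1 => if halted P s then Some s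
             else match step w P T s with
                  | Some s' => exec w P T n' s'
                  | None => None
                  end
  end.

(* word size: number of bits of N, i.e. ceil(log2 N) rounded so that N fits
   in a word *)
Definition word_size (N : nat) : nat := (Nat.log2 N).+1.

(* initial configuration: r_0 = N, r_1 = sigma, other registers 0,
   pc = 0, output arrays with arbitrary initial (word-sized) contents *)
Definition init_state (N sigma : nat) (SA0 LCP0 : seq nat) : state :=
  State 0 (fun x => if x == 0 then N else if x == 1 then sigma else 0) SA0 LCP0.

Definition words_ok (w N : nat) (m : seq nat) : bool :=
  (size m == N) && all (fun v => v < 2 ^ w) m.

(* Main.v *)
(* SA-IS with the texts of all recursion levels kept in the LCP array.  Each
   reduced text has at most half the length of the previous one, so the texts
   T_1, ..., T_k of levels 1 to k take at most N - |T_k| words, which leaves room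
   for the bucket pointers of level k, while the suffix array serves as working
   space.  Reduced texts end with their only character 1, so on the way back each
   of them is recovered by scanning backwards and no recursion stack is needed.

   The LCP array is then obtained from the array Phi of suffix array predecessors:
   i + PLCP[i] is nondecreasing and less than N, so storing it modulo
   h = ceil (N / 2) together with the position where it reaches h loses nothing
   and keeps values below h; adding h is then a mark bit, with which the values
   are moved from text order to suffix array order along the cycles of the
   permutation.

   Programs are written in a small structured language over unbounded natural
   numbers, compiled to the machine; [safe] demands that no value exceeds N. *)
Require Import Defs.
From mathcomp Require Import all_boot zify.
Set Implicit Arguments. Unset Strict Implicit. Unset Printing Implicit Defensive.

(** The obstacle is that no bit is spare for suffix types. They are read off bucket pointers
    instead: when a pass reaches slot [x], the entry found there has the type being inserted iff [x]
    lies below the current pointer of its bucket ([pinv_test]), and the final pointers of the S pass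
    still separate the types in every bucket. So a single abstract pass, governed by [pass_law], is
    verified; the L pass and the mirrored S pass are its two instances. Both are used with
    [stop = lms], to sort LMS substrings given in arbitrary order, and with [stop = pred0], to sort
    whole suffixes from sorted LMS suffixes. What is compared are sequences of codes, twice the
    character plus the type bit, which order L before S inside a bucket.

    Time is counted in loop iterations, handled as a credit. A level of length n costs at most 22n
    on the way down and 17n on the way up; as the next length is at most n/2, both are charged to
    the length lost between the levels. *)

(** * A structured language and its compiler *)

Inductive expr :=
| EC of nat
| EV of nat
| EAdd of expr & expr
| ESub of expr & expr
| ELt of expr & expr
| EEq of expr & expr
| EHalf of expr
| ELd of arr & expr
| EText of expr
| EIf of expr & expr & expr.

Inductive cmd :=
| Skip
| Asg of nat & expr
| Sto of arr & expr & expr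
| Seq of cmd & cmd
| If of expr & cmd & cmd
| While of expr & cmd.

(** [EText] compiles to a run-time branch on [reg_bb], since one code sorts both the input and the
    reduced texts, the latter found at base [reg_tb]. Program variables stay below [tmp];
    expressions are evaluated in the registers from [tmp] on. *)
Definition reg_tb := 3.
Definition reg_bb := 4.
Definition tmp := 40.

Fixpoint size_expr (e : expr) : nat :=
  match e with
  | EC _ | EV _ => 1
  | EAdd a b | ESub a b | ELt a b | EEq a b => size_expr a + (size_expr b + 1)
  | EHalf a => size_expr a + 2
  | ELd _ a => size_expr a + 1
  | EText a => size_expr a + 5
  | EIf c a b => size_expr c + (1 + (size_expr a + (1 + size_expr b)))
  end.

Fixpoint size_cmd (c : cmd) : nat :=
  match c with
  | Skip => 0
  | Asg _ e => size_expr e + 1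
  | Sto _ a v => size_expr a + (size_expr v + 1)
  | Seq a b => size_cmd a + size_cmd b
  | If e a b => size_expr e + (1 + (size_cmd a + (1 + size_cmd b)))
  | While e a => size_expr e + (1 + (size_cmd a + 1))
  end.

(* [compile_expr e d p] is the code of [e] placed at address [p]; it leaves the value in
   register [d] and overwrites no register below [d]. *)
Fixpoint compile_expr (e : expr) (d p : nat) : seq instr :=
  match e with
  | EC c => [:: IConst d c]
  | EV r => [:: IMov d r]
  | EAdd a b => compile_expr a d p ++ compile_expr b d.+1 (p + size_expr a) ++ [:: IOp OAdd d d d.+1]
  | ESub a b => compile_expr a d p ++ compile_expr b d.+1 (p + size_expr a) ++ [:: IOp OSub d d d.+1]
  | ELt a b => compile_expr a d p ++ compile_expr b d.+1 (p + size_expr a) ++ [:: IOp OLt d d d.+1]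
  | EEq a b => compile_expr a d p ++ compile_expr b d.+1 (p + size_expr a) ++ [:: IOp OEq d d d.+1]
  | EHalf a => compile_expr a d p ++ [:: IConst d.+1 1; IOp OShr d d d.+1]
  | ELd k a => compile_expr a d p ++ [:: ILoad k d d]
  | EText a => compile_expr a d p ++
      [:: IJz reg_bb (p + size_expr a + 4); IOp OAdd d d reg_tb; ILoad ALCP d d;
          IJmp (p + size_expr a + 5); ILoadT d d]
  | EIf c a b =>
      compile_expr c d p ++ [:: IJz d (p + size_expr c + 1 + size_expr a + 1)] ++
      compile_expr a d (p + size_expr c + 1) ++
      [:: IJmp (p + size_expr c + 1 + size_expr a + 1 + size_expr b)] ++
      compile_expr b d (p + size_expr c + 1 + size_expr a + 1)
  end.

Fixpoint compile_cmd (c : cmd) (p : nat) : seq instr :=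
  match c with
  | Skip => [::]
  | Asg r e => compile_expr e tmp p ++ [:: IMov r tmp]
  | Sto k a v => compile_expr a tmp p ++ compile_expr v tmp.+1 (p + size_expr a) ++ [:: IStore k tmp tmp.+1]
  | Seq a b => compile_cmd a p ++ compile_cmd b (p + size_cmd a)
  | If e a b =>
      compile_expr e tmp p ++ [:: IJz tmp (p + size_expr e + 1 + size_cmd a + 1)] ++
      compile_cmd a (p + size_expr e + 1) ++
      [:: IJmp (p + size_expr e + 1 + size_cmd a + 1 + size_cmd b)] ++
      compile_cmd b (p + size_expr e + 1 + size_cmd a + 1)
  | While e a =>
      compile_expr e tmp p ++ [:: IJz tmp (p + size_expr e + 1 + size_cmd a + 1)] ++
      compile_cmd a (p + size_expr e + 1) ++ [:: IJmp p]
  end.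

Fixpoint wf_expr (e : expr) : bool :=
  match e with
  | EC _ => true
  | EV r => r < tmp
  | EAdd a b | ESub a b | ELt a b | EEq a b => wf_expr a && wf_expr b
  | EHalf a | ELd _ a | EText a => wf_expr a
  | EIf c a b => [&& wf_expr c, wf_expr a & wf_expr b]
  end.

Fixpoint wf_cmd (c : cmd) : bool :=
  match c with
  | Skip => true
  | Asg r e => (r < tmp) && wf_expr e
  | Sto _ a v => wf_expr a && wf_expr v
  | Seq a b => wf_cmd a && wf_cmd b
  | If e a b => [&& wf_expr e, wf_cmd a & wf_cmd b]
  | While e a => wf_expr e && wf_cmd a
  end.

Lemma size_compile_expr e d p : size (compile_expr e d p) = size_expr e.
Proof.
elim: e d p => //=.
- by move=> a IHa b IHb d p; rewrite !size_cat IHa IHb /=.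
- by move=> a IHa b IHb d p; rewrite !size_cat IHa IHb /=.
- by move=> a IHa b IHb d p; rewrite !size_cat IHa IHb /=.
- by move=> a IHa b IHb d p; rewrite !size_cat IHa IHb /=.
- by move=> a IHa d p; rewrite !size_cat IHa /=.
- by move=> k a IHa d p; rewrite !size_cat IHa /=.
- by move=> a IHa d p; rewrite !size_cat IHa /=.
- by move=> c IHc a IHa b IHb d p; rewrite !size_cat IHc /= !size_cat /= IHa IHb.
Qed.

Lemma size_compile_cmd c p : size (compile_cmd c p) = size_cmd c.
Proof.
elim: c p => //=.
- by move=> r e p; rewrite size_cat size_compile_expr.
- by move=> k a v p; rewrite !size_cat !size_compile_expr.
- by move=> a IHa b IHb p; rewrite !size_cat IHa IHb.
- by move=> e a IHa b IHb p; rewrite !size_cat /= !size_cat /= size_compile_expr IHa IHb.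
- by move=> e a IHa p; rewrite !size_cat /= !size_cat /= size_compile_expr IHa.
Qed.

(** * Semantics over unbounded numbers *)

Record st := St { rg : nat -> nat; fa : nat -> nat; fb : nat -> nat }.

Definition upd (f : nat -> nat) (d v : nat) : nat -> nat :=
  fun x => if x == d then v else f x.
Definition updr (f : nat -> nat) (d v : nat) : nat -> nat :=
  fun x => if x == d then v else f x.
Definition setr d v s := St (updr (rg s) d v) (fa s) (fb s).
Definition fget k s := if k is ASA then fa s else fb s.
Definition fset k i v s :=
  if k is ASA then St (rg s) (upd (fa s) i v) (fb s)
  else St (rg s) (fa s) (upd (fb s) i v).

Section Semantics.
Variables (N : nat) (tx : nat -> nat).

Definition txt (s : st) (i : nat) : nat :=
  if rg s reg_bb == 0 then tx i else fb s (rg s reg_tb + i).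

Definition txt_safe (s : st) (i : nat) : Prop :=
  if rg s reg_bb == 0 then i < N else rg s reg_tb + i < N.

Fixpoint ev (e : expr) (s : st) : nat :=
  match e with
  | EC c => c
  | EV r => rg s r
  | EAdd a b => ev a s + ev b s
  | ESub a b => ev a s - ev b s
  | ELt a b => ev a s < ev b s
  | EEq a b => ev a s == ev b s
  | EHalf a => ev a s %/ 2
  | ELd k a => fget k s (ev a s)
  | EText a => txt s (ev a s)
  | EIf c a b => if ev c s == 0 then ev b s else ev a s
  end.

(** Under these conditions truncated subtraction and modular subtraction agree, sums do not wrap and
    loads stay inside their array. Values merely read carry no bound, because moving them cannot
    overflow. [EHalf] asks for [0 < N] because its shift amount 1 must fit in a word. *)
Fixpoint safe (e : expr) (s : st) : Prop :=
  match e with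
  | EC c => c <= N
  | EV r => True
  | EAdd a b => [/\ safe a s, safe b s & ev a s + ev b s <= N]
  | ESub a b => [/\ safe a s, safe b s & ev b s <= ev a s <= N]
  | ELt a b | EEq a b => safe a s /\ safe b s
  | EHalf a => safe a s /\ 0 < N
  | ELd k a => safe a s /\ ev a s < N
  | EText a => safe a s /\ txt_safe s (ev a s)
  | EIf c a b => safe c s /\ (if ev c s == 0 then safe b s else safe a s)
  end.

(* The cost counts loop iterations only: between two iterations at most the
   whole program text is executed once. *)
Inductive run : cmd -> st -> nat -> st -> Prop :=
| RSkip s : run Skip s 0 s
| RAsg r e s : safe e s -> run (Asg r e) s 0 (setr r (ev e s) s)
| RSto k a v s : safe a s -> safe v s -> ev a s < N ->
    run (Sto k a v) s 0 (fset k (ev a s) (ev v s) s)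
| RSeq a b s s1 s2 k1 k2 : run a s k1 s1 -> run b s1 k2 s2 ->
    run (Seq a b) s (k1 + k2) s2
| RIf1 e a b s s1 k : safe e s -> ev e s != 0 -> run a s k s1 ->
    run (If e a b) s k s1
| RIf0 e a b s s1 k : safe e s -> ev e s == 0 -> run b s k s1 ->
    run (If e a b) s k s1
| RWhile1 e a s s1 s2 k1 k2 : safe e s -> ev e s != 0 -> run a s k1 s1 ->
    run (While e a) s1 k2 s2 -> run (While e a) s (k1 + k2).+1 s2
| RWhile0 e a s : safe e s -> ev e s == 0 -> run (While e a) s 0 s.

Fixpoint mods (c : cmd) : seq nat :=
  match c with
  | Skip | Sto _ _ _ => [::]
  | Asg r _ => [:: r]
  | Seq a b | If _ a b => mods a ++ mods b
  | While _ a => mods a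
  end.

Fixpoint wr (k : arr) (c : cmd) : bool :=
  match c with
  | Skip | Asg _ _ => false
  | Sto k' _ _ => match k, k' with ASA, ASA | ALCP, ALCP => true | _, _ => false end
  | Seq a b | If _ a b => wr k a || wr k b
  | While _ a => wr k a
  end.

Definition framed (c : cmd) (s s' : st) : Prop :=
  [/\ forall r, r \notin mods c -> rg s' r = rg s r,
      ~~ wr ASA c -> fa s' = fa s & ~~ wr ALCP c -> fb s' = fb s].

Lemma fr_refl c s : framed c s s.
Proof. by split. Qed.

Lemma fr_trans c s1 s2 s3 : framed c s1 s2 -> framed c s2 s3 -> framed c s1 s3.
Proof.
move=> [a1 b1 c1] [a2 b2 c2]; split.
- by move=> r h; rewrite a2 ?a1.
- by move=> h; rewrite b2 ?b1.
- by move=> h; rewrite c2 ?c1.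
Qed.

Lemma fr_sub c1 c s1 s2 : {subset mods c1 <= mods c} ->
  (wr ASA c1 -> wr ASA c) -> (wr ALCP c1 -> wr ALCP c) ->
  framed c1 s1 s2 -> framed c s1 s2.
Proof.
move=> h ha hb [x y z]; split.
- by move=> r hr; apply: x; apply: contra hr; apply: h.
- by move=> hr; apply: y; apply: contra hr.
- by move=> hr; apply: z; apply: contra hr.
Qed.

(** Turns framing into a computed membership test, so that the specifications of the blocks need to
    mention only what changes. *)
Lemma run_fr c s k s' : run c s k s' -> framed c s s'.
Proof.
elim=> {c s k s'}.
- by move=> s; exact: fr_refl.
- move=> r e s _; split=> //= x; rewrite inE /updr => h.
  by rewrite (negbTE h).
- by move=> [] a v s _ _ _; split.
- move=> a b s s1 s2 k1 k2 _ h1 _ h2; apply: (@fr_trans _ _ s1).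
    apply: fr_sub h1 => /=; [|by move=> ->|by move=> ->].
    by move=> x; rewrite mem_cat => ->.
  apply: fr_sub h2 => /=; [|by move=> ->; rewrite orbT|by move=> ->; rewrite orbT].
  by move=> x; rewrite mem_cat orbC => ->.
- move=> e a b s s1 k _ _ _; apply: fr_sub => /=; [|by move=> ->|by move=> ->].
  by move=> x; rewrite mem_cat => ->.
- move=> e a b s s1 k _ _ _.
  apply: fr_sub => /=; [|by move=> ->; rewrite orbT|by move=> ->; rewrite orbT].
  by move=> x; rewrite mem_cat orbC => ->.
- by move=> e a s s1 s2 k1 k2 _ _ _ h1 _ h2; apply: fr_trans h1 h2.
- by move=> *; exact: fr_refl.
Qed.

End Semantics.

(** * Correctness of the compiler *)

Section Compile.
Variables (T : seq nat) (w : nat) (P : program).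
Let N := size T.
Let tx := nth 0 T.
Hypothesis Nw : N < 2 ^ w.

Lemma exec_add n1 n2 s :
  exec w P T (n1 + n2) s = obind (exec w P T n2) (exec w P T n1 s).
Proof.
elim: n1 s => [|n1 IH] s //=; case: ifP => [h|h].
  by case: n2 {IH} => //= n2; rewrite h.
by case: (step w P T s).
Qed.

Definition code_at (p : nat) (code : seq instr) :=
  exists pre post, P = pre ++ code ++ post /\ size pre = p.

Lemma at_catl p a b : code_at p (a ++ b) -> code_at p a.
Proof. by case=> pre [post [e1 e2]]; exists pre, (b ++ post); rewrite e1 -!catA. Qed.

Lemma at_catr p a b : code_at p (a ++ b) -> code_at (p + size a) b.
Proof.
case=> pre [post [e1 <-]]; exists (pre ++ a), post.
by rewrite size_cat e1 -!catA.
Qed.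

Lemma at_cons p i b : code_at p (i :: b) -> code_at p.+1 b.
Proof. by move=> h; have := @at_catr p [:: i] b h; rewrite addn1. Qed.

Lemma at_nth p i b : code_at p (i :: b) -> p < size P /\ nth IHalt P p = i.
Proof.
case=> pre [post [e1 <-]]; rewrite e1 nth_cat ltnn subnn /=; split=> //.
by rewrite !size_cat /= -[X in X < _]addn0 ltn_add2l.
Qed.

Definition nohalt (i : instr) := if i is IHalt then false else true.

Lemma exec1 p i b ms ms' : code_at p (i :: b) -> pc ms = p -> nohalt i ->
  step w P T ms = Some ms' -> exec w P T 1 ms = Some ms'.
Proof.
move=> h hp hi hs; have [h1 h2] := at_nth h.
by rewrite /= /halted hp h1 h2 hs; case: i hi {h h2}.
Qed.

(** Registers from [tmp] on are left free, and so are the cells from index [N] on, which exist only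
    in the idealized arrays. *)
Definition sim (s : st) (ms : state) :=
  [/\ forall r, r < tmp -> regs ms r = rg s r,
      size (mSA ms) = N, size (mLCP ms) = N,
      forall i, i < N -> nth 0 (mSA ms) i = fa s i &
      forall i, i < N -> nth 0 (mLCP ms) i = fb s i].

Definition ext (d : nat) (ms ms' : state) :=
  [/\ forall r, r < d -> regs ms' r = regs ms r,
      mSA ms' = mSA ms & mLCP ms' = mLCP ms].

Definition reach (k : nat) (ms ms' : state) :=
  exists2 j, j <= k & exec w P T j ms = Some ms'.

Lemma reach0 ms : reach 0 ms ms.
Proof. by exists 0. Qed.

Lemma reach_trans a b s1 s2 s3 :
  reach a s1 s2 -> reach b s2 s3 -> reach (a + b) s1 s3.
Proof.
move=> [i hi e1] [j hj e2]; exists (i + j); first exact: leq_add.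
by rewrite exec_add e1.
Qed.

Lemma reach_le a b s1 s2 : a <= b -> reach a s1 s2 -> reach b s1 s2.
Proof. by move=> h [i hi e]; exists i => //; exact: leq_trans h. Qed.

Lemma reach1 p i b ms ms' : code_at p (i :: b) -> pc ms = p -> nohalt i ->
  step w P T ms = Some ms' -> reach 1 ms ms'.
Proof. by move=> *; exists 1 => //; apply: exec1; eauto. Qed.

Lemma ext_trans d d' a b c : d <= d' -> ext d a b -> ext d' b c -> ext d a c.
Proof.
move=> hd [x1 y1 z1] [x2 y2 z2]; split; rewrite ?y2 ?z2 // => r hr.
by rewrite x2 ?x1 //; exact: leq_trans hd.
Qed.

Lemma sim_ext s d a b : tmp <= d -> sim s a -> ext d a b -> sim s b.
Proof.
move=> hd [h1 h2 h3 h4 h5] [x y z]; split; rewrite ?y ?z // => r hr.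
by rewrite x ?h1 //; exact: leq_trans hd.
Qed.

Definition setreg ms d v p := State p (upd_reg (regs ms) d v) (mSA ms) (mLCP ms).

Lemma ext_setreg ms d v p : ext d ms (setreg ms d v p).
Proof. by split=> //= r hr; rewrite /upd_reg; case: eqP => // e; lia. Qed.

Lemma regs_setreg ms d v p : regs (setreg ms d v p) d = v.
Proof. by rewrite /= /upd_reg eqxx. Qed.

Definition evaluates (s : st) (ms : state) (k v d p : nat) :=
  exists ms', [/\ reach k ms ms', pc ms' = p, regs ms' d = v & ext d ms ms'].

(** Factors the four binary operators and the halving shift: the second operand goes to the next
    register, and its evaluation leaves the first one intact. *)
Lemma binop_ok s ms ea va vb eb d p q (o : binop) r b :
  tmp <= d -> sim s ms ->
  evaluates s ms ea va d p ->
  (forall ms, sim s ms -> pc ms = p -> evaluates s ms eb vb d.+1 q) ->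
  code_at q (IOp o d d d.+1 :: b) ->
  eval_binop w o va vb = r ->
  evaluates s ms (ea + (eb + 1)) r d q.+1.
Proof.
move=> hd hs [m1 [r1 p1 v1 x1]] /(_ m1 (sim_ext hd hs x1) p1) [m2 [r2 p2 v2 x2]] hq he.
exists (setreg m2 d r q.+1); split=> //.
- apply: reach_trans r1 _; apply: reach_trans r2 _.
  apply: (reach1 hq p2) => //; rewrite /step p2.
  have [-> ->] := at_nth hq; rewrite v2.
  by case: x2 => x2 _ _; rewrite x2 // v1 he.
- exact: regs_setreg.
- apply: ext_trans (leqnn d) _ (ext_setreg _ _ _ _).
  by apply: ext_trans (leqnSn d) x1 x2.
Qed.

Lemma compile_expr_ok e s ms d p :
  wf_expr e -> tmp <= d -> code_at p (compile_expr e d p) -> sim s ms -> pc ms = p ->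
  safe N tx e s -> evaluates s ms (size_expr e) (ev tx e s) d (p + size_expr e).
Proof.
elim: e ms d p => /=.
- move=> c ms d p _ hd hat hs hp hc; exists (setreg ms d c p.+1).
  split=> //; rewrite ?addn1 ?regs_setreg //; last exact: ext_setreg.
  apply: (reach1 hat hp) => //; rewrite /step hp; have [-> ->] := at_nth hat.
  by rewrite modn_small //; exact: leq_ltn_trans Nw.
- move=> r ms d p hr hd hat hs hp _; exists (setreg ms d (rg s r) p.+1).
  split=> //; rewrite ?addn1 ?regs_setreg //; last exact: ext_setreg.
  apply: (reach1 hat hp) => //; rewrite /step hp; have [-> ->] := at_nth hat.
  by case: hs => -> .
- move=> a IHa b IHb ms d p /andP[wa wb] hd hat hs hp [sa sb hN].
  rewrite (_ : p + _ = (p + size_expr a + size_expr b).+1); last by lia.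
  have h3 := at_catr (at_catr hat); rewrite !size_compile_expr in h3.
  apply: (binop_ok hd hs (IHa _ _ _ wa hd (at_catl hat) hs hp sa) _ h3) => //.
    move=> m1 s1 p1; apply: IHb => //; first exact: leqW.
    by have := at_catl (at_catr hat); rewrite size_compile_expr.
  by rewrite /= modn_small //; exact: leq_ltn_trans Nw.
- move=> a IHa b IHb ms d p /andP[wa wb] hd hat hs hp [sa sb /andP[h1 h2]].
  rewrite (_ : p + _ = (p + size_expr a + size_expr b).+1); last by lia.
  have h3 := at_catr (at_catr hat); rewrite !size_compile_expr in h3.
  apply: (binop_ok hd hs (IHa _ _ _ wa hd (at_catl hat) hs hp sa) _ h3) => //.
    move=> m1 s1 p1; apply: IHb => //; first exact: leqW.
    by have := at_catl (at_catr hat); rewrite size_compile_expr.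
  (* The machine adds [2 ^ w] before subtracting; since the difference is nonnegative, that summand
     can be pulled out and vanishes modulo [2 ^ w]. *)
  by rewrite /= -addnBAC // modnDr modn_small //; lia.
- move=> a IHa b IHb ms d p /andP[wa wb] hd hat hs hp [sa sb].
  rewrite (_ : p + _ = (p + size_expr a + size_expr b).+1); last by lia.
  have h3 := at_catr (at_catr hat); rewrite !size_compile_expr in h3.
  apply: (binop_ok hd hs (IHa _ _ _ wa hd (at_catl hat) hs hp sa) _ h3) => //.
  move=> m1 s1 p1; apply: IHb => //; first exact: leqW.
  by have := at_catl (at_catr hat); rewrite size_compile_expr.
- move=> a IHa b IHb ms d p /andP[wa wb] hd hat hs hp [sa sb].
  rewrite (_ : p + _ = (p + size_expr a + size_expr b).+1); last by lia.
  have h3 := at_catr (at_catr hat); rewrite !size_compile_expr in h3.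
  apply: (binop_ok hd hs (IHa _ _ _ wa hd (at_catl hat) hs hp sa) _ h3) => //.
  move=> m1 s1 p1; apply: IHb => //; first exact: leqW.
  by have := at_catl (at_catr hat); rewrite size_compile_expr.
- move=> a IHa ms d p wa hd hat hs hp [sa N0].
  have h3 := at_catr hat; rewrite size_compile_expr in h3.
  rewrite (_ : p + _ = (p + size_expr a).+1.+1); last by lia.
  apply: (@binop_ok s ms (size_expr a) (ev tx a s) 1 1 d _ _ OShr _ _ hd hs
             (IHa _ _ _ wa hd (at_catl hat) hs hp sa) _ (at_cons h3)) => //.
  move=> m1 s1 p1; exists (setreg m1 d.+1 1 (p + size_expr a).+1).
  split=> //; rewrite ?regs_setreg //; last exact: ext_setreg.
  apply: (reach1 h3 p1) => //; rewrite /step p1; have [-> ->] := at_nth h3.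
  by rewrite modn_small //; exact: leq_ltn_trans Nw.
- move=> k a IHa ms d p wa hd hat hs hp [sa hl].
  have h3 := at_catr hat; rewrite size_compile_expr in h3.
  have [m1 [r1 p1 v1 x1]] := IHa _ _ _ wa hd (at_catl hat) hs hp sa.
  exists (setreg m1 d (fget k s (ev tx a s)) (p + size_expr a).+1).
  split=> //; rewrite ?addnA ?addn1 ?regs_setreg //; last first.
    by apply: ext_trans (leqnn d) x1 (ext_setreg _ _ _ _).
  rewrite -addn1; apply: reach_trans r1 _; apply: (reach1 h3 p1) => //.
  rewrite /step p1; have [-> ->] := at_nth h3; rewrite v1.
  have [_ z1 z2 z3 z4] := sim_ext hd hs x1.
  by case: k {h3 hat} => /=; rewrite ?z1 ?z2 hl ?z3 ?z4.
- move=> a IHa ms d p wa hd hat hs hp [sa hl].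
  have h3 := at_catr hat; rewrite size_compile_expr in h3.
  have [m1 [r1 p1 v1 x1]] := IHa _ _ _ wa hd (at_catl hat) hs hp sa.
  have [z0 z1 z2 z3 z4] := sim_ext hd hs x1.
  have h4 := at_cons h3; have h5 := at_cons h4; have h6 := at_cons h5.
  have h7 := at_cons h6.
  have ebb : regs m1 reg_bb = rg s reg_bb by apply: z0.
  have etb : regs m1 reg_tb = rg s reg_tb by apply: z0.
  have neq r : r < tmp -> r == d = false by move=> *; apply/eqP; lia.
  rewrite /txt; move: hl; rewrite /txt_safe; case: ifP => hbb hl.
    exists (setreg m1 d (tx (ev tx a s)) (p + size_expr a + 5)).
    split=> //; rewrite ?addnA ?regs_setreg //; last first.
      by apply: ext_trans (leqnn d) x1 (ext_setreg _ _ _ _).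
    apply: reach_trans r1 _; apply: (@reach_le (1 + 1)) => //.
    pose m2 := State (p + size_expr a + 4) (regs m1) (mSA m1) (mLCP m1).
    apply: (@reach_trans _ _ _ m2).
      apply: (reach1 h3 p1) => //; rewrite /step p1; have [-> ->] := at_nth h3.
      by rewrite ebb hbb.
    have ep : (p + size_expr a).+4 = p + size_expr a + 4 by lia.
    rewrite ep in h7.
    apply: (reach1 h7) => //; rewrite /step; have [-> ->] := at_nth h7.
    rewrite /m2 /= v1 hl /setreg; congr (Some (State _ _ _ _)); lia.
  pose m2 := State (p + size_expr a).+1 (regs m1) (mSA m1) (mLCP m1).
  pose m3 := setreg m2 d (rg s reg_tb + ev tx a s) (p + size_expr a).+2.
  pose m4 := setreg m3 d (fb s (rg s reg_tb + ev tx a s)) (p + size_expr a).+3.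
  exists (State (p + size_expr a + 5) (regs m4) (mSA m4) (mLCP m4)).
  split=> //; rewrite ?addnA ?regs_setreg //; last first.
    apply: (@ext_trans d d ms m1) => //.
    by apply: (@ext_trans d d m1 m3) => //; exact: ext_setreg.
  apply: reach_trans r1 _; apply: (@reach_le (1 + (1 + (1 + 1)))) => //.
  apply: (@reach_trans _ _ _ m2).
    apply: (reach1 h3 p1) => //; rewrite /step p1; have [-> ->] := at_nth h3.
    by rewrite ebb hbb.
  apply: (@reach_trans _ _ _ m3).
    apply: (reach1 h4) => //; rewrite /step; have [-> ->] := at_nth h4.
    rewrite /m2 /= v1 etb modn_small; last by lia.
    by rewrite /m3 /setreg [rg s reg_tb + _]addnC.
  apply: (@reach_trans _ _ _ m4).
    apply: (reach1 h5) => //; rewrite /step; have [-> ->] := at_nth h5.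
    by rewrite /m4 /m3 /= /upd_reg eqxx z2 hl z4.
  apply: (reach1 h6) => //; rewrite /step; have [-> ->] := at_nth h6.
  by rewrite /m4 /=.
- move=> c IHc a IHa b IHb ms d p /and3P[wc wa wb] hd hat hs hp [sc hif].
  have [m1 [r1 p1 v1 x1]] := IHc _ _ _ wc hd (at_catl hat) hs hp sc.
  have h1 := at_catr hat; rewrite size_compile_expr in h1.
  have h2 := at_cons h1; rewrite -addn1 in h2.
  have h3 := at_catr h2; rewrite size_compile_expr /= in h3.
  have h4 := at_cons h3; rewrite -addn1 in h4.
  have s1 := sim_ext hd hs x1.
  case: ifP hif => hc hif.
    pose m2 := State (p + size_expr c + 1 + size_expr a + 1) (regs m1) (mSA m1) (mLCP m1).
    have [m3 [r3 p3 v3 x3]] := IHb m2 d _ wb hd h4 s1 erefl hif.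
    exists m3; split=> //; last by apply: ext_trans (leqnn d) x1 x3.
      apply: reach_trans r1 _; apply: (@reach_le (1 + size_expr b)); first by lia.
      apply: reach_trans r3; apply: (reach1 h1 p1) => //.
      by rewrite /step p1; have [-> ->] := at_nth h1; rewrite v1 hc.
    by rewrite p3; lia.
  pose m2 := State (p + size_expr c + 1) (regs m1) (mSA m1) (mLCP m1).
  have [m3 [r3 p3 v3 x3]] := IHa m2 d _ wa hd (at_catl h2) s1 erefl hif.
  exists (State (p + size_expr c + 1 + size_expr a + 1 + size_expr b) (regs m3) (mSA m3) (mLCP m3)).
  split=> //; last by apply: ext_trans (leqnn d) x1 x3.
    apply: reach_trans r1 _; apply: (@reach_le (1 + (size_expr a + 1))); first by lia.
    apply: (@reach_trans _ _ _ m2).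
      apply: (reach1 h1 p1) => //.
      rewrite /step p1; have [-> ->] := at_nth h1; rewrite v1 hc.
      by rewrite -addn1.
    apply: reach_trans r3 _; apply: (reach1 h3 p3) => //.
    by rewrite /step p3; have [-> ->] := at_nth h3.
  by rewrite /=; lia.
Qed.


Lemma sim_fset s ms k i v p : i < N -> sim s ms ->
  sim (fset k i v s)
      (set_arr (State p (regs ms) (mSA ms) (mLCP ms)) k
               (set_nth 0 (get_arr ms k) i v)).
Proof.
move=> hi [h1 h2 h3 h4 h5]; case: k; split=> //=.
- by rewrite size_set_nth h2; apply/maxn_idPr.
- by move=> j hj; rewrite nth_set_nth /= /upd; case: eqP => // _; exact: h4.
- by rewrite size_set_nth h3; apply/maxn_idPr.
- by move=> j hj; rewrite nth_set_nth /= /upd; case: eqP => // _; exact: h5.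
Qed.

(** The factor is [k.+1] rather than [k] so that straight-line code and the final failing test of a
    loop are paid for as well. *)
Lemma compile_cmd_ok c s k s' : run N tx c s k s' -> forall ms p,
  wf_cmd c -> code_at p (compile_cmd c p) -> sim s ms -> pc ms = p ->
  exists ms', [/\ reach (size_cmd c * k.+1) ms ms', pc ms' = p + size_cmd c & sim s' ms'].
Proof.
elim=> {c s k s'} /=.
- by move=> s ms p _ _ hs hp; exists ms; split=> //; rewrite ?addn0 //; exact: reach0.
- move=> r e s se ms p /andP[hr we] hat hs hp.
  have [m1 [r1 p1 v1 x1]] := compile_expr_ok we (leqnn tmp) (at_catl hat) hs hp se.
  have h3 := at_catr hat; rewrite size_compile_expr in h3.
  exists (setreg m1 r (ev tx e s) (p + size_expr e).+1); split=> //=; last 2 first.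
  + by rewrite addnA addn1.
  + have [z0 z1 z2 z3 z4] := sim_ext (leqnn _) hs x1; split=> //= x hx.
    by rewrite /upd_reg /updr; case: eqP => // _; exact: z0.
  rewrite muln1; apply: reach_trans r1 _; apply: (reach1 h3 p1) => //.
  by rewrite /step p1; have [-> ->] := at_nth h3; rewrite v1.
- move=> k a v s sa sv hN ms p /andP[wa wv] hat hs hp.
  have [m1 [r1 p1 v1 x1]] := compile_expr_ok wa (leqnn tmp) (at_catl hat) hs hp sa.
  have h2 := at_catr hat; rewrite size_compile_expr in h2.
  have s1 := sim_ext (leqnn _) hs x1.
  have [m2 [r2 p2 v2 x2]] := compile_expr_ok wv (leqnSn tmp) (at_catl h2) s1 p1 sv.
  have h3 := at_catr h2; rewrite size_compile_expr in h3.
  have s2 := sim_ext (leqnSn _) s1 x2.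
  have e1 : regs m2 tmp = ev tx a s by case: x2 => -> .
  exists (set_arr (State (p + size_expr a + size_expr v).+1 (regs m2) (mSA m2) (mLCP m2)) k
               (set_nth 0 (get_arr m2 k) (ev tx a s) (ev tx v s))); split=> //.
  + rewrite muln1; apply: reach_trans r1 _; apply: reach_trans r2 _.
    apply: (reach1 h3 p2) => //.
    rewrite /step p2; have [-> ->] := at_nth h3; rewrite e1 v2.
    have [_ z1 z2 _ _] := s2.
    by case: k {h3 h2 hat} => /=; rewrite ?z1 ?z2 hN.
  + by case: k {h3 h2 hat} => /=; lia.
  + exact: sim_fset.
- move=> a b s s1 s2 k1 k2 _ IHa _ IHb ms p /andP[wa wb] hat hs hp.
  have [m1 [r1 p1 x1]] := IHa _ _ wa (at_catl hat) hs hp.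
  have h2 := at_catr hat; rewrite size_compile_cmd in h2.
  have [m2 [r2 p2 x2]] := IHb _ _ wb h2 x1 p1.
  exists m2; split=> //; last by rewrite p2 addnA.
  by apply: reach_le (reach_trans r1 r2); rewrite mulnDl leq_add // leq_mul //; lia.
- move=> e a b s s1 k se he _ IH ms p /and3P[we wa wb] hat hs hp.
  have [m1 [r1 p1 v1 x1]] := compile_expr_ok we (leqnn tmp) (at_catl hat) hs hp se.
  have h1 := at_catr hat; rewrite size_compile_expr in h1.
  have h2 := at_cons h1; rewrite -addn1 in h2.
  have h3 := at_catr h2; rewrite size_compile_cmd in h3.
  pose m2 := State (p + size_expr e + 1) (regs m1) (mSA m1) (mLCP m1).
  have s2 : sim s m2 by have := sim_ext (leqnn _) hs x1.
  have [m3 [r3 p3 x3]] := IH m2 _ wa (at_catl h2) s2 erefl.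
  exists (State (p + size_expr e + 1 + size_cmd a + 1 + size_cmd b) (regs m3) (mSA m3) (mLCP m3)).
  split=> //=; last by lia.
  apply: (@reach_le (size_expr e + (1 + (size_cmd a * k.+1 + 1)))); first by nia.
  apply: reach_trans r1 _; apply: (@reach_trans _ _ _ m2).
    apply: (reach1 h1 p1) => //.
    rewrite /step p1; have [-> ->] := at_nth h1; rewrite v1 (negbTE he).
    by rewrite -addn1.
  apply: reach_trans r3 _; apply: (reach1 h3 p3) => //.
  by rewrite /step p3; have [-> ->] := at_nth h3.
- move=> e a b s s1 k se he _ IH ms p /and3P[we wa wb] hat hs hp.
  have [m1 [r1 p1 v1 x1]] := compile_expr_ok we (leqnn tmp) (at_catl hat) hs hp se.
  have h1 := at_catr hat; rewrite size_compile_expr in h1.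
  have h2 := at_cons h1; rewrite -addn1 in h2.
  have h3 := at_catr h2; rewrite size_compile_cmd in h3.
  have h4 := at_cons h3; rewrite -addn1 in h4.
  pose m2 := State (p + size_expr e + 1 + size_cmd a + 1) (regs m1) (mSA m1) (mLCP m1).
  have s2 : sim s m2 by have := sim_ext (leqnn _) hs x1.
  have [m3 [r3 p3 x3]] := IH m2 _ wb h4 s2 erefl.
  exists m3; split=> //=; last by lia.
  apply: (@reach_le (size_expr e + (1 + size_cmd b * k.+1))); first by nia.
  apply: reach_trans r1 _; apply: reach_trans r3.
  apply: (reach1 h1 p1) => //.
  by rewrite /step p1; have [-> ->] := at_nth h1; rewrite v1 he.
- move=> e a s s1 s2 k1 k2 se he _ IHa _ IHw ms p wf hat hs hp.
  have /andP[we wa] := wf.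
  have [m1 [r1 p1 v1 x1]] := compile_expr_ok we (leqnn tmp) (at_catl hat) hs hp se.
  have h1 := at_catr hat; rewrite size_compile_expr in h1.
  have h2 := at_cons h1; rewrite -addn1 in h2.
  have h3 := at_catr h2; rewrite size_compile_cmd in h3.
  pose m2 := State (p + size_expr e + 1) (regs m1) (mSA m1) (mLCP m1).
  have s2' : sim s m2 by have := sim_ext (leqnn _) hs x1.
  have [m3 [r3 p3 x3]] := IHa m2 _ wa (at_catl h2) s2' erefl.
  pose m4 := State p (regs m3) (mSA m3) (mLCP m3).
  have [m5 [r5 p5 x5]] := IHw m4 _ wf hat x3 erefl.
  exists m5; split=> //.
  apply: (@reach_le (size_expr e + (1 + (size_cmd a * k1.+1 + (1 +
    (size_expr e + (1 + (size_cmd a + 1))) * k2.+1))))); first by nia.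
  apply: reach_trans r1 _; apply: (@reach_trans _ _ _ m2).
    apply: (reach1 h1 p1) => //.
    rewrite /step p1; have [-> ->] := at_nth h1; rewrite v1 (negbTE he).
    by rewrite -addn1.
  apply: reach_trans r3 _; apply: reach_trans r5; apply: (reach1 h3 p3) => //.
  by rewrite /step p3; have [-> ->] := at_nth h3.
- move=> e a s se he ms p /andP[we wa] hat hs hp.
  have [m1 [r1 p1 v1 x1]] := compile_expr_ok we (leqnn tmp) (at_catl hat) hs hp se.
  have h1 := at_catr hat; rewrite size_compile_expr in h1.
  exists (State (p + size_expr e + 1 + size_cmd a + 1) (regs m1) (mSA m1) (mLCP m1)).
  split=> //=; first last.
  + by have := sim_ext (leqnn _) hs x1.
  + by lia.
  apply: (@reach_le (size_expr e + 1)); first by nia.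
  apply: reach_trans r1 _; apply: (reach1 h1 p1) => //.
  by rewrite /step p1; have [-> ->] := at_nth h1; rewrite v1 he.
Qed.

End Compile.

(** [exec] stays put once halted, so every budget [B] above the bound yields the same final state;
    this is what allows a budget depending on the input length only. *)
Lemma machine_run (T : seq nat) w c s k s' ms B :
  size T < 2 ^ w -> wf_cmd c -> sim T s ms -> pc ms = 0 ->
  run (size T) (nth 0 T) c s k s' -> size_cmd c * k.+1 <= B ->
  exists ms', [/\ exec w (compile_cmd c 0 ++ [:: IHalt]) T B ms = Some ms',
    halted (compile_cmd c 0 ++ [:: IHalt]) ms' & sim T s' ms'].
Proof.
move=> hw wf hs hp hr hB; set P := _ ++ _.
have hat : code_at P 0 (compile_cmd c 0) by exists [::], [:: IHalt].
have [ms' [[j hj hx] p' s1]] := compile_cmd_ok hw hr wf hat hs hp.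
have hh : halted P ms'.
  by rewrite /halted p' add0n /P size_cat size_compile_cmd /= addn1 ltnSn nth_cat size_compile_cmd ltnn subnn.
exists ms'; split=> //.
rewrite -(subnKC (leq_trans hj hB)) exec_add hx /=.
by case: (B - j) => //= n; rewrite hh.
Qed.

(** * Weakest preconditions with a time credit *)

Section Wp.
Variables (N : nat) (tx : nat -> nat).
Notation ev := (ev tx).
Notation safe := (safe N tx).
Notation run := (run N tx).

(* [b] is a credit: each loop iteration consumes one unit, and the
   postcondition receives what is left. *)
Definition wp (c : cmd) (Q : nat -> st -> Prop) (b : nat) (s : st) : Prop :=
  exists k s', [/\ run c s k s', k <= b & Q (b - k) s'].

Lemma wp_skip Q b s : Q b s -> wp Skip Q b s.
Proof. by move=> h; exists 0, s; rewrite subn0; split=> //; constructor. Qed.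

Lemma wp_asg r e Q b s : safe e s -> Q b (setr r (ev e s) s) -> wp (Asg r e) Q b s.
Proof.
move=> h1 h2; exists 0, (setr r (ev e s) s).
by rewrite subn0; split=> //; constructor.
Qed.

Lemma wp_sto k a v Q b s : safe a s -> safe v s -> ev a s < N ->
  Q b (fset k (ev a s) (ev v s) s) -> wp (Sto k a v) Q b s.
Proof.
move=> h1 h2 h3 h4; exists 0, (fset k (ev a s) (ev v s) s).
by rewrite subn0; split=> //; constructor.
Qed.

Lemma wp_seq c1 c2 Q b s : wp c1 (wp c2 Q) b s -> wp (Seq c1 c2) Q b s.
Proof.
move=> [k1 [s1 [r1 l1 [k2 [s2 [r2 l2 q]]]]]]; exists (k1 + k2), s2.
by split; [econstructor; eauto | lia | rewrite subnDA].
Qed.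

Lemma wp_if e c1 c2 Q b s : safe e s ->
  (if ev e s == 0 then wp c2 Q b s else wp c1 Q b s) -> wp (If e c1 c2) Q b s.
Proof.
move=> he; case: ifP => h [k [s1 [r l q]]]; exists k, s1; split=> //.
  exact: RIf0.
by apply: RIf1 => //; rewrite h.
Qed.

Lemma wp_conseq (Q R : nat -> st -> Prop) c b s :
  wp c R b s -> (forall b' s', framed c s s' -> R b' s' -> Q b' s') -> wp c Q b s.
Proof.
move=> [k [s' [r l q]]] h; exists k, s'; split=> //.
by apply: h q; exact: run_fr r.
Qed.

(** No separate variant is needed: each iteration lowers the credit, so induction on the credit
    gives termination and the time bound at once. The frame fact is supplied at each iteration and
    need not be part of the invariant. *)
Lemma wp_while (I : nat -> st -> Prop) e c Q b s0 :
  I b s0 ->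
  (forall b s, I b s -> framed c s0 s ->
     safe e s /\ (if ev e s == 0 then Q b s else 0 < b /\ wp c I b.-1 s)) ->
  wp (While e c) Q b s0.
Proof.
move=> hI hstep.
suff H n s b' : b' <= n -> I b' s -> framed c s0 s -> wp (While e c) Q b' s.
  by apply: (H b) => //; exact: fr_refl.
elim: n s b' => [|n IH] s b' hb hI' hf.
  have [he] := hstep _ _ hI' hf; case: ifP => h; last by move=> [h0 _]; lia.
  by move=> q; exists 0, s; rewrite subn0; split=> //; exact: RWhile0.
have [he] := hstep _ _ hI' hf; case: ifP => h.
  by move=> q; exists 0, s; rewrite subn0; split=> //; exact: RWhile0.
move=> [b0 [k [s1 [r1 l1 q1]]]].
have hk : b'.-1 - k <= n by lia.
have [k2 [s2 [r2 l2 q2]]] := IH s1 (b'.-1 - k) hk q1 (fr_trans hf (run_fr r1)).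
exists (k + k2).+1, s2; split.
- by apply: RWhile1 r1 r2 => //; rewrite h.
- by lia.
- by rewrite (_ : b' - _ = b'.-1 - k - k2) //; lia.
Qed.

Definition Loop (x r : nat) (c : cmd) : cmd :=
  While (ELt (EV x) (EV r)) (Seq c (Asg x (EAdd (EV x) (EC 1)))).
Definition For (x r : nat) (c : cmd) : cmd := Seq (Asg x (EC 0)) (Loop x r c).

(** For bodies that hand back all their credit, in effect loop-free ones: the loop then costs its
    number of iterations. *)
Lemma wp_loop x r c (J : nat -> st -> Prop) Q b s0 i0 n :
  rg s0 x = i0 -> rg s0 r = n -> i0 <= n <= N -> x != r -> r \notin mods c ->
  n - i0 <= b ->
  J i0 s0 ->
  (forall i s b', i0 <= i < n -> rg s x = i -> framed (Loop x r c) s0 s -> J i s ->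
     wp c (fun b'' s' => [/\ b' <= b'', rg s' x = i & J i.+1 (setr x i.+1 s')]) b' s) ->
  (forall s b', b - (n - i0) <= b' -> framed (Loop x r c) s0 s -> rg s x = n ->
     J n s -> Q b' s) ->
  wp (Loop x r c) Q b s0.
Proof.
move=> ex er /andP[hi hn] hxr hrm hb hJ hstep hQ.
apply: (@wp_while (fun b' s => exists i, [/\ rg s x = i, i0 <= i <= n,
   b - (i - i0) <= b' & J i s])).
  by exists i0; split=> //; rewrite ?leqnn ?hi // subnn subn0.
move=> b' s [i [exi /andP[h1 h2] hb' hJi]] hf.
have hrg : rg s r = n.
  case: (hf) => -> //=; rewrite mem_cat negb_or hrm /= inE eq_sym.
  exact: hxr.
split=> //=; rewrite exi hrg.
case: (ltnP i n) => hin /=; last first.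
  have e : i = n by lia.
  by rewrite e in exi hb' hJi; exact: hQ.
split; first by lia.
apply: wp_seq; apply: wp_conseq (hstep i s b'.-1 _ exi hf hJi) _.
  by rewrite h1.
move=> b'' s' hf' [hb'' ex' hJ']; apply: wp_asg => /=.
  by rewrite ex'; split=> //; lia.
rewrite ex' addn1; exists i.+1; split=> //; try lia.
by rewrite /= /updr eqxx.
Qed.

Lemma wp_for x r c (J : nat -> st -> Prop) Q b s0 n :
  rg s0 r = n -> n <= N -> x != r -> r \notin mods c ->
  n <= b ->
  J 0 (setr x 0 s0) ->
  (forall i s b', i < n -> rg s x = i -> framed (For x r c) s0 s -> J i s ->
     wp c (fun b'' s' => [/\ b' <= b'', rg s' x = i & J i.+1 (setr x i.+1 s')]) b' s) ->
  (forall s b', b - n <= b' -> framed (For x r c) s0 s -> rg s x = n -> J n s -> Q b' s) ->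
  wp (For x r c) Q b s0.
Proof.
move=> er hn hxr hrm hb hJ hstep hQ.
have hfr s : framed (Loop x r c) (setr x 0 s0) s -> framed (For x r c) s0 s.
  move=> [f1 f2 f3]; split=> //= y; rewrite inE negb_or => h; case/andP: h => hy hy'.
  by rewrite f1 //= /updr (negbTE hy).
apply: wp_seq; apply: wp_asg => //=.
apply: (@wp_loop x r c J _ _ _ 0 n) => //=.
- by rewrite /updr eqxx.
- by rewrite /updr eq_sym (negbTE hxr).
- by lia.
- by move=> i s b' hi ei hf hj; apply: hstep => //; exact: hfr.
- by move=> s b' hb' hf ei hj; apply: hQ => //; [lia | exact: hfr].
Qed.

End Wp.

(** * Counting, buckets and the abstract inducing pass *)

Definition cnt (n : nat) (p : pred nat) : nat := count p (iota 0 n).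

Lemma eq_cnt n (p q : pred nat) : (forall i, i < n -> p i = q i) -> cnt n p = cnt n q.
Proof. by move=> h; apply: eq_in_count => i; rewrite mem_iota => /andP[_ /h]. Qed.

Lemma sub_cnt n (p q : pred nat) : (forall i, i < n -> p i -> q i) -> cnt n p <= cnt n q.
Proof.
move=> h; rewrite /cnt -!size_filter; apply: uniq_leq_size.
  exact: filter_uniq (iota_uniq _ _).
move=> i; rewrite !mem_filter mem_iota => /andP[hp /andP[_ hi]].
by rewrite h.
Qed.

Lemma cnt_le n (p : pred nat) : cnt n p <= n.
Proof. by rewrite /cnt -[X in _ <= X](size_iota 0) count_size. Qed.

Lemma cntS n (p : pred nat) : cnt n.+1 p = cnt n p + p n.
Proof. by rewrite /cnt -addn1 iotaD count_cat /= addn0. Qed.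

Lemma cnt_add n (p q : pred nat) : (forall i, i < n -> ~~ (p i && q i)) ->
  cnt n (fun i => p i || q i) = cnt n p + cnt n q.
Proof.
elim: n => // n IH h; rewrite !cntS IH; last by move=> i hi; apply: h; lia.
by move: (h n (ltnSn n)); case: (p n); case: (q n) => //= _; lia.
Qed.

Lemma cnt1 n i : i < n -> cnt n (fun j => j == i) = 1.
Proof. by move=> hi; rewrite /cnt -/(count_mem i _) count_uniq_mem ?iota_uniq // mem_iota hi. Qed.

Lemma cnt_addone n (p q : pred nat) i : i < n -> ~~ p i ->
  (forall j, j < n -> q j = p j || (j == i)) -> cnt n q = (cnt n p).+1.
Proof.
move=> hi hp hq; rewrite (eq_cnt hq) cnt_add; first by rewrite cnt1 // addn1.
by move=> j _; case: eqP => [->|_]; rewrite ?(negbTE hp) ?andbF.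
Qed.

Section Pass.
Variables (n : nat) (t : nat -> nat).

Definition bkt_start (c : nat) : nat := cnt n (fun i => t i < c).
Definition bkt_num (X : pred nat) (c : nat) : nat := cnt n (fun i => (t i == c) && X i).

Lemma bsS c : bkt_start c.+1 = bkt_start c + cnt n (fun i => t i == c).
Proof.
rewrite -cnt_add; first by apply: eq_cnt => i _; lia.
by move=> i _; lia.
Qed.

Lemma bs_mono c d : c <= d -> bkt_start c <= bkt_start d.
Proof. by move=> h; apply: sub_cnt => i _ hi; lia. Qed.

Lemma bs_le c : bkt_start c <= n. Proof. exact: cnt_le. Qed.

Lemma bs_nb X c : bkt_start c + bkt_num X c <= bkt_start c.+1.
Proof. by rewrite bsS leq_add2l; apply: sub_cnt => i _ /andP[]. Qed.

Lemma bucket_inj y c d : bkt_start c <= y < bkt_start c.+1 -> bkt_start d <= y < bkt_start d.+1 -> c = d.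
Proof.
move=> /andP[h1 h2] /andP[h3 h4]; case: (ltngtP c d) => // h.
  by have := bs_mono h; lia.
by have := bs_mono h; lia.
Qed.

Variables (X : pred nat) (le : nat -> nat -> Prop).

(* [X] is the type (L or mirrored S) whose positions are inserted by the pass,
   the seeds being the positions already in the array. *)
Record pass_law : Prop := PassLaw {
  pl_last : forall i, X i -> i.+1 < n;
  pl_rec : forall i, i.+1 < n ->
    X i = (t i.+1 < t i) || ((t i == t i.+1) && X i.+1);
  pl_lt : forall i j, i < n -> j < n -> t i < t j -> le i j;
  pl_seed : forall i j, i < n -> j < n -> t i = t j -> X i -> ~~ X j -> le i j;
  pl_ind : forall i j, i < n -> j < n -> t i = t j -> X i -> X j ->
    le i.+1 j.+1 -> le i j }.

(** [sd_slot] keeps the first [bkt_num X] slots of each bucket free for insertions. [sd_all] asks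
    only for the seeds that start a chain of insertions, those preceded by a position in [X];
    entries are 1-based, so position [i.+1] appears as [i.+2]. *)
Record seeded (A : nat -> nat) : Prop := Seeded {
  sd_slot : forall y, y < n -> A y != 0 -> exists p,
    [/\ A y = p.+1, p < n, ~~ X p & bkt_start (t p) + bkt_num X (t p) <= y < bkt_start (t p).+1];
  sd_inj : forall y z, y < n -> z < n -> A y != 0 -> A y = A z -> y = z;
  sd_all : forall i, X i -> ~~ X i.+1 -> exists2 y, y < n & A y = i.+2;
  sd_sorted : forall y z p q, y < z -> z < n -> A y = p.+1 -> A z = q.+1 -> le p q }.

Definition placed (A : nat -> nat) (i : nat) : bool :=
  has (fun y => A y == i.+1) (iota 0 n).

Lemma placedP A i : reflect (exists2 y, y < n & A y = i.+1) (placed A i).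
Proof.
apply: (iffP hasP) => [[y]|[y hy e]].
  by rewrite mem_iota => /andP[_ hy] /eqP e; exists y.
by exists y; rewrite ?mem_iota ?e.
Qed.

Variable A0 : nat -> nat.
Hypotheses (HL : pass_law) (HS : seeded A0).

(* [G] is the array after the first [x] slots have been scanned and [h] the
   bucket pointers; [pi_slot] says that the successor of an inserted position was
   scanned before. *)
Record pass_inv (x : nat) (G h : nat -> nat) : Prop := Pinv {
  pi_slot : forall y, y < n -> G y != 0 -> exists p, [/\ G y = p.+1, p < n &
    if X p then bkt_start (t p) <= y < h (t p) /\
                (exists z, [/\ z < y, z < x & G z = p.+2])
    else A0 y = G y];
  pi_seed : forall y, y < n -> A0 y != 0 -> G y = A0 y;
  pi_inj : forall y z, y < n -> z < n -> G y != 0 -> G y = G z -> y = z;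
  pi_ord : forall y1 y2 z1 z2 p1 p2, y1 < y2 -> y2 < n -> z1 < n -> z2 < n ->
    X p1 -> X p2 -> t p1 = t p2 -> G y1 = p1.+1 -> G y2 = p2.+1 ->
    G z1 = p1.+2 -> G z2 = p2.+2 -> z1 < z2;
  pi_done : forall i z, X i -> z < x -> z < n -> G z = i.+2 -> placed G i;
  pi_ptr : forall c, h c = bkt_start c + cnt n (fun i => [&& t i == c, X i & placed G i]) }.

Lemma pinv0 h : (forall c, h c = bkt_start c) -> pass_inv 0 A0 h.
Proof.
move=> hh; split=> //.
- move=> y hy h0; have [p [e hp hX _]] := sd_slot HS hy h0.
  by exists p; rewrite e (negbTE hX); split.
- exact: sd_inj HS.
- move=> y1 y2 z1 z2 p1 p2 hy hn _ _ h1 _ _ e1.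
  have h0 : A0 y1 != 0 by rewrite e1.
  have [p [e hp hX _]] := sd_slot HS (ltn_trans hy hn) h0.
  by move: hX; have -> : p = p1 by [lia]; rewrite h1.
- move=> c; rewrite hh -[LHS]addn0; congr (_ + _); apply/esym/eqP.
  rewrite -leqn0 leqNgt -has_count; apply/hasPn => i _.
  apply/negP => /and3P[_ hX /placedP[y hy e]].
  have h0 : A0 y != 0 by rewrite e.
  have [p [e' hp hX' _]] := sd_slot HS hy h0.
  by move: hX'; have -> : p = i by [lia]; rewrite hX.
Qed.

Section Inv.
Variables (x : nat) (G h : nat -> nat).
Hypothesis HI : pass_inv x G h.

Lemma pinv_ptr_le c : bkt_start c <= h c <= bkt_start c + bkt_num X c.
Proof.
rewrite (pi_ptr HI) leq_addr leq_add2l /=; apply: sub_cnt => i _ /and3P[-> ->] //.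
Qed.

Lemma pinv_bucket y p : y < n -> G y = p.+1 -> bkt_start (t p) <= y < bkt_start (t p).+1.
Proof.
move=> hy e; have h0 : G y != 0 by rewrite e.
have [q [e' hq hh]] := pi_slot HI hy h0.
have eq : q = p by lia.
rewrite {q}eq in e' hq hh; move: hh; have := pinv_ptr_le (t p).
have := bs_nb X (t p); case: ifP => hX.
  by move=> h1 /andP[h2 h3] [/andP[h4 h5] _]; lia.
move=> h1 _ e2; rewrite -e2 in h0.
have [q [e3 hq' _ ]] := sd_slot HS hy h0.
have -> : q = p by lia.
by lia.
Qed.

Hypothesis hx : x < n.

(** Recovers the type of a scanned position from the bucket pointer alone. Inserted positions lie
    below the pointer; seeds lie past all the reserved slots, and the pointer never leaves these. *)
Lemma pinv_test p : G x = p.+1 -> X p = (x < h (t p)).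
Proof.
move=> e; have h0 : G x != 0 by rewrite e.
have [q [e' hq hh]] := pi_slot HI hx h0.
have eq : q = p by lia.
rewrite {q}eq in e' hq hh; move: hh; case: ifP => hX.
  by case=> /andP[_ ->].
move=> e2; rewrite -e2 in h0.
have [q [e3 hq' _ ]] := sd_slot HS hx h0.
have -> : q = p by lia.
have := pinv_ptr_le (t p); lia.
Qed.

Lemma pinv_skip : (forall i, G x = i.+2 -> ~~ X i) -> pass_inv x.+1 G h.
Proof.
move=> hns; split.
- move=> y hy h0; have [p [e hp hh]] := pi_slot HI hy h0; exists p; split=> //.
  by move: hh; case: ifP => // _ [? [z [? ? ?]]]; split=> //; exists z; split=> //; lia.
- exact: pi_seed HI.
- exact: pi_inj HI.
- exact: pi_ord HI.
- move=> i z hX hz hzn e; case: (ltnP z x) => hzx; first exact: (pi_done HI hX hzx hzn e).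
  have ez : z = x by lia.
  by move: (hns i); rewrite -ez e hX => /(_ erefl).
- exact: pi_ptr HI.
Qed.

Variable i : nat.
Hypotheses (hG : G x = i.+2) (hX : X i).

Let hi : i < n. Proof. by have := pl_last HL hX; lia. Qed.

(** An inserted position has its successor in a slot scanned earlier, but the successor of [i] sits
    at [x] itself and entries are distinct. *)
Lemma pinv_unplaced : ~~ placed G i.
Proof.
apply/placedP => -[y hy e]; have h0 : G y != 0 by rewrite e.
have [q [e' hq]] := pi_slot HI hy h0.
have -> : q = i by lia.
rewrite hX => -[_ [z [z1 z2 z3]]].
suff : z = x by lia.
by apply: (pi_inj HI); rewrite ?z3 ?hG //; lia.
Qed.

(** Insertions happen ahead of the scan. If [t i] exceeds the character of the successor, the
    destination is in a later bucket; if both are equal, the successor is in [X] too, and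
    [pinv_test] puts the pointer of this very bucket beyond [x]. As [i] is not placed yet, one of
    the reserved slots is left. *)
Lemma pinv_dst : x < h (t i) < n.
Proof.
have hsn : i.+1 < n by exact: (pl_last HL).
have h1 : h (t i) < bkt_start (t i) + bkt_num X (t i).
  rewrite (pi_ptr HI) ltn_add2l.
  rewrite -(@cnt_addone n _ (fun j => [&& t j == t i, X j & placed G j || (j == i)]) i) //.
  - by apply: sub_cnt => j _ /and3P[-> ->].
  - by rewrite (negbTE pinv_unplaced) !andbF.
  - move=> j _; case: (j =P i) => [->|_]; last by rewrite !orbF.
    by rewrite eqxx hX !orbT.
have := bs_nb X (t i); have := bs_le (t i).+1.
have := pinv_ptr_le (t i) => /andP[h2 _].
have /andP[h3 h4] := pinv_bucket hx hG.
move=> h5 h6; apply/andP; split; last by lia.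
have := pl_rec HL hsn; rewrite hX => /esym/orP[hlt|/andP[/eqP-> hXs]].
  by have := bs_mono hlt; lia.
by rewrite -(pinv_test hG).
Qed.

(** An occupant would belong to the same bucket, where inserted entries are strictly below the
    pointer and seeds beyond the reserved slots. *)
Lemma pinv_dst0 : G (h (t i)) = 0.
Proof.
have /andP[_ hn] := pinv_dst.
apply/eqP; case: eqP => // /eqP h0; exfalso.
have [q [e' hq hh]] := pi_slot HI hn h0.
have hb := pinv_bucket hn e'.
have h1 : h (t i) < bkt_start (t i) + bkt_num X (t i).
  rewrite (pi_ptr HI) ltn_add2l.
  rewrite -(@cnt_addone n _ (fun j => [&& t j == t i, X j & placed G j || (j == i)]) i) //.
  - by apply: sub_cnt => j _ /and3P[-> ->].
  - by rewrite (negbTE pinv_unplaced) !andbF.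
  - move=> j _; case: (j =P i) => [->|_]; last by rewrite !orbF.
    by rewrite eqxx hX !orbT.
have hb2 : bkt_start (t i) <= h (t i) < bkt_start (t i).+1.
  by have := bs_nb X (t i); have := pinv_ptr_le (t i); lia.
have et := bucket_inj hb hb2.
move: hh; rewrite et; case: ifP => _; first by case=> /andP[_]; rewrite ltnn.
move=> e2; rewrite -e2 in h0.
have [q' [e3 hq' _ ]] := sd_slot HS hn h0.
have -> : q' = q by lia.
by rewrite et; lia.
Qed.

Let G' := upd G (h (t i)) i.+1.
Let h' := upd h (t i) (h (t i)).+1.

Let G'old y : y < n -> G y != 0 -> G' y = G y.
Proof.
move=> hy h0; rewrite /G' /upd; case: eqP => // e.
by move: h0; rewrite e pinv_dst0.
Qed.

Let G'inv y p : G' y = p.+1 -> (y = h (t i) /\ p = i) \/ (y != h (t i) /\ G y = p.+1).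
Proof. by rewrite /G' /upd; case: eqP => [->|_]; [left; split=> //; lia | right]. Qed.

Let placed' j : j < n -> placed G' j = placed G j || (j == i).
Proof.
move=> hj; apply/idP/idP.
  case/placedP=> y hy /G'inv[[_ ->]|[_ e]]; first by rewrite eqxx orbT.
  by apply/orP; left; apply/placedP; exists y.
case/orP=> [/placedP[y hy e]|/eqP->].
  by apply/placedP; exists y => //; rewrite G'old ?e.
apply/placedP; exists (h (t i)); first by case/andP: pinv_dst.
by rewrite /G' /upd eqxx.
Qed.

(** The essential clause is [pi_ord]: the new entry lands after all inserted entries of its bucket,
    and its successor, at [x], comes after their successors, which were scanned before. *)
Lemma pinv_put : pass_inv x.+1 G' h'.
Proof.
have /andP[hd1 hd2] := pinv_dst.
have hGx : G' x = i.+2 by rewrite G'old ?hG.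
split.
- move=> y hy; case eG: (G' y) => [|p] // _; exists p; case: (G'inv eG) => [[ey ep]|[ney e]].
    subst p y; split=> //; rewrite hX /h' /upd eqxx.
    have /andP[-> _] := pinv_ptr_le (t i); rewrite ltnSn; split=> //.
    by exists x; split.
  have h0 : G y != 0 by rewrite e.
  have [q [e' hq hh]] := pi_slot HI hy h0.
  have eq : q = p by lia.
  rewrite {q}eq in e' hq hh; split=> //; move: hh; case: ifP => hXp.
    case=> /andP[h1 h2] [z [z1 z2 z3]]; split; last first.
      by exists z; split=> //; [lia | rewrite G'old ?z3 //; lia].
    by rewrite h1 /h' /upd; case: eqP => [ee|_] //=; rewrite -ee; lia.
  by rewrite e.
- move=> y hy h0; rewrite G'old ?(pi_seed HI hy h0) //.
- move=> y z hy hz; case eG: (G' y) => [|p] // _ /esym eG'.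
  case: (G'inv eG) => [[ey ep]|[ney e]]; case: (G'inv eG') => [[ez ep']|[nez e']].
  + by rewrite ey ez.
  + by case/placedP: pinv_unplaced; exists z => //; rewrite e' ep.
  + by case/placedP: pinv_unplaced; exists y => //; rewrite e ep'.
  + by apply: (pi_inj HI) => //; rewrite e.
- move=> y1 y2 z1 z2 p1 p2 hy12 hy2 hz1 hz2 X1 X2 et e1 e2 f1 f2.
  have g1 : G z1 = p1.+2.
    case: (G'inv f1) => [[_ ep]|[_ ->]] //.
    exfalso; case: (G'inv e1) => [[_ ep1]|[ny1 e1']]; first by lia.
    have h0 : G y1 != 0 by rewrite e1'.
    have [q [e' hq]] := pi_slot HI (ltn_trans hy12 hy2) h0.
    have -> : q = p1 by lia.
    rewrite X1 => -[_ [z [k1 k2 k3]]]; case/placedP: pinv_unplaced.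
    by exists z; [lia | rewrite k3; lia].
  have g2 : G z2 = p2.+2.
    case: (G'inv f2) => [[_ ep]|[_ ->]] //.
    exfalso; case: (G'inv e2) => [[_ ep1]|[ny1 e1']]; first by lia.
    have h0 : G y2 != 0 by rewrite e1'.
    have [q [e' hq]] := pi_slot HI hy2 h0.
    have -> : q = p2 by lia.
    rewrite X2 => -[_ [z [k1 k2 k3]]]; case/placedP: pinv_unplaced.
    by exists z; [lia | rewrite k3; lia].
  case: (G'inv e1) => [[ey1 ep1]|[ny1 e1']]; case: (G'inv e2) => [[ey2 ep2]|[ny2 e2']].
  + by lia.
  + exfalso; have h0 : G y2 != 0 by rewrite e2'.
    have [q [e' hq]] := pi_slot HI hy2 h0.
    have -> : q = p2 by lia.
    by rewrite X2 -et ep1 => -[/andP[_ hh] _]; lia.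
  + have h0 : G y1 != 0 by rewrite e1'.
    have [q [e' hq]] := pi_slot HI (ltn_trans hy12 hy2) h0.
    have -> : q = p1 by lia.
    rewrite X1 => -[_ [z [k1 k2 k3]]].
    have -> : z1 = z by apply: (pi_inj HI); rewrite ?g1 ?k3 //; lia.
    have -> : z2 = x by apply: (pi_inj HI); rewrite ?g2 ?ep2 ?hG //; lia.
    by [].
  + exact: (pi_ord HI hy12 hy2 hz1 hz2 X1 X2 et e1' e2' g1 g2).
- move=> j z hXj hz hzn e.
  have hj : j < n by have := pl_last HL hXj; lia.
  rewrite placed' //; case: (ltnP z x) => hzx.
    case: (G'inv e) => [[ez ej]|[nez e']]; first by lia.
    by rewrite (pi_done HI hXj hzx hzn e').
  have ez : z = x by lia.
  by move: e; rewrite ez hGx => -[->]; rewrite eqxx orbT.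
- move=> c; rewrite /h' /upd; case: eqP => [->|nc]; last first.
    rewrite (pi_ptr HI); congr (_ + _); apply: eq_cnt => j hj; rewrite placed' //.
    by case: (j =P i) => [->|]; rewrite ?orbF //; case: eqP => // /esym.
  rewrite (pi_ptr HI) -addnS; congr (_ + _).
  apply/esym/(@cnt_addone _ _ _ i) => //.
    by rewrite (negbTE pinv_unplaced) !andbF.
  move=> j hj; rewrite placed' //; case: (j =P i) => [->|_]; last by rewrite !orbF.
  by rewrite eqxx hX !orbT.
Qed.

End Inv.

Section Final.
Variables (G h : nat -> nat).
Hypothesis HI : pass_inv n G h.

(** Induction from the right: a run of positions in [X] is followed by a seed, and each scanned
    entry has caused the insertion of its predecessor. *)
Lemma pinv_all i : X i -> placed G i.
Proof.
move=> hX; move: {2}(n - i) (leqnn (n - i)) => d.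
elim: d i hX => [|d IH] i hX hd; have hi := pl_last HL hX; first by lia.
case: (boolP (X i.+1)) => hXs.
  have /placedP[y hy e] : placed G i.+1 by apply: IH; lia.
  exact: (pi_done HI hX hy hy e).
have [y hy e] := sd_all HS hX hXs.
by apply: (pi_done HI hX hy hy); rewrite (pi_seed HI hy) e.
Qed.

Lemma pinv_ptr_final c : h c = bkt_start c + bkt_num X c.
Proof.
rewrite (pi_ptr HI); congr (_ + _); apply: eq_cnt => i _.
by case: (boolP (X i)) => hX; rewrite ?(pinv_all hX) ?andbT.
Qed.

(** Induction on the larger slot: two inserted entries of one bucket are compared through their
    successors, which by [pi_ord] stand in the same order in smaller slots. A seed cannot precede an
    inserted entry of its bucket, as it lies beyond the final pointer. *)
Lemma pinv_sorted y z p q : y < z -> z < n -> G y = p.+1 -> G z = q.+1 -> le p q.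
Proof.
move: {2}z (leqnn z) => d; elim: d y z p q => [|d IH] y z p q hd hyz hz ey ez; first by lia.
have hy : y < n by lia.
have hy0 : G y != 0 by rewrite ey.
have hz0 : G z != 0 by rewrite ez.
have [p' [ep hp hhp]] := pi_slot HI hy hy0.
have e1 : p' = p by lia.
rewrite {p'}e1 in ep hp hhp.
have [q' [eq hq hhq]] := pi_slot HI hz hz0.
have e1 : q' = q by lia.
rewrite {q'}e1 in eq hq hhq.
have /andP[b1 b2] := pinv_bucket HI hy ey.
have /andP[b3 b4] := pinv_bucket HI hz ez.
case: (ltngtP (t p) (t q)) => [hlt|hgt|et]; first exact: (pl_lt HL).
  by have := bs_mono hgt; lia.
move: hhp hhq; case: ifP => Xp; case: ifP => Xq.
- move=> [_ [y' [k1 k2 k3]]] [_ [z' [m1 m2 m3]]].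
  apply: (pl_ind HL) => //; apply: (IH y' z') => //; try lia.
  by apply: (pi_ord HI hyz hz _ _ Xp Xq et ey ez k3 m3); lia.
- by move=> _ _; apply: (pl_seed HL); rewrite ?Xq.
- move=> e0 [/andP[_ hzh] _]; exfalso.
  rewrite -e0 in hy0; have [p' [e' _ _]] := sd_slot HS hy hy0.
  have -> : p' = p by lia.
  by rewrite pinv_ptr_final -et in hzh; lia.
- move=> e0 e1; apply: (sd_sorted HS hyz hz); first by rewrite e0.
  by rewrite e1.
Qed.

End Final.
End Pass.

(** * Placing given positions at the front of their buckets *)

Section Place.
Variables (n : nat) (t : nat -> nat) (le : nat -> nat -> Prop).

(** [D] is the set of positions placed so far. The record is instantiated in the mirror, where the
    front of a bucket is its end in the real array. *)
Record place_inv (D : pred nat) (A h : nat -> nat) : Prop := Plinv {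
  pv_ptr : forall c, h c = bkt_start n t c + cnt n (fun i => (t i == c) && D i);
  pv_slot : forall y, y < n -> A y != 0 -> exists p,
    [/\ A y = p.+1, p < n, D p & bkt_start n t (t p) <= y < h (t p)];
  pv_all : forall p, p < n -> D p -> exists2 y, y < n & A y = p.+1;
  pv_inj : forall y z, y < n -> z < n -> A y != 0 -> A y = A z -> y = z;
  pv_sorted : forall y z p q, y < z -> z < n -> A y = p.+1 -> A z = q.+1 ->
    t p = t q -> le p q }.

Lemma plinv0 A h : (forall y, y < n -> A y = 0) -> (forall c, h c = bkt_start n t c) ->
  place_inv pred0 A h.
Proof.
move=> hA hh; split=> //.
- move=> c; rewrite hh -[LHS]addn0; congr (_ + _); apply/esym/eqP.
  by rewrite -leqn0 leqNgt -has_count; apply/hasPn => i _; rewrite andbF.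
- by move=> y hy; rewrite hA.
- by move=> y z hy; rewrite hA.
- by move=> y z p q hyz hz e1; move: e1; rewrite hA //; lia.
Qed.

Lemma plinv_eq D D' A A' h h' : (forall i, i < n -> D i = D' i) ->
  (forall y, y < n -> A y = A' y) -> (forall c, h c = h' c) ->
  place_inv D A h -> place_inv D' A' h'.
Proof.
move=> hD hA hh [p1 p2 p3 p4 p5]; split.
- by move=> c; rewrite -hh p1; congr (_ + _); apply: eq_cnt => i hi; rewrite hD.
- move=> y hy; rewrite -hA // => h0; have [p [e1 e2 e3 e4]] := p2 _ hy h0.
  by exists p; rewrite -hD // -hh.
- by move=> p hp; rewrite -hD // => /(p3 _ hp)[y hy e]; exists y; rewrite -?hA.
- by move=> y z hy hz; rewrite -!hA //; exact: p4.
- move=> y z p q hyz hz; rewrite -!hA //; last by lia.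
  exact: p5.
Qed.

Section Step.
Variables (D : pred nat) (A h : nat -> nat) (p : nat).
Hypotheses (HI : place_inv D A h) (hp : p < n) (hD : ~~ D p).

Let D' i := D i || (i == p).

Lemma plinv_lt : h (t p) < bkt_start n t (t p).+1.
Proof.
rewrite (pv_ptr HI) bsS ltn_add2l.
rewrite -(@cnt_addone n _ (fun i => (t i == t p) && D' i) p) //.
- by apply: sub_cnt => i _ /andP[].
- by rewrite (negbTE hD) andbF.
- by rewrite /D' => j _; case: (j =P p) => [->|]; rewrite ?orbF // eqxx !orbT.
Qed.

Lemma plinv_free : A (h (t p)) = 0.
Proof.
have hl := plinv_lt; have hb := bs_le n t (t p).+1.
apply/eqP; case: eqP => // /eqP h0; exfalso.
have [|q [e hq hDq hs]] := pv_slot HI _ h0; first by lia.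
have h1 : h (t q) <= bkt_start n t (t q).+1.
  by rewrite (pv_ptr HI) bsS leq_add2l; apply: sub_cnt => i _ /andP[].
have : t q = t p.
  apply: (@bucket_inj n t (h (t p))); first by lia.
  rewrite hl (pv_ptr HI); lia.
by move=> e2; move: hs; rewrite e2; lia.
Qed.

Lemma plinv_step : (forall q, q < n -> D q -> t q = t p -> le q p) ->
  place_inv D' (upd A (h (t p)) p.+1) (upd h (t p) (h (t p)).+1).
Proof.
move=> hle; have hl := plinv_lt; have hb := bs_le n t (t p).+1.
have old y : y < n -> A y != 0 -> upd A (h (t p)) p.+1 y = A y.
  by move=> hy h0; rewrite /upd; case: eqP => // e; move: h0; rewrite e plinv_free.
have inv y q : upd A (h (t p)) p.+1 y = q.+1 ->
    (y = h (t p) /\ q = p) \/ (y != h (t p) /\ A y = q.+1).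
  by rewrite /upd; case: eqP => [->|_]; [left; split=> //; lia | right].
have unpl y : y < n -> A y <> p.+1.
  move=> hy e; have h0 : A y != 0 by rewrite e.
  have [q [e' hq hDq _]] := pv_slot HI hy h0.
  by move: hDq hD; have -> : q = p by [lia]; move=> ->.
split.
- move=> c; rewrite /upd; case: eqP => [->|nc].
    rewrite (pv_ptr HI) -addnS; congr (_ + _); apply/esym/(@cnt_addone _ _ _ p) => //.
      by rewrite (negbTE hD) andbF.
    by rewrite /D' => j _; case: (j =P p) => [->|]; rewrite ?orbF // eqxx !orbT.
  rewrite (pv_ptr HI); congr (_ + _); apply: eq_cnt => j hj; rewrite /D'.
  by case: (j =P p) => [->|]; rewrite ?orbF //; case: eqP => // /esym.
- move=> y hy; case e: (upd _ _ _ y) => [|q] // _; exists q.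
  case: (inv _ _ e) => [[ey eq]|[ney e']].
    subst q y; rewrite /D' eqxx orbT /upd eqxx; split=> //.
    by rewrite ltnSn andbT (pv_ptr HI) leq_addr.
  have h0 : A y != 0 by rewrite e'.
  have [q' [e'' hq hDq hs]] := pv_slot HI hy h0.
  have eq : q' = q by lia.
  rewrite {q'}eq in e'' hq hDq hs; split=> //; first by rewrite /D' hDq.
  by rewrite /upd; case: eqP => [e2|_ //]; rewrite e2 in hs *; lia.
- move=> q hq; rewrite /D' => /orP[/(pv_all HI hq)[y hy e]|/eqP->].
    by exists y => //; rewrite old ?e.
  by exists (h (t p)); [lia | rewrite /upd eqxx].
- move=> y z hy hz; case e: (upd _ _ _ y) => [|q] // _ /esym e'.
  case: (inv _ _ e) => [[ey eq]|[ney e1]]; case: (inv _ _ e') => [[ez eq']|[nez e2]].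
  + by rewrite ey ez.
  + by case: (unpl z hz); rewrite e2 eq.
  + by case: (unpl y hy); rewrite e1 eq'.
  + by apply: (pv_inj HI) => //; rewrite e1.
- move=> y z q r hyz hz e e' et.
  case: (inv _ _ e) => [[ey eq]|[ney e1]]; case: (inv _ _ e') => [[ez eq']|[nez e2]].
  + by lia.
  + exfalso; have h0 : A z != 0 by rewrite e2.
    have [q' [e3 hq' hDq hs]] := pv_slot HI hz h0.
    have eq' : q' = r by lia.
    by move: hs; rewrite eq' -et eq; lia.
  + have h0 : A y != 0 by rewrite e1.
    have [q' [e3 hq' hDq hs]] := pv_slot HI (ltn_trans hyz hz) h0.
    have eq : q' = q by lia.
    by rewrite eq'; apply: hle; rewrite -?eq // eq et eq'.
  + exact: (pv_sorted HI hyz hz e1 e2).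
Qed.
End Step.
End Place.

(** * Buckets of the mirrored alphabet *)

Definition cmpl (n : nat) (t : nat -> nat) (i : nat) : nat := n - t i + 1.

Section Compl.
Variables (n : nat) (t : nat -> nat).
Hypothesis ht : forall i, i < n -> 1 <= t i <= n.

Lemma cnt_compl (p : pred nat) : cnt n (fun i => ~~ p i) = n - cnt n p.
Proof.
have := count_predC p (iota 0 n); rewrite size_iota /cnt.
rewrite (@eq_count _ (predC p) (fun i => ~~ p i)) //; lia.
Qed.

Lemma bs_cmpl p : p < n -> bkt_start n (cmpl n t) (cmpl n t p) = n - bkt_start n t (t p).+1.
Proof.
move=> hp; rewrite /bkt_start -cnt_compl; apply: eq_cnt => i hi.
by have := ht hi; have := ht hp; rewrite /cmpl; lia.
Qed.

Lemma bsS_cmpl p : p < n -> bkt_start n (cmpl n t) (cmpl n t p).+1 = n - bkt_start n t (t p).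
Proof.
move=> hp; rewrite /bkt_start -cnt_compl; apply: eq_cnt => i hi.
by have := ht hi; have := ht hp; rewrite /cmpl; lia.
Qed.

Lemma cnt_cmpl p (X : pred nat) : p < n ->
  cnt n (fun i => (cmpl n t i == cmpl n t p) && X i) =
  cnt n (fun i => (t i == t p) && X i).
Proof.
move=> hp; apply: eq_cnt => i hi; congr (_ && _).
by have := ht hi; have := ht hp; rewrite /cmpl; lia.
Qed.

End Compl.

(** * Suffix types and keys *)

Section Types.
Variables (n : nat) (t : nat -> nat).

(** The fuel is the distance to the last position; its default value [true] makes the last position
    S-type, as usual for a sentinel. *)
Fixpoint styp_fuel (d i : nat) : bool :=
  if d is d'.+1 then (t i < t i.+1) || ((t i == t i.+1) && styp_fuel d' i.+1) else true.
Definition styp (i : nat) : bool := styp_fuel (n.-1 - i) i.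
Definition lms (i : nat) : bool := [&& 0 < i, i < n, styp i & ~~ styp i.-1].
(** With the type as low bit, S exceeds L at equal characters, which is the true order of such
    suffixes. *)
Definition ecode (i : nat) : nat := (t i) * 2 + styp i.

(* [key stop i] is the sequence of codes of [i, i+1, ...], up to and including
   the first position after [i] satisfying [stop]: the code of an LMS substring
   when [stop] is [lms], of a whole suffix when it is [pred0]. *)
Fixpoint key_fuel (stop : pred nat) (d i : nat) : seq nat :=
  ecode i :: if d is d'.+1 then
    (if stop i.+1 then [:: ecode i.+1] else key_fuel stop d' i.+1) else [::].
Definition key stop i := key_fuel stop (n.-1 - i) i.
(** The key of the L pass. A stopping position is cut after its first code, because LMS positions
    enter that pass in arbitrary order inside a bucket when [stop] is [lms]. *)
Definition key1 (stop : pred nat) i := if stop i then [:: ecode i] else key stop i.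

Lemma stypE i : i.+1 < n ->
  styp i = (t i < t i.+1) || ((t i == t i.+1) && styp i.+1).
Proof. by move=> hi; rewrite /styp (_ : n.-1 - i = (n.-1 - i.+1).+1) //; lia. Qed.

Lemma styp_last : styp n.-1.
Proof. by rewrite /styp subnn. Qed.

Lemma keyE stop i : i.+1 < n -> key stop i = ecode i :: key1 stop i.+1.
Proof. by move=> hi; rewrite /key1 /key (_ : n.-1 - i = (n.-1 - i.+1).+1) //; lia. Qed.

Lemma key_last stop : key stop n.-1 = [:: ecode n.-1].
Proof. by rewrite /key subnn. Qed.

Lemma key_cons stop i : exists u, key stop i = ecode i :: u.
Proof. by rewrite /key; case: (n.-1 - i) => [|d] /=; eexists. Qed.

Lemma key1_cons stop i : exists u, key1 stop i = ecode i :: u.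
Proof. by rewrite /key1; case: ifP => _; [exists [::] | exact: key_cons]. Qed.

End Types.

(** The shape of text common to all levels. The alphabet is bounded by the length, so [n] bucket
    pointers always suffice. *)
Record vtext (n : nat) (t : nat -> nat) : Prop := VText {
  vt_pos : 0 < n;
  vt_rng : forall i, i < n -> 1 <= t i <= n;
  vt_last : forall i, i < n -> (t i == 1) = (i == n.-1) }.

Lemma lex_lt_irr s : lex_lt s s = false.
Proof. by elim: s => //= a s ->; rewrite ltnn andbF. Qed.

Lemma lex_lt_trans b a c : lex_lt a b -> lex_lt b c -> lex_lt a c.
Proof.
elim: a b c => [|x a IH] [|y b] [|z c] //=.
case/orP=> [h1|/andP[/eqP-> h1]] /orP[h2|/andP[/eqP e h2]].
- by rewrite (ltn_trans h1 h2).
- by rewrite -e h1.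
- by rewrite h2.
- by rewrite e eqxx (IH _ _ h1 h2) orbT.
Qed.

Lemma lex_lt_total a b : lex_lt a b = false -> lex_lt b a = false -> a = b.
Proof.
elim: a b => [|x a IH] [|y b] //= /norP[h1 h2] /norP[h3 h4].
have e : x = y by lia.
by move: h2 h4; rewrite e eqxx /= => /negbTE h2 /negbTE h4; rewrite (IH b).
Qed.

Lemma lex_lt_asym a b : lex_lt a b -> lex_lt b a = false.
Proof.
move=> h; apply/negP => h'; have := lex_lt_trans h h'.
by rewrite lex_lt_irr.
Qed.

Definition lex_le a b := ~~ lex_lt b a.

Lemma lex_le_refl a : lex_le a a.
Proof. by rewrite /lex_le lex_lt_irr. Qed.

Lemma lex_le_cons x a b : lex_le (x :: a) (x :: b) = lex_le a b.
Proof. by rewrite /lex_le /= ltnn eqxx. Qed.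

Lemma lex_le_head x y a b : x < y -> lex_le (x :: a) (y :: b).
Proof. by move=> h; rewrite /lex_le /= negb_or negb_and -leqNgt; lia. Qed.

Lemma lex_le_trans b a c : lex_le a b -> lex_le b c -> lex_le a c.
Proof.
rewrite /lex_le => h1 h2; apply/negP => h.
case hab: (lex_lt a b).
  by move: h2; rewrite (lex_lt_trans h hab).
by move: h2; rewrite -(lex_lt_total hab (negbTE h1)) h.
Qed.

(** * L types and mirrored S types obey the pass laws *)

Section Laws.
Variables (n : nat) (t : nat -> nat) (stop : pred nat).
Hypothesis HT : vtext n t.
Hypothesis Hstop : forall i, stop i -> lms n t i.

Notation S := (styp n t).
Notation e := (ecode n t).
Notation K := (key n t stop).
Notation K1 := (key1 n t stop).

Definition ltyp i := (i < n) && ~~ S i.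
(** The last position is excluded since an inserted position needs a successor; it is put into the
    array by hand between the two passes. *)
Definition styp' i := (i.+1 < n) && S i.
Definition le1 i j := lex_le (K1 i) (K1 j) : Prop.
Definition le2 i j := lex_le (K i) (K j) : Prop.

Lemma ltyp_last i : ltyp i -> i.+1 < n.
Proof.
case/andP=> h1; case: (ltnP i.+1 n) => // h; have -> : i = n.-1 by lia.
by rewrite styp_last.
Qed.

Lemma lms_styp i : lms n t i -> S i. Proof. by case/and4P. Qed.

Lemma stop_ltyp i : ltyp i -> stop i = false.
Proof. by case/andP=> _ h; apply/negP => /Hstop/lms_styp; rewrite (negbTE h). Qed.

Lemma stop_next i : S i -> stop i.+1 = false.
Proof. by move=> h; apply/negP => /Hstop /and4P[_ _ _] /=; rewrite h. Qed.

Lemma le1_lt i j : t i < t j -> le1 i j.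
Proof.
move=> h; rewrite /le1; have [u ->] := key1_cons n t stop i.
have [v ->] := key1_cons n t stop j.
by apply: lex_le_head; rewrite /ecode; lia.
Qed.

Lemma le2_lt i j : t i < t j -> le2 i j.
Proof.
move=> h; rewrite /le2; have [u ->] := key_cons n t stop i.
have [v ->] := key_cons n t stop j.
by apply: lex_le_head; rewrite /ecode; lia.
Qed.

(** An L-type position is never a stop, so its [key1] unfolds to its code followed by the [key1] of
    the successor, which is what [pl_ind] requires. *)
Lemma law_fwd : pass_law n t ltyp le1.
Proof.
split.
- exact: ltyp_last.
- move=> i hi; rewrite /ltyp stypE //.
  have -> : i < n by lia.
  by rewrite hi /=; case: (S i.+1) => /=; rewrite ?andbT ?andbF; lia.
- by move=> i j _ _; exact: le1_lt.
- move=> i j hi hj et /andP[_ Li]; rewrite /ltyp hj negbK => Sj; rewrite /le1.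
  have [u ->] := key1_cons n t stop i; have [v ->] := key1_cons n t stop j.
  by apply: lex_le_head; rewrite /ecode et Sj (negbTE Li); lia.
- move=> i j _ _ et Li Lj h; rewrite /le1 /key1 !stop_ltyp // !keyE ?ltyp_last //.
  have -> : e i = e j.
    by case/andP: Li => _ /negbTE Li; case/andP: Lj => _ /negbTE Lj; rewrite /ecode et Li Lj.
  by rewrite lex_le_cons.
Qed.

(** Complementing the characters reverses the order, hence [le2 j i]. The position after an S-type
    one is never LMS, so [key1] and [key] agree on it and the order by [key] is inherited from the
    successors. *)
Lemma law_bwd : pass_law n (cmpl n t) styp' (fun i j => le2 j i).
Proof.
have hr := vt_rng HT.
split.
- by move=> i /andP[].
- move=> i hi; rewrite /styp' stypE // hi /cmpl.
  have h1 := hr i (ltnW hi); have h2 := hr _ hi.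
  have -> : (n - t i.+1 + 1 < n - t i + 1) = (t i < t i.+1) by lia.
  have -> : (n - t i + 1 == n - t i.+1 + 1) = (t i == t i.+1) by lia.
  rewrite /=; case: (ltnP i.+2 n) => //= h3.
  (* The successor is the last position, S-type but outside [styp']. This does no harm: its
     character 1 differs from [t i], so the clause for equal characters is void. *)
  rewrite andbF orbF (_ : i.+1 = n.-1); last by lia.
  have := vt_last HT (ltnW hi); have := vt_last HT hi.
  have -> : i.+1 == n.-1 by lia.
  have -> : i == n.-1 = false by lia.
  move=> /eqP e1 e2; have -> : n.-1 = i.+1 by lia.
  by rewrite e1 e2; case: (t i) e2 h1 => //; lia.
- by move=> i j hi hj h; apply: le2_lt; have := hr _ hi; have := hr _ hj; move: h; rewrite /cmpl; lia.
- move=> i j hi hj et /andP[hi2 Si]; rewrite /styp' negb_and => hS.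
  have et' : t i = t j by have := hr _ hi; have := hr _ hj; move: et; rewrite /cmpl; lia.
  have Sj : ~~ S j.
    case/orP: hS => // h; have := vt_last HT hj; have := vt_last HT hi.
    rewrite et'; have -> : j == n.-1 by lia.
    by move=> -> /eqP h'; lia.
  rewrite /le2; have [u ->] := key_cons n t stop i; have [v ->] := key_cons n t stop j.
  by apply: lex_le_head; rewrite /ecode et' Si (negbTE Sj); lia.
- move=> i j hi hj et /andP[hi2 Si] /andP[hj2 Sj] h; rewrite /le2 !keyE //.
  have et' : t i = t j by have := hr _ hi; have := hr _ hj; move: et; rewrite /cmpl; lia.
  have -> : e i = e j by rewrite /ecode et' Si Sj.
  by rewrite lex_le_cons /key1 !stop_next.
Qed.

End Laws.

Definition sa_ok (n : nat) (le : nat -> nat -> Prop) (A : nat -> nat) : Prop :=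
  perm_eq (mkseq A n) (iota 1 n) /\
  (forall y z, y < z < n -> le (A y).-1 (A z).-1).

Lemma sa_val n le A y : sa_ok n le A -> y < n -> 1 <= A y <= n.
Proof.
move=> [hp _] hy; have : A y \in mkseq A n by apply: map_f; rewrite mem_iota.
by rewrite (perm_mem hp) mem_iota; lia.
Qed.

Lemma sa_inj n le A y z : sa_ok n le A -> y < n -> z < n -> A y = A z -> y = z.
Proof.
move=> [hp _] hy hz e.
have hu : uniq (mkseq A n) by rewrite (perm_uniq hp) iota_uniq.
have h := nth_uniq 0 (s := mkseq A n) (i := y) (j := z).
rewrite size_mkseq !nth_mkseq // in h.
by move: (h hy hz hu); rewrite e eqxx => /esym/eqP.
Qed.

Lemma sa_all n le A p : sa_ok n le A -> p < n -> exists2 y, y < n & A y = p.+1.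
Proof.
move=> [hp _] hy; have : p.+1 \in iota 1 n by rewrite mem_iota; lia.
by rewrite -(perm_mem hp) => /mapP[y]; rewrite mem_iota => /andP[_ h] e; exists y.
Qed.

(** Pigeonhole: [n] slots that cover [n] values cover each of them once. *)
Lemma perm_of_all n A : (forall p, p < n -> exists2 y, y < n & A y = p.+1) ->
  perm_eq (mkseq A n) (iota 1 n).
Proof.
move=> h; have hs : {subset iota 1 n <= mkseq A n}.
  move=> v; rewrite mem_iota => hv.
  have [|y hy e] := h v.-1; first by lia.
  by apply/mapP; exists y; rewrite ?mem_iota // e; lia.
have hz : size (mkseq A n) <= size (iota 1 n) by rewrite size_mkseq size_iota.
have [e1 e2] := uniq_min_size (iota_uniq _ _) hs hz.
apply: uniq_perm; [| exact: iota_uniq | by move=> v; rewrite e2].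
by rewrite (uniq_size_uniq (iota_uniq 1 n)) // size_mkseq size_iota.
Qed.

(** * The two passes together sort all positions *)

Section Induce.
Variables (n : nat) (t : nat -> nat) (stop : pred nat).
Hypothesis HT : vtext n t.
Hypothesis Hstop : forall i, stop i -> lms n t i.

Notation L := (ltyp n t).
Notation S' := (styp' n t).
Notation t' := (cmpl n t).
Notation le1 := (le1 n t stop).
Notation le2 := (le2 n t stop).
Let hr := vt_rng HT.

(** L and LMS positions of a bucket are disjoint, so LMS positions packed at its end leave the front
    free for all L ones. *)
Lemma seeded_fwd A A' h' :
  place_inv n t' (fun i j => le1 j i) (lms n t) A' h' ->
  (forall y, y < n -> A y = A' (n.-1 - y)) ->
  seeded n t L le1 A.
Proof.
move=> HP hA.
have slot y p : y < n -> A y = p.+1 ->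
    [/\ p < n, lms n t p & bkt_start n t (t p) + bkt_num n t L (t p) <= y < bkt_start n t (t p).+1].
  move=> hy e; rewrite hA // in e.
  have h0 : A' (n.-1 - y) != 0 by rewrite e.
  have [|q [e' hq hD]] := pv_slot HP _ h0; first by lia.
  have eq : q = p by lia.
  rewrite {q}eq in e' hq hD *; rewrite (pv_ptr HP) cnt_cmpl // bs_cmpl // => hs.
  split=> //; have : bkt_num n t L (t p) + cnt n (fun i => (t i == t p) && lms n t i)
      <= cnt n (fun i => t i == t p).
    rewrite /bkt_num -cnt_add; first by apply: sub_cnt => i _; case: (_ == _).
    move=> i _; rewrite /ltyp /lms; case: (styp n t i); by rewrite /= ?andbF.
  by have := bsS n t (t p); have := bs_le n t (t p).+1; lia.
split.
- move=> y hy; case e: (A y) => [|p] // _; exists p.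
  have [h1 h2 h3] := slot _ _ hy e; split=> //.
  by rewrite /ltyp (lms_styp h2) andbF.
- move=> y z hy hz; rewrite !hA // => h0 e.
  have := pv_inj HP _ _ h0 e; lia.
- move=> i Li hns; have hi := ltyp_last Li.
  have hl : lms n t i.+1.
    by move: hns Li; rewrite /ltyp /lms hi /= negbK => -> /andP[_ ->].
  have [y hy e] := pv_all HP hi hl.
  exists (n.-1 - y); first by lia.
  rewrite hA; last by lia.
  by rewrite (_ : n.-1 - (n.-1 - y) = y) //; lia.
- move=> y z p q hyz hz ep eq.
  have [p1 p2 p3] := slot _ _ (ltn_trans hyz hz) ep.
  have [q1 q2 q3] := slot _ _ hz eq.
  case: (ltngtP (t p) (t q)) => [hlt|hgt|et]; first exact: le1_lt.
    by have := bs_mono n t hgt; lia.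
  rewrite hA in ep; last by lia.
  rewrite hA // in eq; apply: (pv_sorted HP _ _ eq ep); try lia.
  by rewrite /cmpl et.
Qed.

(** The array between the passes: the L entries, and in slot 0, the whole bucket of character 1, the
    last position. *)
Definition mid_array (G : nat -> nat) (y : nat) : nat :=
  if y == 0 then n else if (G y != 0) && L (G y).-1 then G y else 0.

(** L entries never occupy slot 0, since their characters exceed 1 and the bucket of 1 has size one.
    The second conjunct supplies the positions that the S pass does not insert, so that its result
    is a full permutation. *)
Lemma seeded_bwd A0 G h : seeded n t L le1 A0 -> pass_inv n t L A0 n G h ->
  seeded n t' S' (fun i j => le2 j i) (fun y => mid_array G (n.-1 - y)) /\
  (forall p, p < n -> ~~ S' p -> exists2 y, y < n & mid_array G (n.-1 - y) = p.+1).
Proof.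
move=> HS HI; have HL := law_fwd Hstop; have hn := vt_pos HT.
have t1 p : p < n -> p != n.-1 -> 1 < t p.
  by move=> hp hne; have := hr hp; have := vt_last HT hp; rewrite (negbTE hne); lia.
have tl : t n.-1 = 1 by apply/eqP; rewrite (vt_last HT) //; lia.
have b1 : bkt_start n t 1 = 0.
  apply/eqP; rewrite -leqn0 leqNgt -has_count; apply/hasPn => i.
  by rewrite mem_iota => /andP[_ /hr]; lia.
have b2 : bkt_start n t 2 = 1.
  rewrite -[RHS](@cnt1 n n.-1); last by lia.
  by apply: eq_cnt => i hi; have := vt_last HT hi; have := hr hi; lia.
have lastL : L n.-1 = false by rewrite /ltyp styp_last andbF.
have lastS : S' n.-1 = false by rewrite /styp' (_ : n.-1.+1 < n = false) //; lia.
have lslot y p : y < n -> G y = p.+1 -> L p -> bkt_start n t (t p) <= y < bkt_start n t (t p) + bkt_num n t L (t p).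
  move=> hy e Lp; have h0 : G y != 0 by rewrite e.
  have [q [e' hq]] := pi_slot HI hy h0.
  have -> : q = p by lia.
  by rewrite Lp (pinv_ptr_final HL HS HI); case.
have midE y p : y < n -> mid_array G y = p.+1 ->
    (y = 0 /\ p = n.-1) \/ [/\ 0 < y, G y = p.+1, L p & p < n].
  rewrite /mid_array => hy; case: eqP => [-> e|/eqP y0]; first by left; split=> //; lia.
  case: ifP => // /andP[h0 hL] e; right; rewrite e in hL *; split=> //; first by lia.
  by case/andP: hL.
have hL y p : y < n -> G y = p.+1 -> L p -> 0 < y.
  move=> hy e Lp; have := lslot _ _ hy e Lp.
  have hp : p < n by case/andP: Lp.
  have hne : p != n.-1 by apply/eqP => e2; rewrite e2 lastL in Lp.
  by have := bs_mono n t (t1 _ hp hne); rewrite b2; lia.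
have allp p : p < n -> ~~ S' p -> exists2 y, y < n & mid_array G y = p.+1.
  move=> hp hS; case: (p =P n.-1) => [->|/eqP hne].
    by exists 0 => //; rewrite /mid_array /=; lia.
  have Lp : L p.
    by move: hS; rewrite /styp' /ltyp hp negb_and /=; case/orP=> //; lia.
  have /placedP[y hy e] := pinv_all HL HS HI Lp.
  exists y => //; rewrite /mid_array e /= Lp.
  by have := hL _ _ hy e Lp; case: y {hy e}.
split; last first.
  move=> p hp hS; have [y hy e] := allp p hp hS; exists (n.-1 - y); first by lia.
  by rewrite (_ : n.-1 - _ = y) //; lia.
split.
- move=> y hy; case e: (mid_array _ _) => [|p] // _; exists p.
  have hy' : n.-1 - y < n by lia.
  case: (midE _ _ hy' e) => [[y0 ep]|[y0 eG Lp hp]].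
    subst p; rewrite lastS; split=> //; first by lia.
    rewrite bs_cmpl ?bsS_cmpl ?tl ?b1 ?b2 //; try lia.
    rewrite (_ : bkt_num _ _ _ _ = 0); first by lia.
    apply/eqP; rewrite -leqn0 leqNgt -has_count; apply/hasPn => i.
    rewrite mem_iota => /andP[_ hi]; apply/negP => /andP[/eqP e1 /andP[hi2 _]].
    have : t i == 1 by rewrite /cmpl tl in e1; have := hr hi; lia.
    by rewrite (vt_last HT) //; lia.
  have := lslot _ _ hy' eG Lp => hsl.
  split=> //; first by rewrite /styp' negb_and; case/andP: Lp => _ ->; rewrite orbT.
  rewrite /bkt_num bs_cmpl ?bsS_cmpl ?cnt_cmpl //.
  have hne : p != n.-1 by apply/eqP => e2; rewrite e2 lastL in Lp.
  have := t1 _ hp hne => tp.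
  have : cnt n (fun i => t i == t p) = bkt_num n t L (t p) + cnt n (fun i => (t i == t p) && S' i).
    rewrite /bkt_num -cnt_add.
      apply: eq_cnt => i hi; case: eqP => //= et; apply/esym.
      rewrite /ltyp /styp' hi /=; case: (styp n t i) => //=; rewrite andbT.
      by have := vt_last HT hi; rewrite et; lia.
    by move=> i _; rewrite /ltyp /styp'; case: (styp n t i); rewrite ?andbF.
  have := bsS n t (t p); have := bs_le n t (t p).+1; lia.
- move=> y z hy hz; case e: (mid_array G (n.-1 - y)) => [|p] // _ /esym e'.
  have hy' : n.-1 - y < n by lia.
  have hz' : n.-1 - z < n by lia.
  case: (midE _ _ hy' e) => [[y0 ep]|[y0 eG Lp hp]];
    case: (midE _ _ hz' e') => [[z0 ep']|[z0 eG' Lp' hp']]; try lia.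
  + by move: Lp'; rewrite ep lastL.
  + by move: Lp; rewrite ep' lastL.
  + have : n.-1 - y = n.-1 - z by apply: (pi_inj HI); rewrite ?eG.
    by lia.
- move=> i hS hnS; have hi : i.+1 < n by case/andP: hS.
  have [y hy e] := allp _ hi hnS; exists (n.-1 - y); first by lia.
  by rewrite (_ : n.-1 - _ = y) //; lia.
- move=> y z p q hyz hz ep eq.
  have hy' : n.-1 - y < n by lia.
  have hz' : n.-1 - z < n by lia.
  case: (midE _ _ hy' ep) => [[y0 e1]|[y0 eG Lp hp]]; first by lia.
  case: (midE _ _ hz' eq) => [[z0 e2]|[z0 eG' Lp' hp']].
    apply: le2_lt; rewrite e2 tl; apply: t1 => //.
    by apply/eqP => e3; rewrite e3 lastL in Lp.
  have := pinv_sorted HL HS HI _ hy' eG' eG; rewrite /le1 /key1 !(stop_ltyp Hstop) //.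
  by apply; lia.
Qed.

(** The second conjunct is the type information surviving the passes: the final S pointers separate
    the types in each bucket. [compact] finds the LMS positions by it. *)
Lemma sa_final A0 G h : seeded n t' S' (fun i j => le2 j i) A0 ->
  (forall p, p < n -> ~~ S' p -> exists2 y, y < n & A0 y = p.+1) ->
  pass_inv n t' S' A0 n G h ->
  sa_ok n le2 (fun y => G (n.-1 - y)) /\
  (forall y p, y < n -> G (n.-1 - y) = p.+1 -> S' p = (n.-1 - y < h (t' p))).
Proof.
move=> HS hall HI; have HL := law_bwd HT Hstop.
have hn := vt_pos HT.
have pall p : p < n -> exists2 y, y < n & G (n.-1 - y) = p.+1.
  move=> hp; have [y hy e] : exists2 y, y < n & G y = p.+1.
    case: (boolP (S' p)) => hS; first exact/placedP/(pinv_all HL HS HI).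
    have [y hy e] := hall _ hp hS; exists y => //.
    by rewrite (pi_seed HI hy) e.
  by exists (n.-1 - y); [lia | rewrite (_ : n.-1 - _ = y) //; lia].
have hperm := perm_of_all pall.
split; last first.
  move=> y p hy e; have hy' : n.-1 - y < n by lia.
  have h0 : G (n.-1 - y) != 0 by rewrite e.
  have [q [e' hq]] := pi_slot HI hy' h0.
  have -> : q = p by lia.
  case: ifP => Sp; first by case=> /andP[_ ->].
  move=> e2; rewrite -e2 in h0; have [q' [e3 hq' _]] := sd_slot HS hy' h0.
  have -> : q' = p by lia.
  by rewrite (pinv_ptr_final HL HS HI); lia.
split=> // y z hyz.
have val x : x < n -> exists p, G (n.-1 - x) = p.+1.
  move=> hx; have : G (n.-1 - x) \in mkseq (fun y => G (n.-1 - y)) n.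
    by apply/mapP; exists x; rewrite ?mem_iota.
  by rewrite (perm_mem hperm) mem_iota; case: (G _) => // p _; exists p.
have [|p ep] := val y; first by lia.
have [|q eq] := val z; first by lia.
rewrite ep eq /=; apply: (pinv_sorted HL HS HI _ _ eq ep); lia.
Qed.

End Induce.

(** * The reduced text and the order of suffixes *)

Lemma cntD0 (p : pred nat) a d : (forall k, a <= k < a + d -> ~~ p k) -> cnt (a + d) p = cnt a p.
Proof.
elim: d => [|d IH] h; first by rewrite addn0.
rewrite addnS cntS IH; last by move=> k hk; apply: h; lia.
by rewrite (negbTE (h (a + d) _)) ?addn0 //; lia.
Qed.

Lemma cnt_mono (p : pred nat) a b : a <= b -> cnt a p <= cnt b p.
Proof.
move=> h; rewrite -(subnKC h); elim: (b - a) => [|d IH]; first by rewrite addn0.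
by rewrite addnS cntS; lia.
Qed.

Lemma lex_lt_cat p a b : lex_lt (p ++ a) (p ++ b) = lex_lt a b.
Proof. by elim: p => //= x p ->; rewrite ltnn eqxx. Qed.

Definition suffix_from (n : nat) (t : nat -> nat) (i : nat) : seq nat :=
  [seq t k | k <- iota i (n - i)].
Definition suffix_le n t i j := lex_le (suffix_from n t i) (suffix_from n t j) : Prop.

Lemma psufE n t i : i < n -> suffix_from n t i = t i :: suffix_from n t i.+1.
Proof. by move=> h; rewrite /suffix_from (_ : n - i = (n - i.+1).+1) //; lia. Qed.

Section Reduce.
Variables (n : nat) (t : nat -> nat).
Hypothesis HT : vtext n t.

Notation S := (styp n t).
Notation e := (ecode n t).
Notation lm := (lms n t).
Notation full := (key n t pred0).
Notation kl := (key n t lm).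

Lemma ecode_inj i j : e i = e j -> t i = t j /\ S i = S j.
Proof. by rewrite /ecode; case: (S i); case: (S j) => h; split => //; lia. Qed.

Lemma fullE i : i.+1 < n -> full i = e i :: full i.+1.
Proof. by move=> h; rewrite keyE. Qed.

Lemma last_eq i : i < n -> t i = 1 -> i = n.-1.
Proof. by move=> hi h; apply/eqP; rewrite -(vt_last HT hi) h. Qed.

Lemma same_next i j : i < n -> j < n -> i != j -> t i = t j -> i.+1 < n /\ j.+1 < n.
Proof.
move=> hi hj hne et; have := vt_last HT hi; have := vt_last HT hj.
by rewrite et => ->; lia.
Qed.

(** Adding types does not alter the order of suffixes. At equal first characters the successors are
    ordered by induction, so their first codes are too, and by [stypE] a larger code of the
    successor can only turn L into S. *)
Lemma psuf_full i j : i < n -> j < n ->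
  lex_lt (suffix_from n t i) (suffix_from n t j) -> lex_lt (full i) (full j).
Proof.
move: {2}(n - i) (leqnn (n - i)) => d; elim: d i j => [|d IH] i j hd hi hj; first by lia.
case: (i =P j) => [->|/eqP hne]; first by rewrite lex_lt_irr.
rewrite (psufE t hi) (psufE t hj) /=; case/orP=> [hlt|/andP[/eqP et hs]].
  have [u ->] := key_cons n t pred0 i; have [v ->] := key_cons n t pred0 j.
  by rewrite /= /ecode; have -> : t i * 2 + S i < t j * 2 + S j by lia.
have [hi2 hj2] := same_next hi hj hne et.
have {IH hs} := IH i.+1 j.+1 _ hi2 hj2 hs; rewrite (fullE hi2) (fullE hj2) => /(_ ltac:(lia)) hf.
have hle : e i.+1 <= e j.+1.
  move: hf; have [u ->] := key_cons n t pred0 i.+1; have [v ->] := key_cons n t pred0 j.+1.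
  by move=> /=; lia.
have hee : e i <= e j.
  move: hle; rewrite /ecode et (stypE t hi2) (stypE t hj2) et.
  by case: (S i.+1); case: (S j.+1); lia.
move=> /=; rewrite hf andbT; lia.
Qed.

Lemma full_ple i j : i < n -> j < n -> le2 n t pred0 i j -> suffix_le n t i j.
Proof.
move=> hi hj; rewrite /le2 /suffix_le /lex_le; apply: contra; exact: psuf_full.
Qed.

(* The code of an LMS substring is never a proper prefix of another one. *)
Lemma kl_full i j : i < n -> j < n -> lex_lt (kl i) (kl j) -> lex_lt (full i) (full j).
Proof.
move: {2}(n - i) (leqnn (n - i)) => d; elim: d i j => [|d IH] i j hd hi hj; first by lia.
case: (i =P j) => [->|/eqP hne]; first by rewrite lex_lt_irr.
have [u eu] := key_cons n t lm i; have [v ev] := key_cons n t lm j.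
case: (ltngtP (e i) (e j)) => [hlt _|hgt|eij].
- have [u' ->] := key_cons n t pred0 i; have [v' ->] := key_cons n t pred0 j.
  by rewrite /= hlt.
- by rewrite eu ev /=; lia.
have [et eS] := ecode_inj eij.
have [hi2 hj2] := same_next hi hj hne et.
rewrite (fullE hi2) (fullE hj2) (keyE t lm hi2) (keyE t lm hj2) eij /= !ltnn !eqxx /=.
case: (ltngtP (e i.+1) (e j.+1)) => [hlt _|hgt|eij2].
- have [u' ->] := key_cons n t pred0 i.+1; have [v' ->] := key_cons n t pred0 j.+1.
  by rewrite /= hlt.
- have [u' ->] := key1_cons n t lm i.+1; have [v' ->] := key1_cons n t lm j.+1.
  by rewrite /=; lia.
have [et2 eS2] := ecode_inj eij2.
have el : lm i.+1 = lm j.+1 by rewrite /lms /= hi2 hj2 eS eS2.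
rewrite /key1 el; case: ifP => _; first by rewrite eij2 lex_lt_irr.
by apply: IH => //; lia.
Qed.

(** The end of the LMS substring that starts at [i]. The last position is its own end, so its length
    counts as 0. *)
Definition next_lms (i : nat) : nat := i + (size (kl i)).-1.

Lemma nxt_last : next_lms n.-1 = n.-1.
Proof. by rewrite /next_lms key_last /= addn0. Qed.

Lemma nxtE i : i.+1 < n -> next_lms i = if lm i.+1 then i.+1 else next_lms i.+1.
Proof.
move=> h; rewrite /next_lms keyE //= /key1; case: ifP => _ /=; first by rewrite addn1.
by have [u ->] := key_cons n t lm i.+1; rewrite /=; lia.
Qed.

Lemma lms_last : 1 < n -> lm n.-1.
Proof.
move=> h; have h2 : n.-2.+1 < n by lia.
have e2 : n.-2.+1 = n.-1 by lia.
apply/and4P; split; [lia | lia | exact: styp_last |].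
have := stypE t h2; rewrite e2 => ->.
have := vt_last HT (i := n.-1); have := vt_last HT (i := n.-2); have := vt_rng HT (i := n.-2); lia.
Qed.

Lemma nxt_spec i : i.+1 < n ->
  [/\ i < next_lms i < n, lm (next_lms i) & forall k, i < k < next_lms i -> ~~ lm k].
Proof.
move: {2}(n - i) (leqnn (n - i)) => d; elim: d i => [|d IH] i hd hi; first by lia.
rewrite nxtE //; case: ifP => hl; first by split=> //; [lia | move=> k; lia].
case: (ltnP i.+2 n) => hi2.
  have [|h1 h2 h3] := IH i.+1 _ hi2; first by lia.
  split=> //; first by lia.
  move=> k hk; case: (k =P i.+1) => [->|hne]; first by rewrite hl.
  by apply: h3; lia.
have ei : i.+1 = n.-1 by lia.
by move: hl; rewrite ei lms_last //; lia.
Qed.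

Lemma nxt_ge i : i <= next_lms i. Proof. by rewrite /next_lms leq_addr. Qed.

Lemma nth_kl i k : i < n -> k <= next_lms i - i -> nth 0 (kl i) k = e (i + k).
Proof.
move: {2}(n - i) (leqnn (n - i)) => d; elim: d i k => [|d IH] i k hd hi; first by lia.
case: k => [|k]; first by have [u ->] := key_cons n t lm i; rewrite addn0.
case: (ltnP i.+1 n) => hi2; last first.
  have -> : i = n.-1 by lia.
  by rewrite nxt_last; lia.
rewrite nxtE // keyE //= /key1; case: ifP => hl hk.
  by rewrite (_ : k = 0) //= ?addn1 //; lia.
by rewrite IH //; [congr (ecode _ _ _); lia | lia | lia].
Qed.

Lemma size_kl i : size (kl i) = (next_lms i - i).+1.
Proof. by rewrite /next_lms; have [u ->] := key_cons n t lm i; rewrite /=; lia. Qed.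

(** Lets the naming step compare characters only: both strings end in an S-type position, and equal
    characters propagate equal types backwards from there. *)
Lemma kl_eqP i j : i.+1 < n -> j.+1 < n ->
  (next_lms i - i = next_lms j - j /\ forall k, k <= next_lms i - i -> t (i + k) = t (j + k)) <-> kl i = kl j.
Proof.
move=> hi hj; have [i1 i2 i3] := nxt_spec hi; have [j1 j2 j3] := nxt_spec hj.
split=> [[es et]|ek].
  have eS d : d <= next_lms i - i -> S (i + (next_lms i - i - d)) = S (j + (next_lms i - i - d)).
    elim: d => [|d IH] hd.
      rewrite subn0 {2}es !subnKC; [|lia|lia].
      by rewrite (lms_styp i2) (lms_styp j2).
    have h := IH (ltnW hd).
    set a := next_lms i - i - d.+1; have ea : next_lms i - i - d = a.+1 by lia.
    rewrite ea !addnS in h.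
    have hx1 : (i + a).+1 < n by lia.
    have hx2 : (j + a).+1 < n by lia.
    rewrite (stypE t hx1) (stypE t hx2).
    have e1 : t (i + a) = t (j + a) by apply: et; lia.
    have e2 : t (i + a).+1 = t (j + a).+1 by have := et a.+1; rewrite !addnS; apply; lia.
    by rewrite h e1 e2.
  apply: (@eq_from_nth _ 0); first by rewrite !size_kl es.
  move=> k; rewrite size_kl => hk; rewrite !nth_kl //; try lia.
  have := eS (next_lms i - i - k); rewrite subKn // => eSk.
  by rewrite /ecode et // eSk //; lia.
have es : next_lms i - i = next_lms j - j.
  by have := size_kl i; have := size_kl j; rewrite ek; lia.
split=> // k hk; have : nth 0 (kl i) k = nth 0 (kl j) k by rewrite ek.
rewrite !nth_kl //; try lia.
by case/ecode_inj.
Qed.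

(** Consecutive LMS substrings overlap in one position; [take] drops the shared last code. *)
Lemma full_split i : i.+1 < n -> full i = take (next_lms i - i) (kl i) ++ full (next_lms i).
Proof.
move: {2}(n - i) (leqnn (n - i)) => d; elim: d i => [|d IH] i hd hi; first by lia.
rewrite (fullE hi) (nxtE hi) (keyE t lm hi) /key1; case: ifP => hl.
  by rewrite subSnn.
case: (ltnP i.+2 n) => hi2; last first.
  have ei : i.+1 = n.-1 by lia.
  by move: hl; rewrite ei lms_last //; lia.
have [h1 _ _] := nxt_spec hi2.
rewrite (_ : next_lms i.+1 - i = (next_lms i.+1 - i.+1).+1) /=; last by lia.
by rewrite -IH //; lia.
Qed.

Lemma cnt_lms2 : cnt n lm * 2 <= n.
Proof.
(* The summand [lm k] carries through the induction that adjacent positions are never both LMS. *)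
suff H k : cnt k lm * 2 + lm k <= k by have := H n; lia.
elim: k => [|k IH]; first by rewrite /cnt /lms.
rewrite cntS; have : lm k -> lm k.+1 = false.
  by rewrite /lms /= => /and4P[_ _ -> _]; rewrite andbF andbF.
by move: IH; case: (lm k); case: (lm k.+1) => /= h1 h2; try lia; have := h2 isT.
Qed.

Definition lms_seq : seq nat := [seq i <- iota 0 n | lm i].
Definition lms_nth (a : nat) : nat := nth 0 lms_seq a.
Definition lms_rank (p : nat) : nat := cnt p lm.

Lemma size_lmsl : size lms_seq = cnt n lm. Proof. by rewrite size_filter. Qed.

Lemma lms_lt p : lm p -> p < n. Proof. by case/and4P. Qed.

Lemma rk_lt p : lm p -> lms_rank p < cnt n lm.
Proof.
move=> h; have hp := lms_lt h; have := cnt_mono lm hp.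
by rewrite cntS h /lms_rank; lia.
Qed.

Lemma lpos_rk p : lm p -> lms_nth (lms_rank p) = p.
Proof.
move=> h; have hp := lms_lt h.
have e1 : iota 0 n = iota 0 p ++ p :: iota p.+1 (n - p.+1).
  rewrite -[p :: _]/(iota p (n - p.+1).+1) -[X in iota X (n - _).+1]add0n -iotaD.
  by congr iota; lia.
by rewrite /lms_nth /lms_seq e1 filter_cat nth_cat size_filter ltnn subnn /= h.
Qed.

Lemma lpos_lms a : a < cnt n lm -> lm (lms_nth a).
Proof.
by rewrite -size_lmsl => /(mem_nth 0); rewrite mem_filter => /andP[].
Qed.

Lemma rk_lpos a : a < cnt n lm -> lms_rank (lms_nth a) = a.
Proof.
move=> ha; have hl := lpos_lms ha; have hr := rk_lt hl.
have := lpos_rk hl; rewrite /lms_nth => /eqP; rewrite nth_uniq ?size_lmsl //.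
  by move/eqP.
exact: filter_uniq (iota_uniq _ _).
Qed.

Lemma rk_nxt p : lm p -> p.+1 < n -> lms_rank (next_lms p) = (lms_rank p).+1.
Proof.
move=> hl hp; have [h1 h2 h3] := nxt_spec hp.
rewrite /lms_rank (_ : next_lms p = p.+1 + (next_lms p - p.+1)); last by lia.
rewrite cntD0; first by rewrite cntS hl addn1.
by move=> k hk; apply: h3; lia.
Qed.

Lemma rk_last : 1 < n -> lms_rank n.-1 = (cnt n lm).-1.
Proof.
move=> h; have := cntS n.-1 lm; rewrite prednK ?(vt_pos HT) // lms_last //.
by rewrite /lms_rank => ->; rewrite addn1.
Qed.

Definition reduces (m : nat) (t1 : nat -> nat) : Prop :=
  [/\ 1 < n, m = cnt n lm,
   forall a b, a < m -> b < m -> t1 a < t1 b -> lex_lt (kl (lms_nth a)) (kl (lms_nth b)) &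
   forall a b, a < m -> b < m -> t1 a = t1 b -> kl (lms_nth a) = kl (lms_nth b)].

(** Equal letters stand for equal LMS substrings, which [full_split] cancels; the first pair of
    different letters is decided by [kl_full]. Different suffixes never tie, as their lengths
    differ. *)
Lemma reduces_le m t1 a b : vtext m t1 -> reduces m t1 -> a < m -> b < m ->
  suffix_le m t1 a b -> le2 n t pred0 (lms_nth a) (lms_nth b).
Proof.
move=> HT1 [h1 hm hlt heq] ha hb; rewrite /suffix_le /le2.
suff H : forall a b, a < m -> b < m -> lex_lt (suffix_from m t1 a) (suffix_from m t1 b) ->
    lex_lt (full (lms_nth a)) (full (lms_nth b)).
  case hab: (lex_lt (suffix_from m t1 a) (suffix_from m t1 b)).
    by move=> _; rewrite /lex_le (lex_lt_asym (H _ _ ha hb hab)).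
  move=> hle; have /(congr1 size) := lex_lt_total hab (negbTE hle).
  rewrite !size_map !size_iota => es; have -> : a = b by lia.
  exact: lex_le_refl.
move=> {ha hb}; clear a b => a b.
move: {2}(m - a) (leqnn (m - a)) => d; elim: d a b => [|d IH] a b hd ha hb; first by lia.
case: (a =P b) => [->|/eqP hne]; first by rewrite lex_lt_irr.
have la : lm (lms_nth a) by apply: lpos_lms; rewrite -hm.
have lb : lm (lms_nth b) by apply: lpos_lms; rewrite -hm.
rewrite (psufE t1 ha) (psufE t1 hb) /=; case/orP=> [hl|/andP[/eqP et hs]].
  by apply: kl_full; [exact: lms_lt | exact: lms_lt | exact: hlt].
have ra : lms_rank (lms_nth a) = a by apply: rk_lpos; rewrite -hm.
have rb : lms_rank (lms_nth b) = b by apply: rk_lpos; rewrite -hm.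
have hne1 : forall c, c.+1 < m -> lms_rank (lms_nth c) = c -> lm (lms_nth c) -> (lms_nth c).+1 < n /\ next_lms (lms_nth c) = lms_nth c.+1.
  move=> c hc rc lc; have hcn := lms_lt lc.
  have hc1 : (lms_nth c).+1 < n.
    case: (ltnP (lms_nth c).+1 n) => // h; have el : lms_nth c = n.-1 by lia.
    by move: rc; rewrite el rk_last // -hm; lia.
  split=> //; have [_ hl _] := nxt_spec hc1.
  by rewrite -{1}(lpos_rk hl) rk_nxt // rc.
have [ha2 hb2] : a.+1 < m /\ b.+1 < m.
  by have := vt_last HT1 ha; have := vt_last HT1 hb; rewrite et => ->; lia.
have [a1 a2] := hne1 _ ha2 ra la.
have [b1 b2] := hne1 _ hb2 rb lb.
have ek := heq _ _ ha hb et.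
have [es _] := (kl_eqP a1 b1).2 ek.
rewrite (full_split a1) (full_split b1) es ek lex_lt_cat a2 b2.
by apply: IH => //; lia.
Qed.

(** * Naming *)

(** Names count the changes along the sorted list from 1 on, which keeps 0 free to mark empty
    slots. *)
Fixpoint lms_name (q : nat -> nat) (x : nat) : nat :=
  if x is x'.+1 then lms_name q x' + (kl (q x') != kl (q x)) else 1.

Record lsorted (m : nat) (q : nat -> nat) : Prop := LSorted {
  ls_lms : forall x, x < m -> lm (q x);
  ls_all : forall p, lm p -> exists2 x, x < m & q x = p;
  ls_inj : forall x y, x < m -> y < m -> q x = q y -> x = y;
  ls_le : forall x y, x < y < m -> lex_le (kl (q x)) (kl (q y)) }.

Section Names.
Variables (m : nat) (q : nat -> nat).
Hypothesis (HQ : lsorted m q) (n1 : 1 < n) (hm : m = cnt n lm).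

Lemma nmx_le x : 1 <= lms_name q x <= x.+1.
Proof. by elim: x => //= x IH; case: (_ != _) => /=; lia. Qed.

Lemma nmx_mono x y : x <= y -> lms_name q x <= lms_name q y.
Proof.
by move=> h; rewrite -(subnKC h); elim: (y - x) => [|d IH]; rewrite ?addn0 // addnS /=; lia.
Qed.

Lemma nmx_lt x y : x < y < m -> lms_name q x < lms_name q y -> lex_lt (kl (q x)) (kl (q y)).
Proof.
elim: y => [|y IH] hxy; first by lia.
case hlt: (lex_lt (kl (q x)) (kl (q y.+1))) => // h; exfalso.
have hle : lex_le (kl (q x)) (kl (q y.+1)) by apply: (ls_le HQ); lia.
have e := lex_lt_total hlt (negbTE hle).
case: (x =P y) => [exy|/eqP hne]; first by rewrite exy in e h; move: h => /=; rewrite e eqxx; lia.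
have h1 : lex_le (kl (q x)) (kl (q y)) by apply: (ls_le HQ); lia.
have h2 : lex_le (kl (q y)) (kl (q y.+1)) by apply: (ls_le HQ); lia.
have h3 : kl (q y) = kl (q y.+1).
  by apply: lex_lt_total; [move: h1; rewrite e /lex_le => /negbTE | apply/negbTE].
move: h => /=; rewrite h3 eqxx addn0 => h.
have : lex_lt (kl (q x)) (kl (q y)) by apply: IH => //; lia.
by rewrite h3 hlt.
Qed.

Lemma nmx_eq x y : x < y < m -> lms_name q x = lms_name q y -> kl (q x) = kl (q y).
Proof.
elim: y => [|y IH] hxy; first by lia.
have := nmx_mono (x := x) (y := y); rewrite /=.
case: eqP => [e|_] /=; last by lia.
by rewrite addn0 -e; case: (x =P y) => [->//|hne] _; apply: IH; lia.
Qed.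

(** The key of the last position starts with the character 1, which no other position has. *)
Lemma ls_first : 0 < m -> q 0 = n.-1.
Proof.
move=> m0; have [x hx e] := ls_all HQ (lms_last n1).
case: (posnP x) => [x0|x0]; first by rewrite -x0.
have : lex_le (kl (q 0)) (kl (q x)) by apply: (ls_le HQ); lia.
rewrite e key_last; have [u ->] := key_cons n t lm (q 0).
have h0 := ls_lms HQ m0; have hp := lms_lt h0.
rewrite /lex_le /ecode /= styp_last.
have e1 : t n.-1 = 1 by apply/eqP; rewrite (vt_last HT) //; lia.
rewrite e1; case: (q 0 =P n.-1) => // /eqP hne.
by have := vt_last HT hp; have := vt_rng HT hp; rewrite (negbTE hne); lia.
Qed.

(** Name 1 goes to the least LMS substring, the single letter of the last position, and no other
    substring equals it; hence [vtext] passes to the next level. *)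
Lemma names_ok t1 : (forall x, x < m -> t1 (lms_rank (q x)) = lms_name q x) ->
  vtext m t1 /\ reduces m t1.
Proof.
move=> h; have m0 : 0 < m by have := rk_lt (lms_last n1); lia.
have sur a : a < m -> exists x, [/\ x < m, q x = lms_nth a & t1 a = lms_name q x].
  move=> ha; have hla : lm (lms_nth a) by apply: lpos_lms; rewrite -hm.
  have [x hx e] := ls_all HQ hla.
  by exists x; split=> //; rewrite -h // e rk_lpos // -hm.
split.
  split=> // a ha; have [x [hx e ->]] := sur _ ha; first by have := nmx_le x; lia.
  case: (posnP x) => [x0|x0].
    rewrite x0 eqxx; rewrite x0 ls_first // in e.
    have : lms_rank (lms_nth a) = m.-1 by rewrite -e rk_last // -hm.
    by rewrite rk_lpos -?hm // => ->; rewrite eqxx.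
  have hne : a != m.-1.
    apply/eqP => ea; have : lms_rank (q x) = m.-1 by rewrite e rk_lpos -?hm.
    rewrite hm -rk_last // => er.
    have : q x = q 0.
      by rewrite ls_first // -(lpos_rk (lms_last n1)) -er (lpos_rk (ls_lms HQ hx)).
    by move/(ls_inj HQ hx m0); lia.
  rewrite (negbTE hne); apply/eqP => e1.
  have := @nmx_eq 0 x; rewrite e1 x0 hx => /(_ isT erefl) ek.
  have e2 := ls_first m0.
  move: ek; rewrite e2 key_last => ek.
  have [u eu] := key_cons n t lm (q x).
  rewrite eu in ek; case: ek => /ecode_inj[ek _] _.
  have hlx := ls_lms HQ hx.
  have : q x = n.-1.
    apply: last_eq; first exact: lms_lt.
    by rewrite -ek; apply/eqP; rewrite (vt_last HT) //; lia.
  by rewrite -e2 => /(ls_inj HQ hx m0); lia.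
split=> // a b ha hb.
  have [x [hx <- ->]] := sur _ ha; have [y [hy <- ->]] := sur _ hb => hlt.
  apply: nmx_lt => //; rewrite hy andbT; case: (ltnP x y) => // hyx.
  by have := nmx_mono hyx; lia.
have [x [hx <- ->]] := sur _ ha; have [y [hy <- ->]] := sur _ hb => heq.
case: (ltngtP x y) => [hxy|hxy|-> //]; first by apply: nmx_eq; rewrite ?hxy.
by apply/esym/nmx_eq; rewrite ?hxy.
Qed.

End Names.
End Reduce.

(* Register conventions of the suffix sorter: 0 holds N, 2 the length n of the
   current text, 3 its base address in the LCP array, and 4 the base address of
   its n bucket pointers, also in the LCP array; 4 is 0 exactly when the current
   text is the input T.  Suffix array entries are 1-based and 0 means empty.

   With [rev] set, characters and array indices are complemented
   (c |-> n + 1 - c, x |-> n - 1 - x): the right-to-left S-type pass on bucket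
   ends is the left-to-right L-type pass on bucket starts seen in this mirror. *)
Definition vchar (rev : bool) n t := if rev then cmpl n t else t.
Definition vindex (rev : bool) (n x : nat) := if rev then n.-1 - x else x.

Definition Echar (rev : bool) e :=
  if rev then EAdd (ESub (EV 2) (EText e)) (EC 1) else EText e.
Definition Eindex (rev : bool) e :=
  if rev then ESub (ESub (EV 2) (EC 1)) e else e.
Definition Ebucket e := EAdd (EV 4) (ESub e (EC 1)).
Definition Ebucket0 e := EAdd (EV 4) e.

Definition buckets rev :=
  Seq (For 9 2 (Sto ALCP (Ebucket0 (EV 9)) (EC 0)))
  (Seq (For 9 2 (Seq (Asg 6 (Ebucket (Echar rev (EV 9))))
                     (Sto ALCP (EV 6) (EAdd (ELd ALCP (EV 6)) (EC 1)))))
  (Seq (Asg 10 (EC 0))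
       (For 9 2 (Seq (Asg 6 (ELd ALCP (Ebucket0 (EV 9))))
                (Seq (Sto ALCP (Ebucket0 (EV 9)) (EV 10))
                     (Asg 10 (EAdd (EV 10) (EV 6)))))))).

Definition pass rev (z : bool) :=
  For 5 2
  (Seq (Asg 6 (ELd ASA (Eindex rev (EV 5))))
  (If (ELt (EC 1) (EV 6))
    (Seq (Asg 7 (Echar rev (ESub (EV 6) (EC 1))))
    (Seq (Asg 8 (Echar rev (ESub (EV 6) (EC 2))))
    (Seq (Asg 10 (ELt (EV 5) (ELd ALCP (Ebucket (EV 7)))))
    (Seq (If (EIf (ELt (EV 7) (EV 8)) (EC 1) (EIf (EEq (EV 7) (EV 8)) (EV 10) (EC 0)))
           (Seq (Asg 14 (ELd ALCP (Ebucket (EV 8))))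
           (Seq (Sto ASA (Eindex rev (EV 14)) (ESub (EV 6) (EC 1)))
                (Sto ALCP (Ebucket (EV 8)) (EAdd (EV 14) (EC 1)))))
           Skip)
         (if z then If (EV 10) Skip (Sto ASA (Eindex rev (EV 5)) (EC 0)) else Skip)))))
    Skip)).

Ltac simp_regs := rewrite /= /updr /=.
Ltac asg := apply: wp_seq; apply: wp_asg.
Ltac sto := apply: wp_seq; apply: wp_sto.
Ltac wif := apply: wp_seq; apply: wp_if.
Ltac side := do 6 (try split) => //; lia.

Notation kept_outside s n s' :=
  (forall i, i < rg s 4 \/ rg s 4 + n <= i -> fb s' i = fb s i).

(** * Bucket counting and the pass program *)

Section Blocks.
Variables (N : nat) (tx : nat -> nat).
Notation ev := (ev tx).
Notation safe := (safe N tx).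
Notation wp := (wp N tx).

(** A reduced text lies directly below the bucket area, [rg s 3 + n = rg s 4], so it is safe as long
    as the cells below [rg s 4] are. *)
Record text_at (s : st) (n : nat) (t : nat -> nat) : Prop := TxI {
  tx_N : rg s 0 = N;
  tx_n : rg s 2 = n;
  tx_bb : rg s 4 + n <= N;
  tx_txt : if rg s 4 == 0 then forall i, i < n -> tx i = t i
           else rg s 3 + n = rg s 4 /\ forall i, i < n -> fb s (rg s 3 + i) = t i;
  tx_vt : vtext n t }.

Lemma Tx_ext s s' n t : text_at s n t ->
  rg s' 0 = rg s 0 -> rg s' 2 = rg s 2 -> rg s' 3 = rg s 3 -> rg s' 4 = rg s 4 ->
  (forall i, i < rg s 4 -> fb s' i = fb s i) -> text_at s' n t.
Proof.
move=> [h1 h2 h3 h4 h5] e0 e2 e3 e4 hf; split; rewrite ?e0 ?e2 ?e4 ?e3 //.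
move: h4; case: ifP => // h [h6 h7]; split=> // i hi.
by rewrite hf ?h7 //; lia.
Qed.

Lemma Tx_fr c s s' n t : text_at s n t -> framed c s s' ->
  all (fun r => r \notin mods c) [:: 0; 2; 3; 4] ->
  (wr ALCP c -> forall i, i < rg s 4 -> fb s' i = fb s i) -> text_at s' n t.
Proof.
move=> hT [f1 f2 f3] /= /and5P[m0 m2 m3 m4 _] hf.
apply: (Tx_ext hT); rewrite ?f1 //; move: hf f3; case: (wr ALCP c) => /=; first by move=> h _; exact: h.
by move=> _ ->.
Qed.

Lemma Tx_rng s n t i : text_at s n t -> i < n -> 1 <= t i <= n.
Proof. by move=> h; exact: (vt_rng (tx_vt h)). Qed.

Lemma Tx_nN s n t : text_at s n t -> 0 < n <= N.
Proof. by move=> h; have := vt_pos (tx_vt h); have := tx_bb h; lia. Qed.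

Lemma txtE s n t i : text_at s n t -> i < n -> txt tx s i = t i.
Proof.
move=> [h1 h2 h3 h4 h5] hi; rewrite /txt; move: h4; case: ifP => _; first by apply.
by case=> _; apply.
Qed.

Lemma txt_safeE s n t i : text_at s n t -> i < n -> txt_safe N s i.
Proof.
move=> [h1 h2 h3 h4 h5] hi; rewrite /txt_safe /reg_tb /reg_bb; move: h4; case: ifP => hb; [move=> _ | case=> h6 _]; lia.
Qed.

Lemma ev_CH s n t rev e : text_at s n t -> ev e s < n ->
  ev (Echar rev e) s = vchar rev n t (ev e s).
Proof. by move=> h hi; case: rev => /=; rewrite (txtE h hi) // (tx_n h). Qed.

Lemma safe_CH s n t rev e : text_at s n t -> safe e s -> ev e s < n -> safe (Echar rev e) s.
Proof.
move=> h hs hi; have hts := txt_safeE h hi; have := Tx_rng h hi; have := Tx_nN h.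
case: rev => //= hn hr; rewrite (txtE h hi) (tx_n h).
by side.
Qed.

Lemma tt_rng s n t rev i : text_at s n t -> i < n -> 1 <= vchar rev n t i <= n.
Proof. by move=> h hi; have := Tx_rng h hi; case: rev => //=; rewrite /cmpl; lia. Qed.

Lemma ev_IX rev e s n : rg s 2 = n -> ev (Eindex rev e) s = vindex rev n (ev e s).
Proof. by case: rev => //= ->; rewrite subn1. Qed.

Lemma safe_IX rev e s n : rg s 2 = n -> n <= N -> safe e s -> ev e s < n -> safe (Eindex rev e) s.
Proof. by case: rev => //= -> hn hs he; side. Qed.

Lemma ix_lt rev n x : x < n -> vindex rev n x < n.
Proof. by case: rev => /=; lia. Qed.

Lemma ix_inj rev n x y : x < n -> y < n -> (vindex rev n x == vindex rev n y) = (x == y).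
Proof. by case: rev => /=; lia. Qed.

Definition buckets_hold (s : st) (n : nat) (h : nat -> nat) : Prop :=
  forall c, 1 <= c <= n -> fb s (rg s 4 + (c - 1)) = h c.

Lemma buckets_ok rev s n t b Q : text_at s n t -> 3 * n <= b ->
  (forall s' b', b - 3 * n <= b' -> framed (buckets rev) s s' -> text_at s' n t ->
     kept_outside s n s' ->
     buckets_hold s' n (bkt_start n (vchar rev n t)) -> Q b' s') ->
  wp (buckets rev) Q b s.
Proof.
move=> hT hb hQ; have hn := Tx_nN hT; have hbb := tx_bb hT.
have e2 := tx_n hT.
suff H : wp (buckets rev) (fun b' s' => [/\ b - 3 * n <= b',
    kept_outside s n s' &
     buckets_hold s' n (bkt_start n (vchar rev n t))]) b s.
  apply: (wp_conseq H) => b' s' hf [h1 h2 h3]; apply: hQ => //.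
  by apply: (Tx_fr hT hf) => // _ i hi; apply: h2; left.
apply: wp_seq; apply: (@wp_for _ _ 9 2 _ (fun k s' =>
   forall i, fb s' i = if rg s 4 <= i < rg s 4 + k then 0 else fb s i)) e2 _ _ _ _ _ _ _ => //; try lia.
- by move=> i; rewrite (_ : _ <= i < _ = false) //; lia.
- move=> i s1 b1 hi ei hf hJ; have e4 : rg s1 4 = rg s 4 by case: hf => ->.
  apply: wp_sto => /=; rewrite ?ei ?e4 //; try lia; first by split=> //; lia.
  split=> // j; rewrite /upd hJ; case: eqP => [->|ne]; last by congr (if _ then _ else _); lia.
  by rewrite (_ : _ <= _ < _) //; lia.
move=> s1 b1 hb1 hf1 _ hJ1.
have e4 : rg s1 4 = rg s 4 by case: hf1 => ->.
have hJo i : i < rg s 4 \/ rg s 4 + n <= i -> fb s1 i = fb s i.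
  by move=> hi; rewrite hJ1; case: ifP => //; lia.
have hT1 : text_at s1 n t.
  by apply: (Tx_fr hT hf1) => // _ i hi; apply: hJo; left.
apply: wp_seq; apply: (@wp_for _ _ 9 2 _ (fun k s' =>
   kept_outside s n s' /\
   buckets_hold s' n (fun c => cnt k (fun i => vchar rev n t i == c)))) (tx_n hT1) _ _ _ _ _ _ _ => //; try lia.
- split; first exact: hJo.
  by move=> c hc; rewrite /= {1}/updr /= hJ1 e4 (_ : _ <= _ < _) //; lia.
- move=> i s2 b2 hi ei hf [hJa hJb]; have e4' : rg s2 4 = rg s 4 by case: hf => ->.
  have hT2 : text_at s2 n t.
    by apply: (Tx_fr hT1 hf) => // _ j; rewrite e4 => hj; rewrite hJa ?hJo //; left.
  have hr := tt_rng rev hT2 hi.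
  have hlt : ev (EV 9) s2 < n by rewrite /= ei.
  have hsf := safe_CH rev hT2 (e := EV 9) I hlt; have hev := ev_CH rev hT2 hlt.
  rewrite /= ei in hev.
  asg; first by rewrite /= hev e4'; side.
  rewrite /= hev e4'; set c := vchar rev n t i in hr hev *.
  have hv : fb s2 (rg s 4 + (c - 1)) = cnt i (fun i0 => vchar rev n t i0 == c).
    by rewrite -e4' hJb.
  have hvi := cnt_le i (fun i0 => vchar rev n t i0 == c).
  apply: wp_sto; simp_regs; rewrite ?hv; try lia.
    by split=> //; [split=> //; lia | lia | lia].
  split=> //; split.
    move=> j hj; rewrite /upd; case: eqP => [ej|_]; last exact: hJa.
    by exfalso; lia.
  move=> d hd; rewrite /= {1}/updr /= /upd cntS -/c e4'.
  case: (c =P d) => [<-|ne]; first by rewrite !eqxx.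
  by case: eqP => [|_]; [lia | rewrite addn0 -e4' hJb].
move=> s2 b2 hb2 hf2 _ [hJa hJb].
have e4' : rg s2 4 = rg s 4 by case: hf2 => ->.
have hT2 : text_at s2 n t.
  by apply: (Tx_fr hT1 hf2) => // _ j; rewrite e4 => hj; rewrite hJa ?hJo //; left.
asg => //=.
apply: (@wp_for _ _ 9 2 _ (fun k s' =>
   [/\ kept_outside s n s',
   rg s' 10 = bkt_start n (vchar rev n t) k.+1 &
   forall c, 1 <= c <= n -> fb s' (rg s 4 + (c - 1)) =
     if c <= k then bkt_start n (vchar rev n t) c else cnt n (fun i => vchar rev n t i == c)]) _ _ _ n) => //; try lia.
- exact: (tx_n hT2).
- split=> //=.
    simp_regs; apply/esym/eqP; rewrite -leqn0 leqNgt -has_count; apply/hasPn => i.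
    by rewrite mem_iota => /andP[_ hi]; have := tt_rng rev hT2 hi; lia.
  move=> c hc; rewrite -e4' hJb //.
  by case: c hc.
- move=> i s3 b3 hi ei hf [h1 h2 h3]; have e4'' : rg s3 4 = rg s 4 by case: hf => ->.
  asg => /=; rewrite ?ei ?e4''; first by side.
  have := h3 i.+1 (ltac:(lia)); rewrite subn1 ltnn /= => ->.
  sto; simp_regs; rewrite ?ei ?e4'' //; try lia; first by side.
  have hS := bsS n (vchar rev n t) i.+1; have hle := bs_le n (vchar rev n t) i.+2.
  apply: wp_asg; simp_regs; rewrite h2 -?hS; first by split=> //; lia.
  split=> //; split=> //=.
    by move=> j hj; rewrite /upd; case: eqP => [|_]; [lia | exact: h1].
  move=> c hc; rewrite /upd h3 //; case: eqP => [e|ne].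
    have -> : c = i.+1 by lia.
    by rewrite leqnn.
  by rewrite (_ : (c <= i.+1) = (c <= i)) //; lia.
move=> s3 b3 hb3 hf3 _ [h1 h2 h3]; split=> //; first by lia.
have e4'' : rg s3 4 = rg s 4 by case: hf3 => ->.
by move=> c hc; rewrite e4'' h3 //; have -> : c <= n by lia.
Qed.

(** What the program's array holds when the abstract one is [G]: erasing is kept out of [pass_inv].
    The entry 1, position 0, has no predecessor; the program skips it, and it is not erased. *)
Definition zeroed (z : bool) (X : pred nat) (x : nat) (G : nat -> nat) (y : nat) :=
  if [&& z, y < x, 1 < G y & ~~ X (G y).-1] then 0 else G y.

Lemma zeroed0 z X x G y : ~~ [&& z, y < x, 1 < G y & ~~ X (G y).-1] ->
  zeroed z X x G y = G y.
Proof. by rewrite /zeroed => /negbTE ->. Qed.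

Lemma zeroedS z X x G y : zeroed z X x.+1 G y =
  if [&& z, y == x, 1 < G y & ~~ X (G y).-1] then 0 else zeroed z X x G y.
Proof.
rewrite /zeroed ltnS leq_eqVlt; case: z => //=; case: (y =P x) => [->|] //=.
by rewrite ltnn /=.
Qed.

(** Concrete and abstract array differ only in scanned slots, and insertions go ahead of the scan,
    so erasing does not disturb the pass. *)
Lemma pass_ok rev z X le A0 s n t b Q :
  pass_law n (vchar rev n t) X le -> seeded n (vchar rev n t) X le A0 ->
  text_at s n t -> n <= b ->
  (forall y, y < n -> fa s (vindex rev n y) = A0 y) ->
  buckets_hold s n (bkt_start n (vchar rev n t)) ->
  (forall s' b' G h, b - n <= b' -> framed (pass rev z) s s' -> text_at s' n t ->
     pass_inv n (vchar rev n t) X A0 n G h -> buckets_hold s' n h ->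
     (forall y, y < n -> fa s' (vindex rev n y) = zeroed z X n G y) ->
     (forall i, n <= i -> fa s' i = fa s i) ->
     kept_outside s n s' -> Q b' s') ->
  wp (pass rev z) Q b s.
Proof.
move=> HL HS hT hb hA hB hQ; have hn := Tx_nN hT; have hbb := tx_bb hT.
pose J x s' := exists G h, [/\ pass_inv n (vchar rev n t) X A0 x G h, buckets_hold s' n h,
  (forall y, y < n -> fa s' (vindex rev n y) = zeroed z X x G y),
  (forall i, n <= i -> fa s' i = fa s i) &
  kept_outside s n s'].
apply: (@wp_for _ _ 5 2 _ J _ _ _ n) => //; try lia; first exact: (tx_n hT).
- by case: (z).
- exists A0, (bkt_start n (vchar rev n t)); split=> //; first exact: (pinv0 HS).
  by move=> y hy; rewrite /= hA // zeroed0 // ltn0 andbF.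
- move=> x s1 b1 hx ex hf [G [h [HI hB1 hA1 hA2 hF]]].
  have e4 : rg s1 4 = rg s 4 by case: hf => -> //; case: (z).
  have hT1 : text_at s1 n t.
    apply: (Tx_fr hT hf); first by case: (z).
    by move=> _ i hi; apply: hF; left.
  have e2 := tx_n hT1.
  have hix := ix_lt rev hx.
  have hGx : fa s1 (vindex rev n x) = G x by rewrite hA1 // zeroed0 // ltnn andbF.
  asg.
    rewrite /= (@ev_IX rev (EV 5) s1 n) //= ex; split; last by lia.
    by apply: (@safe_IX _ _ _ n) => //=; rewrite ?ex //; lia.
  rewrite /= (@ev_IX rev (EV 5) s1 n) //= ex hGx; set s2 := setr 6 _ s1.
  have hT2 : text_at s2 n t by apply: (Tx_ext hT1).
  apply: wp_if; first by simp_regs; lia.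
  simp_regs; case: (ltnP 1 (G x)) => hg /=; last first.
    apply: wp_skip; split=> //; exists G, h; split=> //.
      by apply: pinv_skip => // i e; rewrite e in hg.
    move=> y hy; rewrite zeroedS /= hA1 //.
    by case: (y =P x) => [->|]; rewrite ?andbF //= ltnNge hg /= andbF.
  have [p eG] : exists p, G x = p.+2 by exists (G x).-2; lia.
  have hpn : p.+1 < n.
    have [|q [e hq _]] := pi_slot HI hx; first by rewrite eG.
    lia.
  rewrite eG in s2 hT2 *.
  have hev : ev (ESub (EV 6) (EC 1)) s2 = p.+1 by simp_regs; lia.
  asg.
    by apply: (safe_CH rev hT2); rewrite ?hev //; simp_regs; do 2 (try split); lia.
  rewrite (ev_CH rev hT2) hev //; set cj := vchar rev n t p.+1; set s3 := setr 7 _ s2.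
  have hcj := tt_rng rev hT hpn.
  have hT3 : text_at s3 n t by apply: (Tx_ext hT2).
  have hev3 : ev (ESub (EV 6) (EC 2)) s3 = p by simp_regs; lia.
  asg.
    by apply: (safe_CH rev hT3); rewrite ?hev3 //; simp_regs; do 2 (try split); lia.
  rewrite (ev_CH rev hT3) hev3; last by lia.
  set ci := vchar rev n t p; set s4 := setr 8 _ s3.
  have hci : 1 <= ci <= n by apply: (tt_rng rev hT); lia.
  have hj : fb s1 (rg s 4 + (cj - 1)) = h cj by rewrite -e4 hB1.
  have hi : fb s1 (rg s 4 + (ci - 1)) = h ci by rewrite -e4 hB1.
  have htest : X p.+1 = (x < h cj) by exact: (pinv_test HS HI hx eG).
  have hXp : X p = (ci > cj) || ((ci == cj) && X p.+1) by apply: (pl_rec HL).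
  asg; first by simp_regs; rewrite e4 -/cj; side.
  simp_regs; rewrite ex e4 hj -htest; set s5 := setr 10 _ s4.
  (* The common end of an iteration, with or without an insertion: the optional erasure of slot
     [x]. *)
  have hz G1 h1 s6 b6 : pass_inv n (vchar rev n t) X A0 x.+1 G1 h1 -> buckets_hold s6 n h1 ->
      G1 x = G x -> rg s6 5 = x -> rg s6 2 = n -> rg s6 10 = X p.+1 ->
      (forall y, y < n -> fa s6 (vindex rev n y) = zeroed z X x G1 y) ->
      (forall i, n <= i -> fa s6 i = fa s i) ->
      kept_outside s n s6 ->
      b1 <= b6 ->
      wp (if z then If (EV 10) Skip (Sto ASA (Eindex rev (EV 5)) (EC 0)) else Skip)
       (fun b'' s' => [/\ b1 <= b'', rg s' 5 = x & J x.+1 (setr 5 x.+1 s')]) b6 s6.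
    move=> HI1 hB6 eG1 e6 e62 e610 hA6 hA6' hF6 hb6.
    case ez: z => /=; last first.
      apply: wp_skip; split=> //; exists G1, h1; split=> //.
      by move=> y hy /=; rewrite zeroedS ez hA6 // ez.
    apply: wp_if => //=; rewrite e610 eqb0; case: ifP => hX1.
      apply: wp_sto => //.
      - by apply: (@safe_IX _ _ _ n) => //=; rewrite ?e6 //; lia.
      - by rewrite (ev_IX _ _ e62) /= e6; lia.
      split=> //; exists G1, h1; split=> //=.
      - move=> y hy; rewrite (ev_IX _ _ e62) /= e6 /upd ix_inj // zeroedS ez /=.
        case: (y =P x) => [->|ne] /=; last by rewrite hA6 // ez.
        by rewrite eG1 eG /= hX1.
      - move=> i hi'; rewrite (ev_IX _ _ e62) /= e6 /upd; case: eqP => [|_]; last exact: hA6'.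
        by move=> ei; lia.
    apply: wp_skip; split=> //; exists G1, h1; split=> //.
    move=> y hy /=; rewrite zeroedS ez hA6 //= ez.
    case: (y =P x) => [->|ne] //=.
    by rewrite eG1 eG /=; move: hX1; case: (X p.+1) => //= _; rewrite andbF.
  wif; first by simp_regs; split=> //; case: ifP => _; [split=> //; case: ifP | lia].
  set tst := (ev _ s5 == 0).
  have -> : tst = ~~ X p.
    rewrite /tst hXp; simp_regs; rewrite -/cj -/ci.
    by case: (ltngtP cj ci) => //= e; case: (X p.+1) => //=; rewrite ?e ?eqxx.
  case: (boolP (X p)) => hXp' /=; last first.
    apply: wp_skip; apply: (hz G h) => //.
    by apply: pinv_skip => // i; rewrite eG => -[<-].
  have /andP[hd1 hd2] := pinv_dst HL HS HI hx eG hXp'.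
  have hd0 := pinv_dst0 HL HS HI hx eG hXp'.
  have hput := pinv_put HL HS HI hx eG hXp'.
  rewrite -/ci in hd1 hd2 hd0 hput.
  asg; first by simp_regs; rewrite e4 -/ci; side.
  simp_regs; rewrite e4 hi; set s6 := setr 14 _ s5.
  have e62 : rg s6 2 = n by rewrite /s6; simp_regs.
  sto.
  - by apply: (@safe_IX _ _ _ n) => //; simp_regs; lia.
  - by simp_regs; side.
  - by rewrite (ev_IX _ _ e62); simp_regs; have := ix_lt rev hd2; lia.
  rewrite (ev_IX _ _ e62); simp_regs; apply: wp_sto; simp_regs; rewrite ?e4; try lia.
    by side.
    by split => //; lia.
  apply: (hz _ _ _ _ hput) => //=.
  - move=> c hc /=; simp_regs; rewrite e4 /upd; case: (c =P ci) => [->|ne]; first by rewrite eqxx addn1.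
    case: eqP => [|_]; first by lia.
    by rewrite -e4 hB1.
  - by rewrite /upd; case: eqP => // e; lia.
  - move=> y hy; rewrite /upd ix_inj // /zeroed /upd; case: eqP => [->|_]; last by rewrite hA1.
    by rewrite (_ : h ci < x = false) ?andbF ?subn1 //; lia.
  - move=> i hi'; rewrite /upd; case: eqP => [|_]; last exact: hA2.
    by have := ix_lt rev hd2; lia.
  - move=> i hi'; rewrite /upd; case: eqP => [|_]; last exact: hF.
    by lia.
- move=> s1 b1 hb1 hf _ [G [h [HI hB1 hA1 hA2 hF]]]; apply: (hQ _ _ G h) => //.
  apply: (Tx_fr hT hf); first by case: (z).
  by move=> _ i hi; apply: hF; left.
Qed.

End Blocks.

(** * Scanning LMS positions, placing, and the inducing program *)

Definition clear (lo : expr) :=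
  Seq (Asg 9 lo) (Loop 9 2 (Sto ASA (EV 9) (EC 0))).

(* [body] is run, from right to left, with [rg 9] one less than the current LMS
   position. *)
Definition each_lms (body : cmd) :=
  Seq (Asg 9 (ESub (EV 2) (EC 1)))
  (Seq (Asg 12 (EC 1))
  (While (ELt (EC 0) (EV 9))
    (Seq (Asg 9 (ESub (EV 9) (EC 1)))
    (Seq (Asg 8 (EText (EV 9)))
    (Seq (Asg 7 (EText (EAdd (EV 9) (EC 1))))
    (Seq (Asg 10 (EIf (ELt (EV 8) (EV 7)) (EC 1) (EIf (EEq (EV 8) (EV 7)) (EV 12) (EC 0))))
    (Seq (If (EIf (EV 12) (EEq (EV 10) (EC 0)) (EC 0)) body Skip)
         (Asg 12 (EV 10))))))))).

(* The position to be placed is in register 13. *)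
Definition place :=
  Seq (Asg 7 (Echar true (EV 13)))
  (Seq (Asg 14 (ELd ALCP (Ebucket (EV 7))))
  (Seq (Sto ASA (Eindex true (EV 14)) (EAdd (EV 13) (EC 1)))
       (Sto ALCP (Ebucket (EV 7)) (EAdd (EV 14) (EC 1))))).

Definition induce :=
  Seq (buckets false) (Seq (pass false true)
  (Seq (Sto ASA (EC 0) (EV 2))
  (Seq (buckets true) (pass true false)))).

Section Blocks2.
Variables (N : nat) (tx : nat -> nat).
Notation ev := (ev tx).
Notation safe := (safe N tx).
Notation wp := (wp N tx).
Notation text_at := (text_at N tx).

Lemma clear_ok lo s n b Q : rg s 2 = n -> 0 < n <= N -> safe lo s -> ev lo s <= n -> n <= b ->
  (forall s' b', b - n <= b' -> framed (clear lo) s s' ->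
    (forall i, fa s' i = if ev lo s <= i < n then 0 else fa s i) -> Q b' s') ->
  wp (clear lo) Q b s.
Proof.
move=> e2 hn hs hl hb hQ.
suff H : wp (clear lo) (fun b' s' => b - n <= b' /\
    forall i, fa s' i = if ev lo s <= i < n then 0 else fa s i) b s.
  by apply: (wp_conseq H) => b' s' hf [h1 h2]; apply: hQ.
asg => //.
apply: (@wp_loop _ _ 9 2 _ (fun k s' => forall i, fa s' i = if ev lo s <= i < k then 0 else fa s i)
          _ _ _ (ev lo s) n) => //; try (simp_regs; lia).
- by move=> i /=; rewrite (_ : _ <= i < _ = false) //; lia.
- move=> i s1 b1 hi ei hf hJ; apply: wp_sto => /=; rewrite ?ei //; try lia.
  split=> // j /=; rewrite /upd hJ; case: eqP => [->|ne]; last by congr (if _ then _ else _); lia.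
  by rewrite (_ : _ <= _ < _) //; lia.
- by move=> s1 b1 hb1 _ _ hJ; split=> //; lia.
Qed.

(** [J i] states that the LMS positions above [i] have been treated. It must be insensitive to the
    registers of the scan and must protect the cells below the bucket area, where the text may
    lie. *)
Lemma each_lms_ok body s n t b Q (J : nat -> st -> Prop) :
  text_at s n t -> n <= b -> all (fun r => r \notin mods body) [:: 0; 2; 3; 4; 9; 10; 12] ->
  (forall i s1 s2, (forall r, r \notin [:: 7; 8; 9; 10; 12] -> rg s2 r = rg s1 r) ->
     fa s2 = fa s1 -> fb s2 = fb s1 -> J i s1 -> J i s2) ->
  (forall i s1, J i s1 -> forall k, k < rg s 4 -> fb s1 k = fb s k) ->
  (forall i s1, i.+1 < n -> ~~ lms n t i.+1 -> J i.+1 s1 -> J i s1) ->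
  J n.-1 s ->
  (forall i s1 b1, i.+1 < n -> lms n t i.+1 -> rg s1 9 = i -> framed (each_lms body) s s1 ->
     text_at s1 n t -> J i.+1 s1 ->
     wp body (fun b2 s2 => b1 <= b2 /\ J i s2) b1 s1) ->
  (forall s' b', b - n <= b' -> framed (each_lms body) s s' -> text_at s' n t -> J 0 s' -> Q b' s') ->
  wp (each_lms body) Q b s.
Proof.
move=> hT hb /= hm hJc hJF hJs hJ hstep hQ; have hn := Tx_nN hT; have e2 := tx_n hT.
have {hm} /and5P[m0 m2 m3 m4 /and4P[m9 m10 m12 _]] := hm.
have hfrT s1 : framed (each_lms body) s s1 -> (forall k, k < rg s 4 -> fb s1 k = fb s k) -> text_at s1 n t.
  move=> [f1 _ _] hk; apply: (Tx_ext hT) => //; apply: f1;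
  by rewrite /= !inE ?mem_cat ?(negbTE m0) ?(negbTE m2) ?(negbTE m3) ?(negbTE m4).
suff H : wp (each_lms body) (fun b' s' => b - n <= b' /\ J 0 s') b s.
  apply: (wp_conseq H) => b' s' hf [h1 h2]; apply: hQ => //.
  by apply: hfrT => //; exact: hJF h2.
asg; first by rewrite /= e2; side.
asg; first by rewrite /=; lia.
rewrite /= e2; set s0 := setr 12 1 _.
apply: (@wp_while _ _ (fun b' s1 => exists i, [/\ rg s1 9 = i, i < n,
    rg s1 12 = styp n t i, b - (n.-1 - i) <= b' & J i s1])).
  exists n.-1; split=> //; try lia.
  - by rewrite /s0; simp_regs; lia.
  - by rewrite /s0; simp_regs; rewrite styp_last.
  - apply: hJc hJ => // r; rewrite !inE !negb_or => /and5P[_ _ h9 _ h12].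
    by rewrite /s0; simp_regs; rewrite (negbTE h12) (negbTE h9).
move=> b1 s1 [i [e9 hi e12 hb1 hJ1]] hf0; split; first by rewrite /=; lia.
have hf : framed (each_lms body) s s1.
  case: hf0 => f1 f2 f3; split=> // r hr; rewrite f1; last first.
    by move: hr; rewrite /= !inE !negb_or => /and3P[_ _].
  move: hr; rewrite /= !inE !negb_or => /and3P[h9 h12 _].
  by rewrite /s0; simp_regs; rewrite (negbTE h12) (negbTE h9).
have hT1 : text_at s1 n t by apply: hfrT => //; exact: hJF hJ1.
rewrite /= e9; case: i => [|i] in e9 hi e12 hb1 hJ1 *.
  by split=> //; lia.
split; first by lia.
have e2' := tx_n hT1.
asg; first by rewrite /= e9; side.
rewrite /= e9 subn1 /=; set s2 := setr 9 i s1.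
have hT2 : text_at s2 n t by apply: (Tx_ext hT1).
have hin : i < n by lia.
asg; first by split=> //=; exact: (txt_safeE hT2).
rewrite /= (txtE hT2) //; set s3 := setr 8 _ s2.
have hT3 : text_at s3 n t by apply: (Tx_ext hT2).
have ei : rg s3 9 + 1 = i.+1 by rewrite /s3; simp_regs; lia.
asg.
  by rewrite /= ei; do 2 (try split) => //; [lia | lia | exact: (txt_safeE hT3)].
rewrite /= ei (txtE hT3) //; set s4 := setr 7 _ s3.
asg.
  by simp_regs; split=> //; case: ifP => _; [split=> //; case: ifP | lia].
rewrite (_ : ev _ s4 = styp n t i); last first.
  rewrite (stypE t hi); simp_regs; rewrite e12.
  by case: (ltngtP (t i) (t i.+1)) => //= e; case: (styp _ _ _).
set s5 := setr 10 _ s4.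
have hJ5 : J i.+1 s5.
  apply: hJc hJ1 => // r; rewrite !inE !negb_or => /and5P[h7 h8 h9 h10 h12].
  by rewrite /s5 /s4 /s3; simp_regs; rewrite (negbTE h7) (negbTE h8) (negbTE h9) (negbTE h10).
have hT5 : text_at s5 n t by apply: (Tx_ext hT3).
have hl : lms n t i.+1 = styp n t i.+1 && ~~ styp n t i by rewrite /lms hi.
wif; first by simp_regs; split=> //; case: ifP.
rewrite (_ : (ev _ s5 == 0) = ~~ lms n t i.+1); last first.
  by rewrite hl; simp_regs; rewrite e12; case: (styp _ _ _); case: (styp _ _ _).
have fin s6 b6 : rg s6 9 = i -> rg s6 10 = styp n t i -> b1.-1 <= b6 -> J i s6 ->
    wp (Asg 12 (EV 10)) (fun b' s' => exists i, [/\ rg s' 9 = i, i < n,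
    rg s' 12 = styp n t i, b - (n.-1 - i) <= b' & J i s']) b6 s6.
  move=> h9 h10 h11 hJ6; apply: wp_asg => //; exists i; split=> //=; simp_regs; try lia.
  apply: hJc hJ6 => // r; rewrite !inE !negb_or => /and5P[_ _ _ _ h12].
  by simp_regs; rewrite (negbTE h12).
case: (boolP (lms n t i.+1)) => hlm /=; last first.
  by apply: wp_skip; apply: fin => //; exact: hJs hJ5.
apply: wp_conseq (hstep i s5 b1.-1 hi hlm _ _ hT5 hJ5) _ => //.
  case: hf => f1 f2 f3; split=> // r hr; rewrite -f1 //.
  move: hr; rewrite /= !inE !negb_or => /and5P[h9 _ _ h8 /and3P[h7 h10 _]].
  by simp_regs; rewrite (negbTE h9) (negbTE h8) (negbTE h7) (negbTE h10).
move=> b2 s6 [f1 _ _] [h1 h2]; apply: fin => //; rewrite f1 //.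
Qed.

Lemma place_ok s n t b Q p h : text_at s n t -> rg s 13 = p -> p < n -> buckets_hold s n h ->
  h (cmpl n t p) < n ->
  (forall s', framed place s s' -> text_at s' n t ->
     fa s' = upd (fa s) (n.-1 - h (cmpl n t p)) p.+1 ->
     buckets_hold s' n (upd h (cmpl n t p) (h (cmpl n t p)).+1) ->
     kept_outside s n s' ->
     Q b s') ->
  wp place Q b s.
Proof.
move=> hT e13 hp hB hh hQ; have hn := Tx_nN hT; have hbb := tx_bb hT; have e2 := tx_n hT.
suff H : wp place (fun b' s' => [/\ b' = b,
    fa s' = upd (fa s) (n.-1 - h (cmpl n t p)) p.+1,
     buckets_hold s' n (upd h (cmpl n t p) (h (cmpl n t p)).+1) &
     kept_outside s n s']) b s.
  apply: (wp_conseq H) => b' s' hf [-> h2 h3 h4]; apply: hQ => //.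
  by apply: (Tx_fr hT hf) => // _ i hi; apply: h4; left.
have hc := tt_rng true hT hp; rewrite /= in hc.
asg; first by apply: (safe_CH true hT); rewrite //= e13.
rewrite (ev_CH true hT) /= e13 //; set c := cmpl n t p in hc hh hQ *; set s1 := setr 7 c s.
have hv : fb s (rg s 4 + (c - 1)) = h c by apply: hB.
asg; first by simp_regs; side.
simp_regs; rewrite hv; set s2 := setr 14 _ s1.
sto.
- by simp_regs; rewrite e2; side.
- by simp_regs; side.
- by simp_regs; rewrite e2; lia.
simp_regs; rewrite e2 e13 subn1 addn1.
apply: wp_sto; simp_regs; try lia; first by side.
  by split=> //; lia.
split=> //.
- move=> d hd /=; simp_regs; rewrite /upd; case: (d =P c) => [->|ne]; first by rewrite eqxx addn1.
  by case: eqP => [|_]; [lia | exact: hB].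
- by move=> i hi; rewrite /upd; case: eqP => [|_] //; lia.
Qed.

Lemma induce_ok (stop : pred nat) s n t b Q A' h' :
  (forall i, stop i -> lms n t i) -> 1 < n ->
  place_inv n (cmpl n t) (fun i j => le1 n t stop j i) (lms n t) A' h' ->
  text_at s n t -> 8 * n <= b ->
  (forall y, y < n -> fa s y = A' (n.-1 - y)) ->
  (forall s' b' h, b - 8 * n <= b' -> framed induce s s' -> text_at s' n t ->
     sa_ok n (le2 n t stop) (fa s') ->
     (forall i, n <= i -> fa s' i = fa s i) ->
     kept_outside s n s' ->
     buckets_hold s' n h ->
     (forall y p, y < n -> fa s' y = p.+1 -> styp' n t p = (n.-1 - y < h (cmpl n t p))) ->
     Q b' s') ->
  wp induce Q b s.
Proof.
move=> hst n1 hP hT hb hA hQ; have hn := Tx_nN hT; have hV := tx_vt hT.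
have HS := seeded_fwd hV hP hA.
(* Position 0 is never LMS. So the entry 1, which the erasing pass skips, can only come from an
   L-type position 0, which has to stay. *)
have hA1 y : y < n -> fa s y != 1.
  move=> hy; apply/eqP => e; have h0 : A' (n.-1 - y) != 0 by rewrite -hA // e.
  have [|p [e' _ hl _]] := pv_slot hP _ h0; first by lia.
  have ep : p = 0 by rewrite -hA // e in e'; lia.
  by rewrite ep /lms in hl.
suff H : wp induce (fun b' s' => exists h, [/\ b - 8 * n <= b', sa_ok n (le2 n t stop) (fa s'),
    (forall i, n <= i -> fa s' i = fa s i),
    kept_outside s n s' &
     buckets_hold s' n h /\
     (forall y p, y < n -> fa s' y = p.+1 -> styp' n t p = (n.-1 - y < h (cmpl n t p)))]) b s.
  apply: (wp_conseq H) => b' s' hf [h [h1 h2 h3 h4 [h5 h6]]]; apply: (hQ _ _ h) => //.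
  by apply: (Tx_fr hT hf) => // _ i hi; apply: h4; left.
apply: wp_seq; apply: (buckets_ok (rev := false) hT); first by lia.
move=> s1 b1 hb1 hf1 hT1 hF1 hB1.
have ea1 : fa s1 = fa s by case: hf1 => _ ->.
have e41 : rg s1 4 = rg s 4 by case: hf1 => ->.
apply: wp_seq; apply: (@pass_ok _ _ false true _ _ (fa s) s1 n t _ _ (law_fwd hst) HS hT1) => //; first by lia.
  by move=> y hy; rewrite ea1.
move=> s2 b2 G h hb2 hf2 hT2 HI hB2 hA2 hA2' hF2.
have e42 : rg s2 4 = rg s 4 by case: hf2 => ->.
have [HS2 hall] := seeded_bwd hV hst HS HI.
sto => //=; first by lia.
rewrite (tx_n hT2); set s3 := St _ _ _.
have hT3 : text_at s3 n t by apply: (Tx_ext hT2).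
have hmid y : y < n -> fa s3 y = mid_array n t G y.
  move=> hy; rewrite /s3 /= /upd /mid_array; case: eqP => // _.
  have := hA2 y hy; rewrite /= => ->; rewrite /zeroed hy /=.
  case: (ltngtP (G y) 1) => [h0|h1|h1]; first by rewrite (_ : G y = 0) //; lia.
    have -> : G y != 0 by lia.
    by rewrite /=; case: (ltyp _ _ _).
  rewrite h1 /=; case: (boolP (ltyp n t 0)) => // hl0.
  have [|q [e' hq]] := pi_slot HI hy; first by rewrite h1.
  have -> : q = 0 by lia.
  rewrite (negbTE hl0) => e0; have := hA1 _ hy.
  by rewrite e0 h1.
apply: wp_seq; apply: (buckets_ok (rev := true) hT3); first by lia.
move=> s4 b4 hb4 hf4 hT4 hF4 hB4.
have ea4 : fa s4 = fa s3 by case: hf4 => _ ->.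
have e44 : rg s4 4 = rg s 4 by case: hf4 => -> //.
have HL2 := law_bwd hV hst.
apply: (@pass_ok _ _ true false _ _ _ s4 n t _ _ HL2 HS2 hT4) => //; first by lia.
  by move=> y hy; rewrite ea4 /vindex hmid //; lia.
move=> s5 b5 G5 h5 hb5 hf5 hT5 HI5 hB5 hA5 hA5' hF5.
have [hs1 hs2] := sa_final hV hst HS2 hall HI5.
have hGe y : y < n -> fa s5 y = G5 (n.-1 - y).
  move=> hy; have hy' : n.-1 - y < n by lia.
  by have := hA5 _ hy'; rewrite /= subKn ?/zeroed //=; lia.
exists h5; split; first by lia.
- case: hs1 => hp hle; split.
    by rewrite (_ : mkseq (fa s5) n = mkseq (fun y => G5 (n.-1 - y)) n) //; apply/eq_in_map => y; rewrite mem_iota => /andP[_ hy]; exact: hGe.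
  by move=> y z hyz; have hyz2 := hle y z hyz; rewrite !hGe //; lia.
- by move=> i hi; rewrite hA5' // ea4 /s3 /= /upd; case: eqP => [|_]; [lia | rewrite hA2' // ea1].
- by move=> i hi; rewrite hF5 ?e44 // hF4 /= ?e42 // hF2 ?e41 // hF1.
- split=> // y p hy; rewrite hGe // => e; exact: hs2.
Qed.

End Blocks2.

(** * Descent: computing the reduced text *)

Definition place_all :=
  Seq (clear (EC 0)) (Seq (buckets true)
    (each_lms (Seq (Asg 13 (EAdd (EV 9) (EC 1))) place))).

(** An S-type position is LMS iff its predecessor has a larger character, a smaller one in the
    mirror; being S-type is read off the final pointers. Slot 0 holds the last position, LMS but
    outside [styp'], so the scan starts at slot 1 with one position already counted. *)
Definition compact :=
  Seq (Asg 11 (EC 1)) (Seq (Asg 5 (EC 1)) (Loop 5 2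
   (Seq (Asg 6 (ELd ASA (EV 5)))
   (If (ELt (EC 1) (EV 6))
     (Seq (Asg 7 (Echar true (ESub (EV 6) (EC 1))))
     (Seq (Asg 8 (Echar true (ESub (EV 6) (EC 2))))
     (Seq (Asg 10 (ELt (Eindex true (EV 5)) (ELd ALCP (Ebucket (EV 7)))))
     (If (EIf (EV 10) (ELt (EV 8) (EV 7)) (EC 0))
        (Seq (Sto ASA (EV 11) (EV 6)) (Asg 11 (EAdd (EV 11) (EC 1)))) Skip))))
     Skip)))).

(* The half-size area after the m sorted LMS positions is indexed by p / 2, which
   is injective on LMS positions p as no two of them are adjacent. *)
Definition lengths :=
  Seq (Asg 13 (ESub (EV 2) (EC 1)))
  (each_lms
    (Seq (Sto ASA (EAdd (EV 11) (EHalf (EAdd (EV 9) (EC 1))))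
                  (ESub (EV 13) (EAdd (EV 9) (EC 1))))
         (Asg 13 (EAdd (EV 9) (EC 1))))).

Section Descent.
Variables (N : nat) (tx : nat -> nat).
Notation ev := (ev tx).
Notation safe := (safe N tx).
Notation wp := (wp N tx).
Notation text_at := (text_at N tx).

(** Any order inside a bucket will do: for [stop = lms], seeds are compared by their first code only
    and all tie. *)
Lemma place_all_ok s n t b Q : text_at s n t -> 5 * n <= b ->
  (forall s' b' A h, b - 5 * n <= b' -> framed place_all s s' -> text_at s' n t ->
     place_inv n (cmpl n t) (fun i j => le1 n t (lms n t) j i) (lms n t) A h ->
     (forall y, y < n -> fa s' y = A (n.-1 - y)) ->
     kept_outside s n s' ->
     Q b' s') ->
  wp place_all Q b s.
Proof.
move=> hT hb hQ; have hn := Tx_nN hT.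
suff H : wp place_all (fun b' s' => exists A h, [/\ b - 5 * n <= b',
     place_inv n (cmpl n t) (fun i j => le1 n t (lms n t) j i) (lms n t) A h,
     (forall y, y < n -> fa s' y = A (n.-1 - y)) &
     kept_outside s n s']) b s.
  apply: (wp_conseq H) => b' s' hf [A [h [h1 h2 h3 h4]]]; apply: (hQ _ _ A h) => //.
  by apply: (Tx_fr hT hf) => // _ i hi; apply: h4; left.
apply: wp_seq; apply: (clear_ok (tx_n hT)) => //; first by lia.
move=> s1 b1 hb1 hf1 hA1.
have eb1 : fb s1 = fb s by case: hf1 => _ _ ->.
have e41 : rg s1 4 = rg s 4 by case: hf1 => ->.
have hT1 : text_at s1 n t by apply: (Tx_fr hT hf1).
apply: wp_seq; apply: (buckets_ok (rev := true) hT1); first by lia.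
move=> s2 b2 hb2 hf2 hT2 hF2 hB2.
have ea2 : fa s2 = fa s1 by case: hf2 => _ ->.
have e42 : rg s2 4 = rg s 4 by case: hf2 => ->.
pose J i s3 := exists A h, [/\ place_inv n (cmpl n t) (fun i j => le1 n t (lms n t) j i)
   (fun p => lms n t p && (i < p)) A h, buckets_hold s3 n h, rg s3 4 = rg s 4,
   (forall y, y < n -> fa s3 y = A (n.-1 - y)) &
   kept_outside s n s3].
apply: (each_lms_ok (J := J) hT2) => //; first by lia.
- move=> i s3 s4 hr ha hfb [A [h [h1 h2 h3 h4 h5]]]; exists A, h.
  have e4 : rg s4 4 = rg s3 4 by apply: hr.
  by split=> //; [move=> c hc; rewrite hfb e4; exact: h2 | rewrite e4 | rewrite ha | rewrite hfb].
- move=> i s3 [A [h [_ _ _ _ h5]]] k; rewrite e42 => hk.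
  by rewrite h5 ?hF2 ?e41 ?eb1 //; left.
- move=> i s3 hi hl [A [h [h1 h2 h3 h4 h5]]]; exists A, h; split=> //.
  apply: plinv_eq h1 => // p hp; case: (p =P i.+1) => [->|ne]; first by rewrite (negbTE hl).
  by congr (_ && _); lia.
- exists (fun=> 0), (bkt_start n (cmpl n t)); split=> //.
  + apply: (@plinv_eq _ _ _ pred0 _ (fun=> 0) _ (bkt_start n (cmpl n t))) => //; last by apply: plinv0.
    by move=> p hp /=; apply/esym/negbTE/negP => /andP[_]; lia.
  + by move=> y hy; rewrite ea2 hA1 /= hy.
  + by move=> i hi; rewrite hF2 ?e41 // eb1.
- move=> i s3 b3 hi hl e9 hf3 hT3 [A [h [h1 h2 h3 h4 h5]]].
  asg; first by rewrite /= e9; side.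
  rewrite /= e9 addn1; set s4 := setr 13 _ s3.
  have hT4 : text_at s4 n t by apply: (Tx_ext hT3).
  have hnD : ~~ (lms n t i.+1 && (i.+1 < i.+1)) by rewrite ltnn andbF.
  have hlt := plinv_lt h1 hi hnD; have hble := bs_le n (cmpl n t) (cmpl n t i.+1).+1.
  have hst := plinv_step h1 hi hnD.
  apply: (place_ok (p := i.+1) (h := h) hT4) => //; first by lia.
  move=> s5 hf5 hT5 ha5 hB5 hF5; split=> //.
  have e45 : rg s5 4 = rg s 4 by case: hf5 => -> //.
  exists (upd A (h (cmpl n t i.+1)) i.+2), (upd h (cmpl n t i.+1) (h (cmpl n t i.+1)).+1).
  split=> //.
  + apply: plinv_eq (hst _) => //.
      move=> p hp; case: (p =P i.+1) => [->|ne]; first by rewrite hl ltnn ltnSn.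
      by rewrite orbF; congr (_ && _); lia.
    move=> q hq /andP[hlq _] et; rewrite /le1 /key1 hl hlq.
    have et' : t q = t i.+1.
      by have := Tx_rng hT hq; have := Tx_rng hT hi; move: et; rewrite /cmpl; lia.
    by rewrite /ecode et' (lms_styp hl) (lms_styp hlq); exact: lex_le_refl.
  + move=> y hy; rewrite ha5 /upd; case: eqP => [->|ne].
      by rewrite subKn ?eqxx //; lia.
    by case: eqP => [e|_]; [lia | exact: h4].
  + by move=> j hj; rewrite hF5; [exact: h5 | rewrite /s4; simp_regs; rewrite h3].
- move=> s3 b3 hb3 hf3 hT3 [A [h [h1 h2 h3 h4 h5]]]; exists A, h; split=> //; first by lia.
  apply: plinv_eq h1 => // p hp.
  by rewrite /lms lt0n; case: (p != 0); rewrite ?andbT ?andbF.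
Qed.

Lemma sa_first n t stop A : vtext n t -> sa_ok n (le2 n t stop) A -> A 0 = n.
Proof.
move=> hV hS; have hn := vt_pos hV.
have [|y hy e] := sa_all (p := n.-1) hS; first by lia.
case: (posnP y) => [y0|y0]; first by rewrite -y0 e; lia.
have hv := sa_val hS hn.
have := hS.2 0 y; rewrite y0 hy => /(_ isT).
rewrite e /le2 /=; case: ((A 0).-1 =P n.-1) => [?|/eqP ne]; first by lia.
have [u ->] := key_cons n t stop (A 0).-1; have [v ->] := key_cons n t stop n.-1.
have e1 : t n.-1 = 1 by apply/eqP; rewrite (vt_last hV) //; lia.
have h2 : 1 < t (A 0).-1.
  have hA0 : (A 0).-1 < n by lia.
  by have := vt_last hV hA0; have := vt_rng hV hA0; rewrite (negbTE ne); lia.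
by rewrite /lex_le /= {1}/ecode {1}/ecode e1; lia.
Qed.

Lemma sa_lsorted n t A : vtext n t -> 1 < n -> sa_ok n (le2 n t (lms n t)) A ->
  let L := [seq v <- mkseq A n | lms n t v.-1] in
  size L = cnt n (lms n t) /\ lsorted n t (cnt n (lms n t)) (fun y => (nth 0 L y).-1).
Proof.
move=> hV n1 hS L; have hn := vt_pos hV.
have hsz : size L = cnt n (lms n t).
  rewrite size_filter (permP hS.1) (iotaDl 1 0) count_map.
  by apply: eq_count.
have hin y : y < size L -> (nth 0 L y) \in L by apply: mem_nth.
have hu : uniq L by rewrite filter_uniq // (perm_uniq hS.1) iota_uniq.
have hpos y : y < size L -> 0 < nth 0 L y.
  by move=> /hin; rewrite mem_filter (perm_mem hS.1) mem_iota => /and3P[].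
split=> //; rewrite -hsz; split.
- by move=> y /hin; rewrite mem_filter => /andP[].
- move=> p hp; have [y hy e] := sa_all hS (lms_lt hp).
  have hl : p.+1 \in L.
    by rewrite mem_filter /= hp -e; apply/mapP; exists y; rewrite // mem_iota.
  by exists (index p.+1 L); rewrite ?index_mem // nth_index.
- move=> y z hy hz e; have := nth_uniq 0 hy hz hu.
  have := hpos _ hy; have := hpos _ hz => h1 h2.
  by have -> : nth 0 L y = nth 0 L z by [lia]; rewrite eqxx => /esym/eqP.
- move=> y z /andP[hyz hz].
  pose r a b := lex_le (key n t (lms n t) a.-1) (key n t (lms n t) b.-1).
  have htr : transitive r by move=> a b c; exact: lex_le_trans.
  have hso : sorted r L.
    apply: sorted_filter => //; apply/(sortedP 0) => i; rewrite size_mkseq => hi.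
    rewrite !nth_mkseq //; last by lia.
    by apply: hS.2; rewrite ltnSn.
  by apply: (sorted_ltn_nth htr 0 hso) => //; rewrite inE; lia.
Qed.

Lemma compact_ok s n t b Q h : text_at s n t -> 1 < n -> n <= b ->
  sa_ok n (le2 n t (lms n t)) (fa s) -> buckets_hold s n h ->
  (forall y p, y < n -> fa s y = p.+1 -> styp' n t p = (n.-1 - y < h (cmpl n t p))) ->
  (forall s' b' q, b - n <= b' -> framed compact s s' -> text_at s' n t ->
     rg s' 11 = cnt n (lms n t) -> lsorted n t (cnt n (lms n t)) q ->
     (forall y, y < cnt n (lms n t) -> fa s' y = (q y).+1) -> Q b' s') ->
  wp compact Q b s.
Proof.
move=> hT n1 hb hS hB hst hQ; have hn := Tx_nN hT; have hV := tx_vt hT.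
have hbb := tx_bb hT.
have [hsz hls] := sa_lsorted hV n1 hS.
set L := [seq v <- _ | _] in hsz hls.
suff H : wp compact (fun b' s' => [/\ b - n <= b', rg s' 11 = size L &
    forall y, y < size L -> fa s' y = nth 0 L y]) b s.
  apply: (wp_conseq H) => b' s' hf [h1 h2 h3]; apply: (hQ _ _ _ h1 hf _ _ hls).
  - exact: (Tx_fr hT hf).
  - by rewrite h2.
  - rewrite -hsz => y hy; rewrite h3 // prednK //.
    have : nth 0 L y \in L by apply: mem_nth.
    by rewrite mem_filter (perm_mem hS.1) mem_iota => /and3P[].
asg; first by rewrite /=; lia.
asg; first by rewrite /=; lia.
pose Lx x := [seq v <- mkseq (fa s) x | lms n t v.-1].
have LxS x : Lx x.+1 = if lms n t (fa s x).-1 then rcons (Lx x) (fa s x) else Lx x.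
  rewrite /Lx /mkseq -addn1 iotaD map_cat filter_cat /= add0n.
  by case: ifP => _; rewrite ?cats1 ?cats0.
have Lx_le x : size (Lx x) <= x by rewrite size_filter -[X in _ <= X](size_mkseq (fa s)) count_size.
have A0 := sa_first hV hS.
set s1 := setr 5 _ _.
apply: (@wp_loop _ _ 5 2 _ (fun x s' => [/\ rg s' 11 = size (Lx x),
    forall y, y < size (Lx x) -> fa s' y = nth 0 (Lx x) y &
    forall y, x <= y -> fa s' y = fa s y]) _ _ _ 1 n) => //; try lia.
- by rewrite /s1; simp_regs; exact: (tx_n hT).
- have hl0 : lms n t n.-1 by apply: lms_last.
  rewrite LxS A0 hl0 /= /Lx /=; split=> //.
  by case=> [|y] //= _; rewrite A0.
- move=> x s2 b2 /andP[x1 hx] ex hf [h1 h2 h3].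
  have hf' : framed compact s s2.
    case: hf => f1 f2 f3; split=> // r hr; rewrite f1; last first.
      by move: hr; rewrite /= !inE !negb_or => /and3P[_ _].
    by move: hr; rewrite /= !inE !negb_or /s1; simp_regs => /and3P[/negbTE-> /negbTE->].
  have hT2 : text_at s2 n t by apply: (Tx_fr hT hf').
  have hv := sa_val hS hx; have e2 := tx_n hT2.
  have e4 : rg s2 4 = rg s 4 by case: hf' => ->.
  have efb : fb s2 = fb s by case: hf' => _ _ ->.
  asg; first by rewrite /= ex; split=> //; lia.
  rewrite /= ex h3 //; set s3 := setr 6 _ s2.
  have hT3 : text_at s3 n t by apply: (Tx_ext hT2).
  have hskip s4 b4 : b2 <= b4 -> ~~ lms n t (fa s x).-1 -> rg s4 5 = x -> rg s4 11 = rg s2 11 ->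
     fa s4 = fa s2 -> [/\ b2 <= b4, rg s4 5 = x
    & [/\ rg (setr 5 x.+1 s4) 11 = size (Lx x.+1), forall y : nat, y < size (Lx x.+1) ->
       fa (setr 5 x.+1 s4) y = nth 0 (Lx x.+1) y
      & forall y : nat, x < y -> fa (setr 5 x.+1 s4) y = fa s y]].
    move=> hb4 hnl e5 e11 ea; split=> //; rewrite LxS (negbTE hnl); simp_regs; rewrite ea e11.
    by split=> // y hy; apply: h3; lia.
  apply: wp_if; first by simp_regs; split=> //; lia.
  simp_regs; case: (ltnP 1 (fa s x)) => hg /=; last first.
    apply: wp_skip; apply: hskip => //.
    by have -> : fa s x = 1 by [lia]; rewrite /lms.
  have [p eG] : exists p, fa s x = p.+2 by exists (fa s x).-2; lia.
  have hpn : p.+1 < n by lia.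
  have hpl : p.+1 != n.-1.
    apply/eqP => e; have : x = 0 by apply: (sa_inj hS) => //; try lia; rewrite A0 eG; lia.
    by lia.
  rewrite eG /= in s3 hT3 hskip *.
  have hev : ev (ESub (EV 6) (EC 1)) s3 = p.+1 by simp_regs; lia.
  asg.
    by apply: (safe_CH true hT3); rewrite ?hev //; simp_regs; do 2 (try split); lia.
  rewrite (ev_CH true hT3) hev //; set cj := vchar true n t p.+1; set s4 := setr 7 _ s3.
  have hcj := tt_rng true hT hpn; rewrite -/cj in hcj.
  have hT4 : text_at s4 n t by apply: (Tx_ext hT3).
  have hev4 : ev (ESub (EV 6) (EC 2)) s4 = p by simp_regs; lia.
  asg.
    by apply: (safe_CH true hT4); rewrite ?hev4 //; simp_regs; do 2 (try split); lia.
  rewrite (ev_CH true hT4) hev4; last by lia.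
  set ci := vchar true n t p; set s5 := setr 8 _ s4.
  have hvj : fb s (rg s 4 + (cj - 1)) = h cj by apply: hB.
  asg.
    by simp_regs; rewrite e2 e4 ex; side.
  simp_regs; rewrite e2 e4 ex efb hvj subn1.
  have hl : lms n t p.+1 = (n.-1 - x < h cj) && (ci < cj).
    rewrite -(hst x p.+1 hx eG) /styp' /lms hpn /= (stypE t hpn).
    have -> : p.+2 < n by lia.
    have := Tx_rng hT hpn; have := Tx_rng hT (ltnW hpn); rewrite /ci /cj /= /cmpl.
    by case: (styp n t p.+1) => //=; case: (ltngtP (t p) (t p.+1)) => //=; lia.
  apply: wp_if; first by simp_regs; split=> //; case: ifP.
  set tst := (ev _ _ == 0).
  have -> : tst = ~~ lms n t p.+1.
    by rewrite hl /tst; simp_regs; case: (_ - _ < _) => //=; case: (ci < cj).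
  case: (boolP (lms n t p.+1)) => hlm /=; last by apply: wp_skip; apply: hskip.
  (* The write index never passes the read index, so unread entries survive. *)
  have hsx := Lx_le x.
  sto; simp_regs; rewrite ?h1 //; try lia.
  apply: wp_asg; first by simp_regs; rewrite h1; split=> //; lia.
  split=> //; simp_regs; rewrite LxS eG /= hlm size_rcons h1 addn1; split=> //.
    move=> y hy; rewrite /upd nth_rcons; case: (ltngtP y (size (Lx x))) => // hyx.
      exact: h2.
    by lia.
  by move=> y hy; rewrite /upd; case: eqP => [|_]; [lia | apply: h3; lia].
- by move=> s2 b2 hb2 hf ex [h1 h2 h3]; split=> //; lia.
Qed.

End Descent.

(** * Naming LMS substrings and packing the reduced text *)

(** Registers 15 and 17 hold length and position of the preceding LMS substring, 16 the current
    name, 18 the number of agreeing characters; the substrings are equal once 18 exceeds the length.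
    The initial length 1 differs from the length 0 of the first entry, which therefore gets a new
    name without comparison. *)
Definition naming :=
  Seq (Asg 15 (EC 1)) (Seq (Asg 16 (EC 0)) (Seq (Asg 17 (EC 0)) (For 5 11
  (Seq (Asg 6 (ESub (ELd ASA (EV 5)) (EC 1)))
  (Seq (Asg 19 (EAdd (EV 11) (EHalf (EV 6))))
  (Seq (Asg 14 (ELd ASA (EV 19)))
  (Seq (Asg 10 (EC 0))
  (Seq (If (EEq (EV 14) (EV 15))
     (Seq (Asg 18 (EC 0))
     (Seq (While (EIf (ELt (EV 14) (EV 18)) (EC 0)
                   (EEq (EText (EAdd (EV 6) (EV 18))) (EText (EAdd (EV 17) (EV 18)))))
             (Asg 18 (EAdd (EV 18) (EC 1))))
          (Asg 10 (ELt (EV 14) (EV 18)))))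
     Skip)
  (Seq (If (EV 10) Skip (Asg 16 (EAdd (EV 16) (EC 1))))
  (Seq (Sto ASA (EV 19) (EV 16))
  (Seq (Asg 17 (EV 6)) (Asg 15 (EV 14))))))))))))).

(** The half-size area is in text order, so skipping its zeros lists the names in text order. They
    overwrite the bucket pointers, which have served their purpose. *)
Definition pack :=
  Seq (Asg 18 (EC 0)) (Seq (Asg 5 (EV 11)) (Loop 5 2
   (Seq (Asg 6 (ELd ASA (EV 5)))
   (If (EV 6)
     (Seq (Sto ALCP (EAdd (EV 4) (EV 18)) (EV 6))
          (Asg 18 (EAdd (EV 18) (EC 1))))
     Skip)))).

Section Descent2.
Variables (N : nat) (tx : nat -> nat).
Notation ev := (ev tx).
Notation safe := (safe N tx).
Notation wp := (wp N tx).
Notation text_at := (text_at N tx).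

(** The version for bodies with inner loops: iteration [i] may spend [w i], so amortized bounds
    enter through the sum. *)
Lemma wp_forw x r c (w : nat -> nat) (J : nat -> st -> Prop) Q b s0 n :
  rg s0 r = n -> n <= N -> x != r -> r \notin mods c ->
  \sum_(i < n) (w i).+1 <= b ->
  J 0 (setr x 0 s0) ->
  (forall i s b', i < n -> rg s x = i -> framed (For x r c) s0 s -> J i s -> w i <= b' ->
     wp c (fun b'' s' => [/\ b' - w i <= b'', rg s' x = i & J i.+1 (setr x i.+1 s')]) b' s) ->
  (forall s b', b - \sum_(i < n) (w i).+1 <= b' -> framed (For x r c) s0 s -> rg s x = n ->
     J n s -> Q b' s) ->
  wp (For x r c) Q b s0.
Proof.
move=> er hn hxr hrm hb hJ hstep hQ.
asg => //=.
pose W k := \sum_(i < k) (w i).+1.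
have WS k : W k.+1 = W k + (w k).+1 by rewrite /W big_ord_recr.
have Wm k : k <= n -> W k <= W n.
  move=> hk; rewrite -(subnKC hk); elim: (n - k) => [|d IH]; first by rewrite addn0.
  by rewrite addnS WS; lia.
apply: (@wp_while _ _ (fun b' s => exists i, [/\ rg s x = i, i <= n, b - W i <= b' & J i s])).
  by exists 0; split=> //=; [rewrite /updr eqxx | rewrite /W big_ord0; lia].
move=> b' s [i [exi hi hb' hJi]] hf.
have hf0 : framed (For x r c) s0 s.
  case: hf => f1 f2 f3; split=> //= y; rewrite inE negb_or => /andP[hy hy'].
  by rewrite f1 //= /updr (negbTE hy).
have hrg : rg s r = n.
  case: (hf0) => -> //=; rewrite inE negb_or eq_sym hxr /=.
  by rewrite mem_cat negb_or hrm inE eq_sym hxr.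
split=> //=; rewrite exi hrg.
case: (ltnP i n) => hin /=; last first.
  by have e : i = n by [lia]; rewrite e in exi hb' hJi; exact: hQ.
have h1 := WS i; have h2 := Wm _ hin; have h3 : W n <= b by [].
split; first by lia.
apply: wp_seq; apply: wp_conseq (hstep i s b'.-1 hin exi hf0 hJi _) _; first by lia.
move=> b'' s' hf' [hb'' ex' hJ']; apply: wp_asg => /=; first by rewrite ex'; split=> //; lia.
rewrite ex' addn1; exists i.+1; split=> //; try lia.
by rewrite /= /updr eqxx.
Qed.

Lemma lms_half n t p q : lms n t p -> lms n t q -> p %/ 2 = q %/ 2 -> p = q.
Proof.
move=> hp hq e; case: (ltngtP p q) => // h.
  have eq : q = p.+1 by lia.
  by move: hq; rewrite eq /lms /= (lms_styp hp) andbF andbF.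
have eq : p = q.+1 by lia.
by move: hp; rewrite eq /lms /= (lms_styp hq) andbF andbF.
Qed.

Lemma lms_area n t p : lms n t p -> cnt n (lms n t) + p %/ 2 < n.
Proof. by move=> h; have := lms_lt h; have := cnt_lms2 n t; lia. Qed.

Lemma nxt_nlms n t i : vtext n t -> i.+1 < n -> ~~ lms n t i.+1 -> next_lms n t i = next_lms n t i.+1.
Proof. by move=> hV hi hl; rewrite nxtE // (negbTE hl). Qed.

Definition area n t (f : nat -> nat) (g : nat -> nat) (P : pred nat) :=
  (forall p, lms n t p -> P p -> f (cnt n (lms n t) + p %/ 2) = g p) /\
  (forall y, cnt n (lms n t) <= y < n ->
     (forall p, lms n t p -> cnt n (lms n t) + p %/ 2 <> y) -> f y = 0).

Lemma lengths_ok s n t b Q : text_at s n t -> 1 < n -> n <= b ->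
  rg s 11 = cnt n (lms n t) ->
  (forall y, cnt n (lms n t) <= y < n -> fa s y = 0) ->
  (forall s' b', b - n <= b' -> framed lengths s s' -> text_at s' n t ->
     (forall y, y < cnt n (lms n t) -> fa s' y = fa s y) ->
     area n t (fa s') (fun p => next_lms n t p - p) predT ->
     Q b' s') ->
  wp lengths Q b s.
Proof.
move=> hT n1 hb e11 h0 hQ; have hn := Tx_nN hT; have hV := tx_vt hT.
have e2 := tx_n hT.
set m := cnt n (lms n t) in e11 h0 hQ.
suff H : wp lengths (fun b' s' => [/\ b - n <= b', (forall y, y < m -> fa s' y = fa s y) &
     area n t (fa s') (fun p => next_lms n t p - p) predT]) b s.
  by apply: (wp_conseq H) => b' s' hf [h1 h2 h3]; apply: hQ => //; exact: (Tx_fr hT hf).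
asg; first by rewrite /= e2; side.
rewrite /= e2 subn1; set s1 := setr 13 _ s.
have hT1 : text_at s1 n t by apply: (Tx_ext hT).
pose J i s2 := [/\ rg s2 13 = next_lms n t i, rg s2 11 = m, fb s2 = fb s,
   forall y, y < m -> fa s2 y = fa s y &
   area n t (fa s2) (fun p => next_lms n t p - p) (fun p => i < p)].
apply: (each_lms_ok (J := J) hT1) => //.
- move=> i s2 s3 hr ha hfb [h1 h2 h3 h4 h5]; split; rewrite ?ha ?hfb //.
    by rewrite hr.
  by rewrite hr.
- by move=> i s2 [_ _ ->].
- move=> i s2 hi hl [h1 h2 h3 h4 [h5 h6]]; split=> //; first by rewrite (nxt_nlms hV).
  split=> // p hp hip; apply: h5 => //.
  by case: (p =P i.+1) => [e|]; [rewrite -e hp in hl | lia].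
- split=> //; first by rewrite nxt_last.
  split=> [p hp hip|y hy _]; last exact: h0.
  by have := lms_lt hp; lia.
- move=> i s2 b2 hi hl e9 hf2 hT2 [h1 h2 h3 h4 [h5 h6]].
  have ha := lms_area hl; have hx := nxt_ge n t i.+1.
  have hxn : next_lms n t i.+1 < n.
    case: (ltnP i.+2 n) => h; first by have [] := nxt_spec hV h; lia.
    by have -> : i.+1 = n.-1 by [lia]; rewrite nxt_last; lia.
  sto => /=; rewrite ?e9 ?h1 ?h2 ?addn1 //.
  + by side.
  + by side.
  + by rewrite -/m in ha; lia.
  apply: wp_asg => /=; rewrite ?e9; first by side.
  split=> //; split=> //; simp_regs.
  + by rewrite nxtE // hl addn1.
  + by move=> y hy; rewrite /upd; case: eqP => [|_]; [lia | exact: h4].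
  rewrite -/m in ha; split=> [p hp hip|y hy hny]; rewrite /upd.
    case: eqP => [e|ne]; last first.
      by apply: h5 => //; case: (p =P i.+1) => [e|]; [rewrite e in ne | lia].
    by have -> : p = i.+1 by apply: (lms_half hp hl); rewrite -/m in e; lia.
  case: eqP => [e|ne]; last exact: h6.
  by case: (hny _ hl); rewrite -/m e.
- by move=> s2 b2 hb2 hf2 hT2 [h1 h2 h3 h4 [h5 h6]]; split=> //; split=> // p hp _; apply: h5 => //; case/andP: hp.
Qed.

(** The lengths telescope, each LMS substring ending where the next one starts. *)
Lemma sum_nxt n t : vtext n t -> 1 < n ->
  \sum_(p <- iota 0 n | lms n t p) (next_lms n t p - p) <= n.
Proof.
move=> hV n1; have hn := vt_pos hV.
suff H d i : i + d = n.-1 ->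
    \sum_(p <- iota i.+1 d | lms n t p) (next_lms n t p - p) + next_lms n t i = n.-1.
  have e0 : iota 0 n = 0 :: iota 1 n.-1 by case: (n) hn.
  by have := H n.-1 0 (add0n _); rewrite e0 big_cons (_ : lms n t 0 = false) //; lia.
elim: d i => [|d IH] i hi.
  rewrite big_nil (_ : i = n.-1); last by lia.
  by rewrite nxt_last.
have hi2 : i.+1 < n by lia.
rewrite -[iota i.+1 d.+1]/(i.+1 :: iota i.+2 d) big_cons (nxtE t hi2).
have := IH i.+1 (ltac:(lia)); have := nxt_ge n t i.+1.
by case: ifP => _; lia.
Qed.

Lemma naming_ok s n t b Q q : text_at s n t -> 1 < n -> 4 * n <= b ->
  rg s 11 = cnt n (lms n t) -> lsorted n t (cnt n (lms n t)) q ->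
  (forall y, y < cnt n (lms n t) -> fa s y = (q y).+1) ->
  area n t (fa s) (fun p => next_lms n t p - p) predT ->
  (forall s' b', b - 4 * n <= b' -> framed naming s s' -> text_at s' n t ->
     (forall x, x < cnt n (lms n t) -> fa s' (cnt n (lms n t) + q x %/ 2) = lms_name n t q x) ->
     (forall y, cnt n (lms n t) <= y < n ->
        (forall p, lms n t p -> cnt n (lms n t) + p %/ 2 <> y) -> fa s' y = 0) ->
     Q b' s') ->
  wp naming Q b s.
Proof.
move=> hT n1 hb e11 hq hsa [har1 har2] hQ; have hn := Tx_nN hT; have hV := tx_vt hT.
have hm2 := cnt_lms2 n t; have hareaP := @lms_area n t.
set m := cnt n (lms n t) in e11 hq hsa har1 har2 hQ hm2 hareaP.
have m0 : 0 < m by have := rk_lt (lms_last hV n1); rewrite -/m; lia.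
suff H : wp naming (fun b' s' => [/\ b - 4 * n <= b',
     (forall x, x < m -> fa s' (m + q x %/ 2) = lms_name n t q x) &
     (forall y, m <= y < n -> (forall p, lms n t p -> m + p %/ 2 <> y) -> fa s' y = 0)]) b s.
  by apply: (wp_conseq H) => b' s' hf [h1 h2 h3]; apply: hQ => //; exact: (Tx_fr hT hf).
(* Each entry costs its length plus at most 3. The lengths add up to at most [n] and there are at
   most n/2 entries, which stays below [4 * n]. *)
have hsum : \sum_(x < m) (next_lms n t (q x) - q x + 2).+1 <= 4 * n.
  have -> : \sum_(x < m) (next_lms n t (q x) - q x + 2).+1 =
      \sum_(x < m) (next_lms n t (q x) - q x) + m * 3.
    rewrite -[m in m * 3]card_ord -sum_nat_const -big_split /=.
    by apply: eq_bigr => x _; rewrite -addnS.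
  have -> : \sum_(x < m) (next_lms n t (q x) - q x) =
      \sum_(p <- [seq q x | x <- iota 0 m]) (next_lms n t p - p).
    by rewrite big_map -(big_mkord predT (fun x => next_lms n t (q x) - q x)) /index_iota subn0.
  suff -> : \sum_(p <- [seq q x | x <- iota 0 m]) (next_lms n t p - p) =
      \sum_(p <- iota 0 n | lms n t p) (next_lms n t p - p) by have := sum_nxt hV n1; lia.
  rewrite -[RHS]big_filter; apply: perm_big; apply: uniq_perm.
  - rewrite map_inj_in_uniq ?iota_uniq // => x y; rewrite !mem_iota => hx hy.
    by apply: (ls_inj hq); lia.
  - exact: filter_uniq (iota_uniq _ _).
  - move=> p; rewrite mem_filter mem_iota; apply/mapP/andP => [[x]|[hp _]].
      rewrite mem_iota => /andP[_ hx] ->; have hl := ls_lms hq hx; split=> //.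
      exact: lms_lt hl.
    by have [x hx e] := ls_all hq hp; exists x; rewrite ?mem_iota.
asg; first by rewrite /=; lia.
asg => //=.
asg => //=.
set s1 := setr 17 _ _.
have hT1 : text_at s1 n t by apply: (Tx_ext hT).
pose J x s2 := [/\ rg s2 16 = (if x is x'.+1 then lms_name n t q x' else 0),
   (if x is x'.+1 then rg s2 17 = q x' /\ rg s2 15 = next_lms n t (q x') - q x' else rg s2 15 = 1),
   (forall y, y < m -> fa s2 y = fa s y),
   (forall y, y < m -> fa s2 (m + q y %/ 2) =
      if y < x then lms_name n t q y else next_lms n t (q y) - q y) &
   (forall y, m <= y < n -> (forall p, lms n t p -> m + p %/ 2 <> y) -> fa s2 y = 0)].
have hlast : q 0 = n.-1 by apply: (ls_first hV hq).
have hne x : 0 < x < m -> (q x).+1 < n.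
  move=> hx; have hl := ls_lms hq (x := x); have := lms_lt (hl (ltac:(lia))).
  case: (ltnP (q x).+1 n) => // h1 h2; have : q x = q 0 by lia.
  by move/(ls_inj hq); lia.
have hnlt p : lms n t p -> next_lms n t p < n.
  move=> hl; have hp := lms_lt hl; case: (ltnP p.+1 n) => h; first by have [] := nxt_spec hV h; lia.
  by have -> : p = n.-1 by [lia]; rewrite nxt_last; lia.
apply: (wp_forw (w := fun x => next_lms n t (q x) - q x + 2) (n := m) (J := J)) => //; try lia.
- split=> //= y hy; rewrite -har1 //; exact: (ls_lms hq).
- move=> x s2 b2 hx ex hf [h16 h17 hlo hhi hz] hb2.
  have hf' : framed naming s s2.
    case: hf => f1 f2 f3; split=> // r hr; rewrite f1; last first.
      by move: hr; rewrite /= !inE !negb_or => /and4P[_ _ _].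
    by move: hr; rewrite /= !inE !negb_or /s1; simp_regs => /and4P[/negbTE-> /negbTE-> /negbTE->].
  have hT2 : text_at s2 n t by apply: (Tx_fr hT hf').
  have e112 : rg s2 11 = m by case: hf' => ->.
  have hl := ls_lms hq hx; have hqn := lms_lt hl; have har := hareaP _ hl.
  have hqx := nxt_ge n t (q x); have hqx2 := hnlt _ hl.
  asg.
    by rewrite /= ex hlo // hsa //; side.
  rewrite /= ex hlo // hsa // subn1 /=.
  asg; first by simp_regs; rewrite e112; side.
  simp_regs; rewrite e112.
  asg; first by simp_regs; split=> //; lia.
  simp_regs; rewrite hhi // ltnn; set lcp_at := next_lms n t (q x) - q x.
  asg => //; set s3 := setr 10 _ _.
  have hT3 : text_at s3 n t by apply: (Tx_ext hT2).
  apply: wp_seq.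
  pose same := if x is x'.+1 then key n t (lms n t) (q x') == key n t (lms n t) (q x) else false.
  have hsame : (if x is x'.+1 then lms_name n t q x' else 0) + ~~ same = lms_name n t q x.
    by rewrite /same; case: (x).
  have fin s4 b4 : b2 - (lcp_at + 2) <= b4 -> rg s4 10 = same -> rg s4 5 = x ->
      rg s4 6 = q x -> rg s4 14 = lcp_at -> rg s4 16 = rg s2 16 -> rg s4 19 = m + q x %/ 2 ->
      fa s4 = fa s2 ->
    wp (Seq (If (EV 10) Skip (Asg 16 (EAdd (EV 16) (EC 1))))
          (Seq (Sto ASA (EV 19) (EV 16)) (Seq (Asg 17 (EV 6)) (Asg 15 (EV 14)))))
    (fun b'' s' => [/\ b2 - (lcp_at + 2) <= b'', rg s' 5 = x & J x.+1 (setr 5 x.+1 s')]) b4 s4.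
    move=> hb4 e10 e5 e6 e14 e16 e19 ea; wif => //=.
    have fin2 s5 : rg s5 5 = x -> rg s5 6 = q x -> rg s5 14 = lcp_at -> rg s5 16 = lms_name n t q x ->
       rg s5 19 = m + q x %/ 2 -> fa s5 = fa s2 ->
       wp (Seq (Sto ASA (EV 19) (EV 16)) (Seq (Asg 17 (EV 6)) (Asg 15 (EV 14))))
        (fun b'' s' => [/\ b2 - (lcp_at + 2) <= b'', rg s' 5 = x & J x.+1 (setr 5 x.+1 s')]) b4 s5.
      move=> e5' e6' e14' e16' e19' ea'.
      sto => //=; first by rewrite e19'; lia.
      asg => //; apply: wp_asg => //.
      split=> //; split=> //; simp_regs; rewrite ?e6' ?e14' ?e16' ?e19' ?ea' //.
      - by move=> y hy; rewrite /upd; case: eqP => [|_]; [lia | exact: hlo].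
      - move=> y hy; rewrite /upd; case: eqP => [e|ne].
          have -> : y = x.
            by apply: (ls_inj hq) => //; apply: (lms_half (ls_lms hq hy) hl); lia.
          by rewrite ltnSn.
        rewrite hhi // ltnS [y <= x]leq_eqVlt.
        by case: (y =P x) => [e|//]; rewrite e in ne.
      - move=> y hy hny; rewrite /upd; case: eqP => [e|_]; last exact: hz.
        by case: (hny _ hl).
    have hx0 := nmx_le q n1 (erefl m) x.
    rewrite e10 eqb0; case: (boolP same) => hs /=.
      by apply: wp_skip; apply: fin2 => //; rewrite e16 h16 -hsame hs addn0.
    apply: wp_asg; first by rewrite /= e16 h16; split=> //; move: hsame; rewrite hs /=; lia.
    apply: fin2 => //=; simp_regs; rewrite e16 h16 -hsame hs //.
  apply: wp_if => //; rewrite [ev _ s3]/= {1}/updr /=; simp_regs.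
  case: (lcp_at =P rg s2 15) => [eln|nln] /=; last first.
    have hsf : same = false.
      move: h17 nln; rewrite /same /lcp_at; case: (x) => [//|x'] [_ ->] nln.
      apply/negbTE/negP => /eqP ek; case: nln.
      by have := size_kl n t (q x'); rewrite ek size_kl; lia.
    by apply: wp_skip; apply: fin => //; [lia | rewrite hsf].
  case: x hx ex hf hf' h16 h17 hhi hlo hb2 hl hqn har hqx hqx2 @lcp_at @s3 hT3 @same hsame fin eln => [|x].
    move=> hx ex hf hf' h16 h17 hhi hlo hb2 hl hqn har hqx hqx2 lcp_at s3 hT3 same hsame fin eln.
    exfalso; move: eln; rewrite h17 /lcp_at hlast nxt_last; lia.
  move=> hx ex hf hf' h16 [h17 h15] hhi hlo hb2 hl hqn har hqx hqx2 lcp_at s3 hT3 same hsame fin eln.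
  have hx1 : (q x.+1).+1 < n by apply: hne.
  have hl' : lms n t (q x) by apply: (ls_lms hq); lia.
  have hqx' := nxt_ge n t (q x); have hqx2' := hnlt _ hl'.
  have hx2 : (q x).+1 < n.
    case: (posnP x) => [x0|x0]; last by apply: hne; lia.
    move: eln; rewrite h15 x0 hlast nxt_last /lcp_at; have [] := nxt_spec hV hx1; lia.
  asg => //; rewrite [ev _ s3]/=; set s4 := setr 18 0 s3.
  apply: wp_seq; apply: (@wp_while _ _ (fun b5 s5 => exists k, [/\ rg s5 18 = k,
     k <= lcp_at.+1, b2 - k <= b5 & forall j, j < k -> t (q x.+1 + j) = t (q x + j)])).
    by exists 0; split=> //; lia.
  move=> b5 s5 [k [e18 hk hb5 hkk]] hf5.
  have hg r : r != 18 -> rg s5 r = rg s4 r.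
    by move=> hr; case: hf5 => -> //=; rewrite inE.
  have e6 : rg s5 6 = q x.+1 by rewrite hg.
  have e14 : rg s5 14 = lcp_at by rewrite hg.
  have e17 : rg s5 17 = q x by rewrite hg.
  have hT5 : text_at s5 n t.
    by apply: (Tx_ext hT3); rewrite ?hg //; case: hf5 => _ _ ->.
  split.
    rewrite /= e14 e18 e6 e17; split=> //; case: (ltnP lcp_at k) => hlk //=.
    by do 3 (try split); rewrite ?e18 //; try lia; apply: (txt_safeE hT5); lia.
  rewrite /= e14 e18 e6 e17; case: (ltnP lcp_at k) => hlk /=.
    apply: wp_asg => //=; rewrite e14 e18 hlk; apply: fin => //=; simp_regs; rewrite ?hg //.
    - by lia.
    - rewrite (_ : same = true) //; rewrite /same; apply/eqP/esym.
      apply/(kl_eqP hV hx1 hx2); split; first by rewrite -/lcp_at eln h15.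
      by move=> j hj; apply: hkk; lia.
    - by case: hf5 => _ ->.
  rewrite !(txtE hT5); try lia.
  case: (t (q x.+1 + k) =P t (q x + k)) => [et|net] /=; last first.
    apply: wp_asg => //=; rewrite e14 e18; apply: fin => //=; simp_regs; rewrite ?hg //.
    - by lia.
    - rewrite (_ : lcp_at < k = false); last by lia.
      rewrite (_ : same = false) //; apply/negbTE/eqP => /esym /(kl_eqP hV hx1 hx2)[_ hall].
      by apply: net; apply: hall.
    - by case: hf5 => _ ->.
  split; first by lia.
  apply: wp_asg => /=; rewrite e18; first by split=> //; lia.
  exists k.+1; split=> //; try lia; first by simp_regs; lia.
  by move=> j hj; case: (j =P k) => [->|] //; move=> ?; apply: hkk; lia.
- move=> s2 b2 hb2 hf ex [h16 h17 hlo hhi hz]; split=> //; first by lia.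
  by move=> x hx; rewrite hhi // hx.
Qed.

End Descent2.

Definition descend :=
  Seq place_all (Seq induce (Seq compact (Seq (clear (EV 11))
  (Seq lengths (Seq naming (Seq pack
  (Seq (Asg 3 (EV 4)) (Seq (Asg 2 (EV 11))
       (Asg 4 (EAdd (EV 3) (EV 2))))))))))).

Section Descent3.
Variables (N : nat) (tx : nat -> nat).
Notation ev := (ev tx).
Notation safe := (safe N tx).
Notation wp := (wp N tx).
Notation text_at := (text_at N tx).

Lemma pack_ok s n t b Q q : text_at s n t -> 1 < n -> n <= b ->
  rg s 11 = cnt n (lms n t) -> lsorted n t (cnt n (lms n t)) q ->
  (forall x, x < cnt n (lms n t) -> fa s (cnt n (lms n t) + q x %/ 2) = lms_name n t q x) ->
  (forall y, cnt n (lms n t) <= y < n ->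
        (forall p, lms n t p -> cnt n (lms n t) + p %/ 2 <> y) -> fa s y = 0) ->
  (forall s' b', b - n <= b' -> framed pack s s' ->
     (forall x, x < cnt n (lms n t) -> fb s' (rg s 4 + lms_rank n t (q x)) = lms_name n t q x) ->
     (forall i, i < rg s 4 -> fb s' i = fb s i) -> Q b' s') ->
  wp pack Q b s.
Proof.
move=> hT n1 hb e11 hq ha hz hQ; have hn := Tx_nN hT; have hbb := tx_bb hT.
have hm2 := cnt_lms2 n t; have hareaP := @lms_area n t.
have hrk := @rk_lt n t.
set m := cnt n (lms n t) in e11 hq ha hz hQ hm2 hareaP hrk.
suff H : wp pack (fun b' s' => [/\ b - n <= b',
     (forall x, x < m -> fb s' (rg s 4 + lms_rank n t (q x)) = lms_name n t q x) &
     (forall i, i < rg s 4 -> fb s' i = fb s i)]) b s.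
  by apply: (wp_conseq H) => b' s' hf [h1 h2 h3]; apply: hQ.
asg; first by rewrite /=; lia.
asg => //.
set s1 := setr 5 _ _.
(* Slot [y] stands for the positions [2 * (y - m)] and the one after it, of which at most one is
   LMS; register 18 is the number of LMS positions before them, hence the rank of the next. *)
apply: (@wp_loop _ _ 5 2 _ (fun y s2 => [/\ rg s2 18 = cnt (2 * (y - m)) (lms n t),
   (forall x, x < m -> q x < 2 * (y - m) -> fb s2 (rg s 4 + lms_rank n t (q x)) = lms_name n t q x) &
   (forall i, i < rg s 4 -> fb s2 i = fb s i)]) _ _ _ m n) => //; try lia.
- by rewrite /s1; simp_regs; exact: (tx_n hT).
- by rewrite subnn muln0; split=> //.
- move=> y s2 b2 hy e5 hf [h18 hfb hlo].
  have e4 : rg s2 4 = rg s 4 by case: hf => ->.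
  have ea : fa s2 = fa s by case: hf => _ ->.
  have eh : 2 * (y.+1 - m) = (2 * (y - m)).+2 by lia.
  set h := y - m in h18 hfb eh.
  have eC : cnt (2 * h).+2 (lms n t) = cnt (2 * h) (lms n t) + lms n t (2 * h) + lms n t (2 * h).+1.
    by rewrite !cntS.
  asg; first by rewrite /= e5; split=> //; lia.
  rewrite /= e5 ea; apply: wp_if => //; simp_regs.
  have [[x hx hxh]|hno] : (exists2 x, x < m & q x %/ 2 = h) \/ (forall p, lms n t p -> p %/ 2 <> h).
    case: (boolP (lms n t (2 * h))) => h0.
      by left; have [x hx e] := ls_all hq h0; exists x => //; lia.
    case: (boolP (lms n t (2 * h).+1)) => h1.
      by left; have [x hx e] := ls_all hq h1; exists x => //; lia.
    right=> p hp ep; have : (p == 2 * h) || (p == (2 * h).+1) by lia.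
    by case/orP=> /eqP e; rewrite e ?(negbTE h0) ?(negbTE h1) in hp.
  + have hl := ls_lms hq hx; have := ha _ hx; have -> : m + q x %/ 2 = y by lia.
    move=> ->; have hnm := nmx_le q n1 (erefl m) x.
    have -> : (lms_name n t q x == 0) = false by lia.
    have hr := hrk _ hl.
    have eqr : lms_rank n t (q x) = cnt (2 * h) (lms n t).
      case: (q x =P 2 * h) => [-> //|ne].
      have e1 : q x = (2 * h).+1 by lia.
      rewrite e1 /lms_rank cntS; have -> : lms n t (2 * h) = false; last by rewrite addn0.
      by apply/negP => h0; have := lms_half h0 hl; rewrite e1; lia.
    have eC1 : cnt (2 * h).+2 (lms n t) = (cnt (2 * h) (lms n t)).+1.
      rewrite eC; have : (q x == 2 * h) || (q x == (2 * h).+1) by lia.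
      case/orP=> /eqP e; rewrite e in hl; rewrite hl.
        rewrite (_ : lms n t (2 * h).+1 = false) ?addn0 ?addn1 //.
        by apply/negP => h1; have := lms_half hl h1; lia.
      rewrite (_ : lms n t (2 * h) = false) ?addn0 ?addn1 //.
      by apply/negP => h1; have := lms_half hl h1; lia.
    sto => //; simp_regs; rewrite e4 h18 -eqr; try lia.
      by split=> //; lia.
    apply: wp_asg; first by simp_regs; rewrite h18 -eqr; split=> //; lia.
    split=> //; split; simp_regs.
    - by rewrite h18 eh eC1 addn1.
    - move=> z hz1; rewrite eh => hz2; rewrite /upd.
      case: (z =P x) => [->|ne]; first by rewrite eqxx.
      have hlz := ls_lms hq hz1.
      case: eqP => [e|_].
        have e1 : lms_rank n t (q z) = lms_rank n t (q x) by lia.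
        by case: ne; apply: (ls_inj hq) => //; rewrite -(lpos_rk hlz) e1 (lpos_rk hl).
      apply: hfb => //; case: (ltnP (q z) (2 * h)) => // hge.
      by case: ne; apply: (ls_inj hq) => //; apply: (lms_half hlz hl); lia.
    - by move=> i hi; rewrite /upd; case: eqP => [|_]; [lia | exact: hlo].
  + rewrite hz ?eqxx //; last by move=> p hp; have := hno p hp; lia.
    apply: wp_skip; split=> //; split; simp_regs => //.
    - rewrite eh eC h18; rewrite (_ : lms n t (2 * h) = false).
        rewrite (_ : lms n t (2 * h).+1 = false) ?addn0 //.
        by apply/negP => h1; apply: (hno _ h1); lia.
      by apply/negP => h1; apply: (hno _ h1); lia.
    - move=> z hz1; rewrite eh => hz2; apply: hfb => //.
      by have := hno _ (ls_lms hq hz1); lia.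
- move=> s2 b2 hb2 hf e5 [h18 hfb hlo]; split=> //; first by lia.
  move=> x hx; apply: hfb => //.
  by have := hareaP _ (ls_lms hq hx); lia.
Qed.

(** The seven blocks cost 5, 8, 1, 1, 1, 4 and 1 times [n], rounded up to 22. The new text starts at
    the old bucket base and the new pointers follow it; both fit into the old bucket area since
    [m * 2 <= n]. *)
Lemma descend_ok s n t b Q : text_at s n t -> 1 < n -> 22 * n <= b ->
  (forall s' b' m t1, b - 22 * n <= b' -> framed descend s s' -> text_at s' m t1 ->
     reduces n t m t1 ->
     rg s' 3 = rg s 4 -> rg s' 4 = rg s 4 + m ->
     (forall i, i < m -> fb s' (rg s 4 + i) = t1 i) ->
     (forall i, i < rg s 4 -> fb s' i = fb s i) -> Q b' s') ->
  wp descend Q b s.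
Proof.
move=> hT n1 hb hQ; have hn := Tx_nN hT; have hV := tx_vt hT; have hbb := tx_bb hT.
have hm2 := cnt_lms2 n t.
suff H : wp descend (fun b' s' => exists m t1, [/\ b - 22 * n <= b', text_at s' m t1,
     reduces n t m t1, rg s' 3 = rg s 4 /\ rg s' 4 = rg s 4 + m &
     (forall i, i < m -> fb s' (rg s 4 + i) = t1 i) /\
     (forall i, i < rg s 4 -> fb s' i = fb s i)]) b s.
  by apply: (wp_conseq H) => b' s' hf [m [t1 [h1 h2 h3 [h4 h5] [h6 h7]]]]; apply: (hQ _ _ m t1).
apply: wp_seq; apply: (place_all_ok hT); first by lia.
move=> s1 b1 A h hb1 hf1 hT1 hP1 hA1 hF1.
have e41 : rg s1 4 = rg s 4 by case: hf1 => ->.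
apply: wp_seq; apply: (induce_ok (stop := lms n t) _ n1 hP1 hT1) => //; first by lia.
move=> s2 b2 h2 hb2 hf2 hT2 hS2 _ hF2 hB2 hst2.
have e42 : rg s2 4 = rg s 4 by case: hf2 => -> //.
apply: wp_seq; apply: (compact_ok hT2 n1 _ hS2 hB2 hst2); first by lia.
move=> s3 b3 q hb3 hf3 hT3 e11 hq hA3.
have e43 : rg s3 4 = rg s 4 by case: hf3 => ->.
have eb3 : fb s3 = fb s2 by case: hf3 => _ _ ->.
apply: wp_seq; apply: (clear_ok (tx_n hT3)) => //=; [by rewrite e11; exact: cnt_le | by lia |].
rewrite e11 => s4 b4 hb4 hf4 hA4.
have e44 : rg s4 4 = rg s 4 by case: hf4 => ->.
have e114 : rg s4 11 = cnt n (lms n t) by case: hf4 => ->.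
have eb4 : fb s4 = fb s2 by case: hf4 => _ _ ->.
have hT4 : text_at s4 n t by apply: (Tx_fr hT3 hf4).
apply: wp_seq; apply: (lengths_ok hT4 n1 _ e114); first by lia.
  by move=> y hy; rewrite hA4 hy.
move=> s5 b5 hb5 hf5 hT5 hA5 har5.
have e45 : rg s5 4 = rg s 4 by case: hf5 => ->.
have e115 : rg s5 11 = cnt n (lms n t) by case: hf5 => ->.
have eb5 : fb s5 = fb s2 by case: hf5 => _ _ ->.
apply: wp_seq; apply: (naming_ok hT5 n1 _ e115 hq) => //; first by lia.
  move=> y hy; rewrite hA5 // hA4 (_ : _ <= y < _ = false) ?hA3 //; lia.
move=> s6 b6 hb6 hf6 hT6 hA6 hz6.
have e46 : rg s6 4 = rg s 4 by case: hf6 => ->.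
have e116 : rg s6 11 = cnt n (lms n t) by case: hf6 => ->.
have eb6 : fb s6 = fb s2 by case: hf6 => _ _ ->.
apply: wp_seq; apply: (pack_ok hT6 n1 _ e116 hq hA6 hz6); first by lia.
rewrite e46 => s7 b7 hb7 hf7 hB7 hlo7.
have e47 : rg s7 4 = rg s 4 by case: hf7 => ->.
have e117 : rg s7 11 = cnt n (lms n t) by case: hf7 => ->.
have e07 : rg s7 0 = N by case: hf7 => -> // _ _; exact: (tx_N hT6).
asg => //; asg => //.
apply: wp_asg; first by simp_regs; rewrite e47 e117; split=> //; lia.
set m := cnt n (lms n t) in e117 *.
pose t1 i := fb s7 (rg s 4 + i).
have [hV1 hR1] := names_ok hV hq n1 (erefl m) (t1 := t1) hB7.
have m0 := vt_pos hV1.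
exists m, t1; split=> //; simp_regs; rewrite ?e47 ?e117 //; first by lia.
- split; simp_regs; rewrite ?e47 ?e117 //; first by lia.
  have -> : rg s 4 + m == 0 = false by lia.
  by [].
- by split=> // i hi; rewrite hlo7 // eb6 hF2 ?e41 ?hF1 //; left.
Qed.

End Descent3.

(** * Ascent: from the suffix array of the reduced text *)

(* The previous text is delimited by scanning backwards: every reduced text ends
   with its only character 1. *)
Definition pop :=
  Seq (Asg 11 (EV 2)) (Seq (Asg 4 (EV 3))
  (If (EV 4)
    (Seq (Asg 5 (ESub (EV 4) (EC 1)))
    (Seq (While (EIf (EV 5) (EIf (EEq (ELd ALCP (ESub (EV 5) (EC 1))) (EC 1))
                                 (EC 0) (EC 1)) (EC 0))
           (Asg 5 (ESub (EV 5) (EC 1))))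
    (Seq (Asg 3 (EV 5)) (Asg 2 (ESub (EV 4) (EV 5))))))
    (Asg 2 (EV 0)))).

(** Tabulates [lms_nth], 1-based, in the bucket area; as the scan runs from right to left, the
    counter runs down from the number of LMS positions. *)
Definition positions :=
  Seq (Asg 13 (EV 11))
  (each_lms (Seq (Asg 13 (ESub (EV 13) (EC 1)))
                 (Sto ALCP (Ebucket0 (EV 13)) (EAdd (EAdd (EV 9) (EC 1)) (EC 1))))).

Definition unrank := For 5 11 (Sto ASA (EV 5) (ELd ALCP (Ebucket (ELd ASA (EV 5))))).

(** Works in place from the largest suffix down: the end of the bucket still free is never to the
    left of the slot being read, and that slot is cleared before it may be reused. *)
Definition spread :=
  Seq (clear (EV 11)) (Seq (buckets true) (Seq (Asg 5 (EV 11))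
  (While (EV 5)
    (Seq (Asg 5 (ESub (EV 5) (EC 1)))
    (Seq (Asg 13 (ESub (ELd ASA (EV 5)) (EC 1)))
    (Seq (Sto ASA (EV 5) (EC 0)) place)))))).

Definition ascend :=
  Seq pop (Seq positions (Seq unrank (Seq spread induce))).

Definition suffix_sort :=
  Seq (Asg 2 (EV 0)) (Seq (Asg 3 (EC 0)) (Seq (Asg 4 (EC 0))
  (Seq (While (ELt (EC 1) (EV 2)) descend)
  (Seq (Sto ASA (EC 0) (EC 1))
       (While (EV 4) ascend))))).

Section Ascent.
Variables (N : nat) (tx : nat -> nat).
Notation ev := (ev tx).
Notation safe := (safe N tx).
Notation wp := (wp N tx).
Notation text_at := (text_at N tx).

(* The stack of reduced texts, deepest first; the input itself is implicit. *)
Definition level := (nat * (nat -> nat))%type.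
Definition cur (ls : seq level) : level := head (N, tx) ls.
Definition stack_size (ls : seq level) : nat := sumn [seq l.1 | l <- ls].

Fixpoint stack_good (ls : seq level) : Prop :=
  if ls is l :: r then
    [/\ vtext l.1 l.2, reduces (cur r).1 (cur r).2 l.1 l.2 & stack_good r]
  else vtext N tx.

Fixpoint stack_mem (f : nat -> nat) (ls : seq level) : Prop :=
  if ls is l :: r then (forall i, i < l.1 -> f (stack_size r + i) = l.2 i) /\ stack_mem f r
  else True.

Record stack (s : st) (ls : seq level) : Prop := Stack {
  sk_good : stack_good ls;
  sk_mem : stack_mem (fb s) ls;
  sk_N : rg s 0 = N;
  sk_n : rg s 2 = (cur ls).1;
  sk_bb : rg s 4 = stack_size ls;
  sk_tb : if ls is _ :: r then rg s 3 = stack_size r else True }.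

Lemma good_vt ls : stack_good ls -> vtext (cur ls).1 (cur ls).2.
Proof. by case: ls => //= l r []. Qed.

Lemma red_le n t m t1 : reduces n t m t1 -> m * 2 <= n.
Proof. by case=> _ -> _ _; exact: cnt_lms2. Qed.

Lemma good_le ls : stack_good ls -> stack_size ls + (cur ls).1 <= N.
Proof.
elim: ls => //= l r IH [_ /red_le hr /IH]; rewrite /stack_size /=; lia.
Qed.

Lemma memok_eq f g ls : (forall i, i < stack_size ls -> f i = g i) -> stack_mem f ls -> stack_mem g ls.
Proof.
elim: ls => //= l r IH h [h1 h2]; split.
  by move=> i hi; rewrite -h ?h1 // /stack_size /=; rewrite -/(stack_size r); lia.
by apply: IH => // i hi; apply: h; rewrite /stack_size /= -/(stack_size r); lia.
Qed.

Lemma stack_Tx s ls : stack s ls -> text_at s (cur ls).1 (cur ls).2.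
Proof.
move=> [hg hm h0 h2 h4 h3]; split=> //.
- by rewrite h4; exact: good_le.
- rewrite h4; case: ls hg hm h2 h4 h3 => [|l r] //= [hV _ _] [hm _] _ _ h3.
  have := vt_pos hV; rewrite /stack_size /= -/(stack_size r) => hp.
  have -> : (l.1 + stack_size r == 0) = false by lia.
  by rewrite h3; split=> //; lia.
- exact: good_vt.
Qed.

Lemma pop_ok s l r b Q : stack s (l :: r) -> (cur r).1 <= b ->
  (forall s' b', b - (cur r).1 <= b' -> framed pop s s' -> stack s' r -> rg s' 11 = l.1 -> Q b' s') ->
  wp pop Q b s.
Proof.
move=> hs hb hQ; have [hg hm h0 h2 h4 h3] := hs; have hle := good_le hg.
have [hV hR hg'] := hg; have hle' := good_le hg'.
suff H : wp pop (fun b' s' => [/\ b - (cur r).1 <= b', stack s' r & rg s' 11 = l.1]) b s.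
  by apply: (wp_conseq H) => b' s' hf [a1 a2 a3]; apply: hQ.
have hm' : stack_mem (fb s) r by case: hm.
asg => //; asg => //.
apply: wp_if => //; simp_regs; rewrite h3.
case: r => [|l' r'] in hs hb hg' hR hQ hm hm' hg hle hle' h4 h3 h2 *.
  by rewrite /stack_size /=; apply: wp_asg => //; split=> //; simp_regs; lia.
have hV' := @good_vt (l' :: r') hg'; rewrite /= in hV'.
have hp := vt_pos hV'.
have eb : stack_size (l' :: r') = stack_size r' + l'.1 by rewrite /stack_size /= addnC.
have -> : (stack_size (l' :: r') == 0) = false by lia.
set n := l'.1 in eb hp; set t := l'.2 in hV'.
have hmt i : i < n -> fb s (stack_size r' + i) = t i by case: hm' => h _; exact: h.
rewrite eb in hle *.
asg; first by simp_regs; do 3 (try split) => //; rewrite /= in hle hle'; lia.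
simp_regs.
apply: wp_seq; apply: (@wp_while _ _ (fun b1 s1 => exists k, [/\ rg s1 5 = stack_size r' + k, k < n,
    b - (n.-1 - k) <= b1 & True])).
  by exists n.-1; split=> //=; simp_regs; lia.
move=> b1 s1 [k [e5 hk hb1 _]] hf.
have e4 : rg s1 4 = stack_size r' + n by case: hf => ->.
have efb : fb s1 = fb s by case: hf => _ _ ->.
rewrite /= in hle hle' hb; rewrite -/n in hb hle'.
split.
  rewrite /= e5; split=> //; case: ifP => // h; split; last by case: ifP => _; lia.
  by side.
rewrite /= e5 efb; set c0 := (_ == 0).
(* The scan starts at the last character and inspects the cell before the current one, so it never
   meets the final 1 of this text. It stops at the start of the text, because the cell before is the
   final 1 of the next text on the stack, or because the address is 0. *)
have hc0 : c0 = (k == 0).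
  rewrite /c0; case: (posnP k) => [k0|k0].
    rewrite k0 addn0; case: (posnP (stack_size r')) => [_ //|hb0].
    suff -> : fb s (stack_size r' - 1) = 1 by [].
    case: (r') hg' hm' hb0 => [|l2 r2] //= [_ _ [hV2 _ _]] [_ [hm2 _]] _.
    have h2p := vt_pos hV2; rewrite /stack_size /= -/(stack_size r2).
    have := hm2 l2.1.-1 (ltac:(lia)).
    rewrite (_ : stack_size r2 + l2.1.-1 = l2.1 + stack_size r2 - 1); last by lia.
    by move=> ->; apply/eqP; rewrite (vt_last hV2) //; lia.
  have -> : (stack_size r' + k == 0) = false by lia.
  have -> : stack_size r' + k - 1 = stack_size r' + k.-1 by lia.
  rewrite hmt; last by lia.
  have := vt_last hV' (i := k.-1); have -> : (k.-1 == n.-1) = false by lia.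
  move=> -> /=; last by lia.
  by lia.
rewrite hc0; case: (posnP k) => [k0|k0]; last first.
  split; first by lia.
  apply: wp_asg; first by rewrite /= e5; side.
  by exists k.-1; split=> //=; simp_regs; lia.
rewrite k0 addn0 in e5.
asg => //; apply: wp_asg; first by simp_regs; rewrite e4 e5; do 2 (try split); lia.
have e0 : rg s1 0 = N by case: hf => ->.
have e11 : rg s1 11 = l.1 by case: hf => ->.
split=> //; first by rewrite /= -/n; lia.
split=> //; simp_regs; rewrite ?efb ?e4 ?e5 //; rewrite -/n; lia.
Qed.

Lemma positions_ok s n t b Q : text_at s n t -> 1 < n -> n <= b -> rg s 11 = cnt n (lms n t) ->
  (forall s' b', b - n <= b' -> framed positions s s' -> text_at s' n t ->
     (forall p, lms n t p -> fb s' (rg s 4 + lms_rank n t p) = p.+1) ->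
     (forall i, i < rg s 4 -> fb s' i = fb s i) -> Q b' s') ->
  wp positions Q b s.
Proof.
move=> hT n1 hb e11 hQ; have hn := Tx_nN hT; have hV := tx_vt hT; have hbb := tx_bb hT.
have hm2 := cnt_lms2 n t; have hrk := @rk_lt n t.
suff H : wp positions (fun b' s' => [/\ b - n <= b',
     (forall p, lms n t p -> fb s' (rg s 4 + lms_rank n t p) = p.+1) &
     (forall i, i < rg s 4 -> fb s' i = fb s i)]) b s.
  apply: (wp_conseq H) => b' s' hf [h1 h2 h3]; apply: hQ => //.
  exact: (Tx_fr hT hf).
asg => //; set s1 := setr 13 _ s.
have hT1 : text_at s1 n t by apply: (Tx_ext hT).
pose J i s2 := [/\ rg s2 13 = lms_rank n t i.+1, rg s2 4 = rg s 4,
   (forall p, lms n t p -> i < p -> fb s2 (rg s 4 + lms_rank n t p) = p.+1) &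
   (forall i, i < rg s 4 -> fb s2 i = fb s i)].
apply: (each_lms_ok (J := J) hT1) => //.
- by move=> i s2 s3 hr ha hfb [h1 h2 h3 h4]; split; rewrite ?hfb ?hr.
- by move=> i s2 [_ _ _].
- move=> i s2 hi hl [h1 h2 h3 h4]; split=> //.
    by rewrite h1 /lms_rank cntS (negbTE hl) addn0.
  move=> p hp hip; apply: h3 => //.
  by case: (p =P i.+1) => [e|]; [rewrite -e hp in hl | lia].
- split=> //; first by rewrite /s1 /=; simp_regs; rewrite e11 /lms_rank prednK //; lia.
  by move=> p /lms_lt hp hip; lia.
- move=> i s2 b2 hi hl e9 hf2 hT2 [h1 h2 h3 h4].
  have hr := hrk _ hl.
  have eS : lms_rank n t i.+2 = (lms_rank n t i.+1).+1 by rewrite /lms_rank cntS hl addn1.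
  asg; first by rewrite /= h1 eS; side.
  apply: wp_sto; simp_regs; rewrite ?h1 ?h2 ?eS ?e9 ?subn1 ?addn1 /=; try lia.
    by side.
    by side.
  split=> //; split=> //; simp_regs.
  + move=> p hp hip; rewrite /upd; case: eqP => [e|ne].
      have e1 : lms_rank n t p = lms_rank n t i.+1 by lia.
      by rewrite -(lpos_rk hp) e1 (lpos_rk hl).
    by apply: h3 => //; case: (p =P i.+1) => [e|]; [rewrite e in ne | lia].
  + by move=> j hj; rewrite /upd; case: eqP => [|_]; [lia | exact: h4].
- move=> s2 b2 hb2 hf2 hT2 [h1 h2 h3 h4]; split=> // p hp; apply: h3 => //.
  by case/andP: hp.
Qed.

Lemma unrank_ok s n t m b Q : text_at s n t -> m = cnt n (lms n t) -> m <= b -> rg s 11 = m ->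
  (forall x, x < m -> 1 <= fa s x <= m) ->
  (forall p, lms n t p -> fb s (rg s 4 + lms_rank n t p) = p.+1) ->
  (forall s' b', b - m <= b' -> framed unrank s s' -> text_at s' n t ->
     (forall x, x < m -> fa s' x = (lms_nth n t (fa s x).-1).+1) -> Q b' s') ->
  wp unrank Q b s.
Proof.
move=> hT hm hb e11 hr hF hQ; have hn := Tx_nN hT; have hbb := tx_bb hT.
have hm2 := cnt_lms2 n t.
apply: (@wp_for _ _ 5 11 _ (fun x s' => [/\ rg s' 4 = rg s 4,
   (forall y, y < x -> fa s' y = (lms_nth n t (fa s y).-1).+1) &
   (forall y, x <= y -> fa s' y = fa s y)]) _ _ _ m) => //; try lia.
- move=> x s1 b1 hx e5 hf [h1 h2 h3]; have := hr _ hx => hrx.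
  have hl : lms n t (lms_nth n t (fa s x).-1) by apply: lpos_lms; lia.
  have er : lms_rank n t (lms_nth n t (fa s x).-1) = (fa s x).-1 by apply: rk_lpos; lia.
  have efb : fb s1 = fb s by case: hf => _ _ ->.
  apply: wp_sto => /=; rewrite ?e5 ?h3 //; try lia.
    by rewrite h1; side.
  split=> //; split=> //=.
    move=> y hy; rewrite /upd; case: eqP => [->|ne]; last by apply: h2; lia.
    by rewrite efb h1 -(hF _ hl) er subn1.
  by move=> y hy; rewrite /upd; case: eqP => [|_]; [lia | apply: h3; lia].
- move=> s1 b1 hb1 hf _ [h1 h2 h3]; apply: hQ => //.
  exact: (Tx_fr hT hf).
Qed.

Lemma cnt_mem n (l : seq nat) : uniq l -> all (fun i => i < n) l ->
  cnt n (fun i => i \in l) = size l.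
Proof.
move=> hu ha; rewrite /cnt -size_filter; apply/perm_size/uniq_perm => //.
  exact: filter_uniq (iota_uniq _ _).
move=> i; rewrite mem_filter mem_iota; case h: (i \in l) => //=.
by rewrite (allP ha _ h).
Qed.

Lemma spread_ok s n t m q b Q : text_at s n t -> m = cnt n (lms n t) -> 5 * n <= b -> rg s 11 = m ->
  (forall x, x < m -> fa s x = (q x).+1) ->
  (forall x, x < m -> lms n t (q x)) ->
  (forall p, lms n t p -> exists2 x, x < m & q x = p) ->
  (forall x y, x < m -> y < m -> q x = q y -> x = y) ->
  (forall x y, x < y < m -> le2 n t pred0 (q x) (q y)) ->
  (forall s' b' A h, b - 5 * n <= b' -> framed spread s s' -> text_at s' n t ->
     place_inv n (cmpl n t) (fun i j => le1 n t pred0 j i) (lms n t) A h ->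
     (forall y, y < n -> fa s' y = A (n.-1 - y)) ->
     (forall i, i < rg s 4 -> fb s' i = fb s i) -> Q b' s') ->
  wp spread Q b s.
Proof.
move=> hT hm hb e11 hA hql hqa hqi hqs hQ; have hn := Tx_nN hT; have hV := tx_vt hT.
have hm2 := cnt_lms2 n t; have hbb := tx_bb hT; rewrite -hm in hm2.
suff H : wp spread (fun b' s' => exists A h, [/\ b - 5 * n <= b',
     place_inv n (cmpl n t) (fun i j => le1 n t pred0 j i) (lms n t) A h,
     (forall y, y < n -> fa s' y = A (n.-1 - y)) &
     (forall i, i < rg s 4 -> fb s' i = fb s i)]) b s.
  apply: (wp_conseq H) => b' s' hf [A [h [h1 h2 h3 h4]]]; apply: (hQ _ _ A h) => //.
  exact: (Tx_fr hT hf).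
apply: wp_seq; apply: (clear_ok (tx_n hT)) => //=; [by rewrite e11; lia | by lia |].
rewrite e11 => s1 b1 hb1 hf1 hA1.
have eb1 : fb s1 = fb s by case: hf1 => _ _ ->.
have e41 : rg s1 4 = rg s 4 by case: hf1 => ->.
have hT1 : text_at s1 n t by apply: (Tx_fr hT hf1).
apply: wp_seq; apply: (buckets_ok (rev := true) hT1); first by lia.
move=> s2 b2 hb2 hf2 hT2 hF2 hB2.
have ea2 : fa s2 = fa s1 by case: hf2 => _ ->.
have e42 : rg s2 4 = rg s 4 by case: hf2 => ->.
have e112 : rg s2 11 = m by case: hf2 => -> // _ _; case: hf1 => -> //.
asg => //; rewrite [ev _ _]/= e112; set s3 := setr 5 m s2.
pose D x p := p \in [seq q y | y <- iota x (m - x)].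
have DE x p : reflect (exists2 y, x <= y < m & q y = p) (D x p).
  apply: (iffP mapP) => [[y]|[y hy <-]]; last by exists y; rewrite // mem_iota; lia.
  by rewrite mem_iota => hy ->; exists y => //; lia.
pose J x s4 := exists A h, [/\ place_inv n (cmpl n t) (fun i j => le1 n t pred0 j i) (D x) A h,
   buckets_hold s4 n h, (forall y, y < x -> fa s4 y = (q y).+1),
   (forall y, x <= y < n -> fa s4 y = A (n.-1 - y)) &
   (forall y, y < x -> A (n.-1 - y) = 0) /\
   (forall i, i < rg s 4 -> fb s4 i = fb s i)].
apply: (@wp_while _ _ (fun b4 s4 => exists x, [/\ rg s4 5 = x, x <= m, b2 - (m - x) <= b4 & J x s4])).
  exists m; split=> //; first by lia.
  exists (fun=> 0), (bkt_start n (cmpl n t)); split=> //.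
  - apply: (@plinv_eq _ _ _ pred0 _ (fun=> 0) _ (bkt_start n (cmpl n t))) => //; last by apply: plinv0.
    by move=> p hp; apply/esym/negbTE/DE => -[y]; lia.
  - by move=> y hy; rewrite /s3 /= ea2 hA1 (_ : _ <= y < _ = false) ?hA //; lia.
  - by move=> y hy; rewrite /s3 /= ea2 hA1 hy.
  - by split=> // i hi; rewrite hF2 ?e41 ?eb1 //; left.
move=> b4 s4 [x [e5 hx hb4 [A [h [hP hB h1 h2 [h3 h4]]]]]] hf4; split=> //=.
rewrite e5; case: (posnP x) => [x0|x0].
  exists A, h; split=> //; first by lia.
    apply: plinv_eq hP => // p hp; rewrite x0; apply/DE/idP => [[y hy <-]|hl].
      by apply: hql; lia.
    by have [y hy e] := hqa _ hl; exists y.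
  by move=> y hy; apply: h2; rewrite x0.
split; first by lia.
have e44 : rg s4 4 = rg s 4 by case: hf4 => ->.
have hT4 : text_at s4 n t.
  apply: (Tx_ext hT2); try by [case: hf4 => ->]; rewrite e42 => i hi.
  by rewrite h4 // hF2 ?e41 ?eb1 //; left.
case: x => // x in e5 hx hb4 hP h1 h2 h3 x0 *.
have hxm : x < m by lia.
set p := q x; have hl : lms n t p := hql _ hxm; have hp := lms_lt hl.
have hnD : ~~ D x.+1 p by apply/DE => -[y hy /hqi]; lia.
have hlt := plinv_lt hP hp hnD; have hble := bs_le n (cmpl n t) (cmpl n t p).+1.
have hst := plinv_step hP hp hnD.
have htq y : y <= x -> t (q y) <= t p.
  move=> hy; case: (y =P x) => [-> //|ne]; rewrite leqNgt; apply/negP => hgt.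
  have : le2 n t pred0 (q y) p by apply: hqs; lia.
  rewrite /le2; have [u ->] := key_cons n t pred0 (q y); have [v ->] := key_cons n t pred0 p.
  by rewrite /lex_le /ecode /=; lia.
(* In mirrored indices, the destination leaves room for the [x.+1] unread slots. Positions in
   earlier mirrored buckets, those already placed in this one, and the unread ones are disjoint,
   because unread positions have characters at most [t p]. *)
have hdst : h (cmpl n t p) + x.+1 <= n.
  rewrite (pv_ptr hP); set c := cmpl n t p.
  have hu : cnt n (fun i => i \in [seq q y | y <- iota 0 x.+1]) = x.+1.
    rewrite cnt_mem ?size_map ?size_iota //.
      rewrite map_inj_in_uniq ?iota_uniq // => y z; rewrite !mem_iota => hy hz.
      by apply: hqi; lia.
    apply/allP => i /mapP[y]; rewrite mem_iota => hy ->; apply: (@lms_lt n t); apply: hql; lia.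
  have hdis1 : cnt n (fun i => (cmpl n t i < c) || ((cmpl n t i == c) && D x.+1 i)) =
      bkt_start n (cmpl n t) c + cnt n (fun i => (cmpl n t i == c) && D x.+1 i).
    by rewrite cnt_add // => i _; case: (ltngtP (cmpl n t i) c).
  have := cnt_le n (fun i => ((cmpl n t i < c) || ((cmpl n t i == c) && D x.+1 i)) ||
     (i \in [seq q y | y <- iota 0 x.+1])).
  rewrite cnt_add; first by rewrite hu hdis1.
  move=> i hi; apply/negP => /andP[ha /mapP[y]]; rewrite mem_iota => hy ey.
  have hty := htq y (ltac:(lia)).
  case/orP: ha => [|/andP[_ /DE[z hz ez]]].
    have := Tx_rng hT hi; have := Tx_rng hT hp; rewrite -ey in hty.
    by rewrite /c /cmpl; lia.
  have : z = y by apply: hqi; [lia | lia | rewrite ez ey].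
  by lia.
asg; first by rewrite /= e5; side.
rewrite /= e5 subn1 /=.
asg; first by simp_regs; rewrite h1 //; side.
simp_regs; rewrite h1 // subn1 /= -/p.
sto => //; simp_regs; first by lia.
set s5 := St _ _ _.
have hT5 : text_at s5 n t by apply: (Tx_ext hT4).
have hB5 : buckets_hold s5 n h by [].
apply: (place_ok (p := p) (h := h) hT5) => //; first by lia.
move=> s6 hf6 hT6 ha6 hB6 hF6; exists x; split=> //.
- by case: hf6 => ->.
- by lia.
- by lia.
exists (upd A (h (cmpl n t p)) p.+1), (upd h (cmpl n t p) (h (cmpl n t p)).+1); split=> //.
- apply: plinv_eq (hst _) => //.
    move=> p' hp'; apply/orP/DE => [[/DE[y hy <-]|/eqP ->]|[y hy <-]].
    + by exists y => //; lia.
    + by exists x => //; lia.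
    + case: (y =P x) => [->|ne]; first by right.
      by left; apply/DE; exists y => //; lia.
  move=> p' hp' /DE[y hy <-] _; rewrite /le1 /key1 /=.
  by apply: hqs; lia.
- move=> y hy; rewrite ha6 /s5 /= /upd; case: eqP => [|_]; first by lia.
  by case: eqP => [|_]; [lia | apply: h1; lia].
- move=> y hy; rewrite ha6 /s5 /= /upd; case: eqP => [->|ne].
    by rewrite subKn ?eqxx //; lia.
  case: (y =P x) => [eyx|nx].
    by case: eqP => [|_]; [lia | rewrite eyx h3].
  case: eqP => [|_]; first by lia.
  by apply: h2; lia.
- split; last by move=> i hi; rewrite hF6 ?h4 //; left; rewrite /s5 /= e44.
  move=> y hy; rewrite /upd; case: eqP => [|_]; first by lia.
  by apply: h3; lia.
Qed.

End Ascent.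

(** * The complete suffix sorter *)

Section Sort.
Variables (N : nat) (tx : nat -> nat).
Notation ev := (ev tx).
Notation safe := (safe N tx).
Notation wp := (wp N tx).
Notation text_at := (text_at N tx).
Notation cur := (cur N tx).
Notation stack := (stack N tx).

Lemma stack_fr c s s' ls : stack s ls -> framed c s s' ->
  all (fun r => r \notin mods c) [:: 0; 2; 3; 4] ->
  (forall i, i < rg s 4 -> fb s' i = fb s i) -> stack s' ls.
Proof.
move=> [h1 h2 h3 h4 h5 h6] [f1 _ _] /= /and5P[m0 m2 m3 m4 _] hf; split; rewrite ?f1 //.
by apply: memok_eq h2 => i; rewrite -h5 => /hf.
Qed.

(** [pop], [positions] and [unrank] cost at most [n] each, [spread] 5 and [induce] 8 times [n],
    rounded up to 17. With [stop = pred0] the seeds are ordered as whole suffixes, and so is the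
    result. *)
Lemma ascend_ok s l r b Q : stack s (l :: r) -> 17 * (cur r).1 <= b ->
  sa_ok l.1 (suffix_le l.1 l.2) (fa s) ->
  (forall s' b', b - 17 * (cur r).1 <= b' -> framed ascend s s' -> stack s' r ->
     sa_ok (cur r).1 (suffix_le (cur r).1 (cur r).2) (fa s') -> Q b' s') ->
  wp ascend Q b s.
Proof.
move=> hs hb hS hQ; have [[hV1 hR hg] _ _ _ _ _] := hs.
set n := (cur r).1 in hb hR hQ *; set t := (cur r).2 in hR hQ *.
have [n1 hm _ _] := hR; set m := l.1 in hV1 hR hm hS; have hV : vtext n t := good_vt hg.
suff H : wp ascend (fun b' s' => [/\ b - 17 * n <= b', stack s' r &
     sa_ok n (suffix_le n t) (fa s')]) b s.
  by apply: (wp_conseq H) => b' s' hf [h1 h2 h3]; apply: hQ.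
have hmn : m <= n by rewrite hm; exact: cnt_le.
apply: wp_seq; apply: (pop_ok hs); first by rewrite -/n; lia.
rewrite -/n => s1 b1 hb1 hf1 hs1 e11; have hT1 := stack_Tx hs1; rewrite -/n -/t in hT1.
have ea1 : fa s1 = fa s by case: hf1 => _ ->.
apply: wp_seq; apply: (positions_ok hT1 n1); [by lia | by rewrite e11 -hm |].
move=> s2 b2 hb2 hf2 hT2 hP2 hlo2.
have e112 : rg s2 11 = m by case: hf2 => ->.
have e42 : rg s2 4 = rg s1 4 by case: hf2 => ->.
have ea2 : fa s2 = fa s by case: hf2 => _ ->.
have hs2 : stack s2 r by exact: (stack_fr hs1 hf2).
have hval x : x < m -> 1 <= fa s2 x <= m by move=> hx; rewrite ea2; exact: sa_val hS hx.
apply: wp_seq; apply: (unrank_ok hT2 hm _ e112 hval); [by lia | by rewrite e42 |].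
move=> s3 b3 hb3 hf3 hT3 hA3; rewrite ea2 in hA3.
have e113 : rg s3 11 = m by case: hf3 => ->.
have eb3 : fb s3 = fb s2 by case: hf3 => _ _ ->.
have hs3 : stack s3 r by apply: (stack_fr hs2 hf3) => // i; rewrite eb3.
pose q x := lms_nth n t (fa s x).-1.
have hv x : x < m -> (fa s x).-1 < m by move=> hx; have := sa_val hS hx; lia.
have hql x : x < m -> lms n t (q x) by move=> hx; apply: lpos_lms; rewrite -hm; exact: hv.
have hrk x : x < m -> lms_rank n t (q x) = (fa s x).-1 by move=> hx; rewrite rk_lpos // -hm; exact: hv.
apply: wp_seq; apply: (spread_ok (q := q) hT3 hm _ e113 hA3 hql); first by lia.
- move=> p hp; have hr : lms_rank n t p < m by rewrite hm; exact: rk_lt.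
  have [x hx e] := sa_all hS hr; exists x => //.
  by rewrite /q e /= lpos_rk.
- move=> x y hx hy e; apply: (sa_inj hS hx hy).
  have := hrk _ hx; rewrite e (hrk _ hy); have := sa_val hS hx; have := sa_val hS hy; lia.
- move=> x y hxy; apply: (reduces_le hV hV1 hR); try (apply: hv; lia).
  exact: hS.2.
move=> s4 b4 A h hb4 hf4 hT4 hP4 hA4 hlo4.
have hs4 : stack s4 r by exact: (stack_fr hs3 hf4).
apply: (induce_ok (stop := pred0) _ n1 hP4 hT4) => //; first by lia.
move=> s5 b5 h5 hb5 hf5 hT5 hS5 _ hF5 _ _; split; first by lia.
  by apply: (stack_fr hs4 hf5) => // i hi; apply: hF5; left.
split; first exact: hS5.1.
move=> y z hyz; apply: full_ple => //.
- by have := sa_val hS5 (y := y); lia.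
- by have := sa_val hS5 (y := z); lia.
- exact: hS5.2.
Qed.

Lemma suffix_sort_ok s b Q : vtext N tx -> rg s 0 = N -> 82 * N <= b ->
  (forall s' b', b - 82 * N <= b' -> framed suffix_sort s s' ->
     sa_ok N (suffix_le N tx) (fa s') -> Q b' s') ->
  wp suffix_sort Q b s.
Proof.
move=> hV e0 hb hQ; have hN := vt_pos hV.
suff H : wp suffix_sort (fun b' s' => b - 82 * N <= b' /\ sa_ok N (suffix_le N tx) (fa s')) b s.
  by apply: (wp_conseq H) => b' s' hf [h1 h2]; apply: hQ.
asg => //.
asg => //.
asg => //.
set s1 := setr 4 _ _.
have hs1 : stack s1 [::] by split=> //; rewrite /s1; simp_regs.
(* A descent from length n to m costs 22n and one iteration, at most 23n; as n is at most 2(n - m),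
   46 units per unit of length lost suffice. *)
apply: wp_seq; apply: (@wp_while _ _ (fun b2 s2 => exists ls,
   [/\ stack s2 ls, (cur ls).1 <= N & b - 46 * (N - (cur ls).1) <= b2])).
  by exists [::]; split=> //=; lia.
move=> b2 s2 [ls [hs2 hle hb2]] _; have hT2 := stack_Tx hs2.
have hn := Tx_nN hT2.
split; first by rewrite /=; lia.
rewrite /= (tx_n hT2); case: (ltnP 1 (cur ls).1) => hn1 /=.
  split; first by lia.
  apply: (descend_ok hT2 hn1); first by lia.
  move=> s3 b3 m t1 hb3 hf3 hT3 hR e3 e4 hB hlo.
  have hmn := red_le hR; exists ((m, t1) :: ls); split; rewrite ?[(cur _).1]/=; try lia.
  have [g1 g2 g3 g4 g5 g6] := hs2.
  split=> //=.
  - by split=> //; exact: (tx_vt hT3).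
  - split; first by move=> i hi; rewrite -g5 hB.
    by apply: memok_eq g2 => i; rewrite -g5 => /hlo.
  - exact: (tx_N hT3).
  - exact: (tx_n hT3).
  - by rewrite e4 g5 /stack_size /= addnC.
  - by rewrite e3 g5.
have en : (cur ls).1 = 1 by lia.
(* The deepest text has length 1, and its suffix array is the single entry 1. *)
sto => //=.
set s3 := St _ _ _.
have hs3 : stack s3 ls by case: hs2 => ? ? ? ? ? ?; split.
(* An ascent from m to n costs at most 18n with its iteration, covered by 36 units per unit of
   length regained; 46 and 36 make 82. *)
apply: (@wp_while _ _ (fun b4 s4 => exists ls,
   [/\ stack s4 ls, (cur ls).1 <= N, b - 46 * N - 36 * ((cur ls).1) <= b4 &
      sa_ok (cur ls).1 (suffix_le (cur ls).1 (cur ls).2) (fa s4)])).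
  exists ls; split=> //; first by lia.
  by rewrite en; split; [rewrite /mkseq /= /upd /= | move=> y z; lia].
move=> b4 s4 [ls4 [hs4 hle4 hb4 hS4]] _; split=> //=.
rewrite (sk_bb hs4); case: ls4 => [|l r] in hs4 hle4 hb4 hS4 *.
  by rewrite /stack_size /=; split=> //; rewrite /= in hb4; lia.
have [[hVl hR hgr] _ _ _ _ _] := hs4; have hl0 := vt_pos hVl.
have hml := red_le hR; have hgl := good_le hgr.
have -> : (stack_size (l :: r) == 0) = false by rewrite /stack_size /=; lia.
rewrite /= in hb4 hS4; split; first by lia.
apply: (ascend_ok hs4) => //; first by lia.
move=> s5 b5 hb5 hf5 hs5 hS5; exists r; split=> //; lia.
Qed.

End Sort.

(** * The LCP array *)

(** Shows that among the smaller suffixes the immediate predecessor shares the longest prefix. *)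
Lemma lcp_between a b c : lex_le a b -> lex_le b c -> lcp a c <= lcp b c.
Proof.
elim: a b c => [|x a IH] [|y b] [|z c] //=.
rewrite /lex_le /= !negb_or !negb_and -!leqNgt => /andP[h1 h2] /andP[h3 h4].
case: (x =P z) => // exz; have exy : x = y by lia.
subst y z; move: h2 h4; rewrite eqxx /= => h2 h4.
by rewrite ltnS; exact: IH.
Qed.

Section Lcp.
Variables (N : nat) (tx : nat -> nat).
Hypothesis HV : vtext N tx.
Notation ps := (suffix_from N tx).

Definition lcp_at i j := lcp (ps i) (ps j).

Lemma lnE i j : i < N -> j < N -> lcp_at i j = if tx i == tx j then (lcp_at i.+1 j.+1).+1 else 0.
Proof. by move=> hi hj; rewrite /lcp_at (psufE tx hi) (psufE tx hj). Qed.

Lemma lnC i j : lcp_at i j = lcp_at j i.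
Proof.
rewrite /lcp_at; elim: (ps i) (ps j) => [|a s IH] [|b u] //=.
by rewrite eq_sym IH.
Qed.

(** The unique final character forces a mismatch inside both suffixes, so comparisons need no test
    for the end of the text. *)
Lemma ln_spec i j : i < N -> j < N -> i != j ->
  [/\ i + lcp_at i j < N, j + lcp_at i j < N, tx (i + lcp_at i j) != tx (j + lcp_at i j) &
      forall k, k < lcp_at i j -> tx (i + k) = tx (j + k)].
Proof.
move: {2}(N - i) (leqnn (N - i)) => d; elim: d i j => [|d IH] i j hd hi hj hne; first by lia.
rewrite lnE //; case: eqP => [et|/eqP ne]; last by rewrite !addn0; split.
have [hi2 hj2] := same_next HV hi hj hne et.
have hd2 : N - i.+1 <= d by lia.
have [h1 h2 h3 h4] := IH i.+1 j.+1 hd2 hi2 hj2 hne.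
rewrite -(addSnnS i) -(addSnnS j); split=> // -[|k] hk; first by rewrite !addn0.
by rewrite -(addSnnS i) -(addSnnS j); apply: h4.
Qed.

Variable A : nat -> nat.
Hypothesis HS : sa_ok N (suffix_le N tx) A.
Variable phi_arr : nat -> nat.
Hypothesis ph0 : phi_arr (A 0).-1 = 0.
Hypothesis phS : forall r, r.+1 < N -> phi_arr (A r.+1).-1 = A r.

Definition plcp i := if phi_arr i == 0 then 0 else lcp_at i (phi_arr i).-1.
Definition plcp_end i := i + plcp i.

Lemma rank_ex i : i < N -> exists2 r, r < N & A r = i.+1.
Proof. by move=> hi; exact: (sa_all HS hi). Qed.

Lemma ph_spec i : i < N -> phi_arr i != 0 -> (phi_arr i).-1 < N /\ i != (phi_arr i).-1.
Proof.
move=> hi; have [[|r] hr e] := rank_ex hi.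
  by move: ph0; rewrite e /= => ->.
have := phS hr; rewrite e /= => -> _.
have hr' : r < N by lia.
have h1 := sa_val HS hr'; split; first by lia.
apply/eqP => e2; have : r = r.+1 by apply: (sa_inj HS) => //; lia.
by lia.
Qed.

Lemma bf_lt i : i < N -> i <= plcp_end i < N.
Proof.
move=> hi; rewrite /plcp_end leq_addr /plcp; case: ifP => [_|/negbT h]; first by rewrite addn0.
by have [h1 h2] := ph_spec hi h; have [] := ln_spec hi h1 h2.
Qed.

(** Kasai's observation, [plcp i <= (plcp i.+1).+1]: dropping the common first character of [i] and
    its predecessor [j] leaves a suffix smaller than the one at [i.+1] that agrees with it in
    [(plcp i).-1] characters, and the true predecessor of [i.+1] lies between the two
    ([lcp_between]). *)
Lemma bf_mono i : i.+1 < N -> plcp_end i <= plcp_end i.+1.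
Proof.
move=> hi; rewrite /plcp_end; case e: (plcp i) => [|l]; first by lia.
suff : l <= plcp i.+1 by lia.
move: e; rewrite /plcp; case: ifP => // /negbT h0 e.
have hi' : i < N by lia.
have [hj hne] := ph_spec hi' h0; set j := (phi_arr i).-1 in e hj hne.
move: e; rewrite lnE //; case: eqP => // et [el].
have [_ hj2] := same_next HV hi' hj hne et.
have [r1 hr1 e1] := rank_ex hi; have [r2 hr2 e2] := rank_ex hj2.
(* the predecessor j of i gives the smaller suffix j+1 of i+1 *)
have hlt : r2 < r1.
  have [[|r] hr er] := rank_ex hi'.
    by move: ph0 h0; rewrite er /= => ->.
  have hle : suffix_le N tx j i.
    have := phS hr; rewrite er /= => e3; rewrite /j e3.
    by have := HS.2 r r.+1; rewrite er ltnSn hr /=; apply.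
  have hle2 : suffix_le N tx j.+1 i.+1.
    by move: hle; rewrite /suffix_le (psufE tx hi') (psufE tx hj) et lex_le_cons.
  case: (ltngtP r2 r1) => // [h|h].
    have h3 : suffix_le N tx i.+1 j.+1.
      by have := HS.2 r1 r2; rewrite e1 e2 /= h hr2; apply.
    have := lex_lt_total (negbTE h3) (negbTE hle2) => /(congr1 size).
    by rewrite !size_map !size_iota; lia.
  by have : i = j by [rewrite h e1 in e2; lia]; lia.
case: r1 => // r1 in hr1 e1 hlt.
have := phS hr1; rewrite e1 /= => eph.
have hv : 1 <= A r1 <= N by apply: (sa_val HS); lia.
rewrite eph (_ : (A r1 == 0) = false); last by lia.
rewrite lnC -el [lcp_at i.+1 _]lnC; apply: lcp_between.
  case: (r2 =P r1) => [er|ne]; first by rewrite -er e2; exact: lex_le_refl.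
  by have := HS.2 r2 r1; rewrite e2 /=; apply; lia.
by have := HS.2 r1 r1.+1; rewrite e1 /=; apply; lia.
Qed.

Lemma bf_le i j : i <= j -> j < N -> plcp_end i <= plcp_end j.
Proof.
move=> h; rewrite -(subnKC h); elim: (j - i) => [|d IH]; first by rewrite addn0.
by rewrite addnS => hd; apply: leq_trans (IH _) (bf_mono hd); lia.
Qed.

(** Comparing may resume anywhere inside the common prefix and stops exactly at its end. *)
Lemma bf_next i b : i < N -> phi_arr i != 0 -> i <= b <= plcp_end i ->
  (tx b == tx ((phi_arr i).-1 + (b - i))) = (b < plcp_end i).
Proof.
move=> hi h0 /andP[h1 h2]; have [hj hne] := ph_spec hi h0.
have [a1 a2 a3 a4] := ln_spec hi hj hne.
have eb : plcp_end i = i + lcp_at i (phi_arr i).-1 by rewrite /plcp_end /plcp (negbTE h0).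
case: (ltnP b (plcp_end i)) => h.
  have := a4 (b - i); rewrite subnKC // => ->; first exact: eqxx.
  by lia.
have -> : b - i = lcp_at i (phi_arr i).-1 by lia.
have -> : b = i + lcp_at i (phi_arr i).-1 by lia.
by rewrite (negbTE a3).
Qed.

End Lcp.

(* phi stores at position i (0-based) the 1-based suffix array predecessor of i,
   or 0 if there is none. *)
Definition phi :=
  Seq (Sto ALCP (ESub (ELd ASA (EC 0)) (EC 1)) (EC 0))
  (Seq (Asg 5 (EC 1))
  (Loop 5 2 (Sto ALCP (ESub (ELd ASA (EV 5)) (EC 1)) (ELd ASA (ESub (EV 5) (EC 1)))))).

(* The values [i + plcp i] are nondecreasing in [i] and less than N, so with
   h = ceil (N / 2) in [rg 7] they are stored modulo h, the register 8 holding
   the number of those smaller than h. *)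
Definition plcps :=
  Seq (Asg 7 (ESub (EV 0) (EHalf (EV 0))))
  (Seq (Asg 6 (EC 0)) (Seq (Asg 8 (EC 0))
  (For 5 2
    (Seq (Asg 10 (ELd ALCP (EV 5)))
    (Seq (If (ELt (EV 6) (EV 5)) (Asg 6 (EV 5)) Skip)
    (Seq (If (EV 10)
            (While (EEq (EText (EV 6))
                        (EText (EAdd (ESub (EV 10) (EC 1)) (ESub (EV 6) (EV 5)))))
               (Asg 6 (EAdd (EV 6) (EC 1))))
            Skip)
         (If (ELt (EV 6) (EV 7))
            (Seq (Sto ALCP (EV 5) (EV 6)) (Asg 8 (EAdd (EV 5) (EC 1))))
            (Sto ALCP (EV 5) (ESub (EV 6) (EV 7)))))))))).

(* Adding h marks the entries that have already received their final value. *)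
Definition permute :=
  For 5 2
    (Seq (Asg 6 (ELd ALCP (EV 5)))
    (If (ELt (EV 6) (EV 7))
       (Seq (Asg 9 (EV 5))
       (Seq (Asg 10 (ESub (ELd ASA (EV 9)) (EC 1)))
       (Seq (While (EIf (EEq (EV 10) (EV 5)) (EC 0) (EC 1))
               (Seq (Sto ALCP (EV 9) (EAdd (ELd ALCP (EV 10)) (EV 7)))
               (Seq (Asg 9 (EV 10))
                    (Asg 10 (ESub (ELd ASA (EV 9)) (EC 1))))))
            (Sto ALCP (EV 9) (EAdd (EV 6) (EV 7))))))
       Skip)).

Definition decode :=
  For 5 2
    (Seq (Asg 10 (ESub (ELd ASA (EV 5)) (EC 1)))
    (Seq (Asg 6 (ESub (ELd ALCP (EV 5)) (EV 7)))
    (Seq (If (ELt (EV 10) (EV 8)) Skip (Asg 6 (EAdd (EV 6) (EV 7))))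
         (Sto ALCP (EV 5) (ESub (EV 6) (EV 10)))))).

Definition lcp_prog :=
  Seq (Asg 2 (EV 0)) (Seq (Asg 4 (EC 0)) (Seq phi (Seq plcps (Seq permute decode)))).

(** * Correctness of the LCP programs *)

Section LcpCode.
Variables (N : nat) (tx : nat -> nat).
Notation ev := (ev tx).
Notation safe := (safe N tx).
Notation wp := (wp N tx).
Hypothesis HV : vtext N tx.
Variable A : nat -> nat.
Hypothesis HS : sa_ok N (suffix_le N tx) A.

Let N0 : 0 < N. Proof. exact: vt_pos HV. Qed.

Lemma phi_ok s b Q : rg s 2 = N -> (fa s = A) -> N <= b ->
  (forall s' b' , b - N <= b' -> framed phi s s' -> fb s' (A 0).-1 = 0 ->
    (forall r, r.+1 < N -> fb s' (A r.+1).-1 = A r) -> Q b' s') ->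
  wp phi Q b s.
Proof.
move=> e2 ea hb hQ.
suff H : wp phi (fun b' s' => [/\ b - N <= b', fb s' (A 0).-1 = 0 &
    forall r, r.+1 < N -> fb s' (A r.+1).-1 = A r]) b s.
  by apply: (wp_conseq H) => b' s' hf [h1 h2 h3]; apply: hQ.
have hv r : r < N -> 1 <= A r <= N by exact: sa_val HS.
have hA0 := hv 0 N0.
sto => //=; rewrite ?ea; first by side.
  by lia.
asg => //=; set s1 := setr 5 1 _.
apply: (@wp_loop _ _ 5 2 _ (fun x s2 => [/\ fa s2 = A, fb s2 (A 0).-1 = 0 &
    forall r, r.+1 < x -> fb s2 (A r.+1).-1 = A r]) _ _ _ 1 N) => //; try lia.
- by split=> //=; rewrite /upd subn1 eqxx.
- move=> x s2 b2 hx ex hf [h1 h2 h3]; have hvx := hv x (ltac:(lia)).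
  have hvx1 := hv x.-1 (ltac:(lia)).
  apply: wp_sto; rewrite /= ?ex ?h1.
  + by side.
  + by side.
  + by lia.
  split=> //; split=> //=; rewrite /upd !subn1.
    case: eqP => // e; have : 0 = x by apply: (sa_inj HS) => //; lia.
    by lia.
  move=> r hr; have hvr := hv r.+1 (ltac:(lia)); case: eqP => [e|ne].
    by have <- : r.+1 = x by apply: (sa_inj HS) => //; lia.
  by apply: h3; case: (r.+1 =P x) => [e|]; [rewrite e in ne | lia].
- by move=> s2 b2 hb2 hf ex [h1 h2 h3]; split=> //; lia.
Qed.

Variable phi_arr : nat -> nat.
Hypothesis ph0 : phi_arr (A 0).-1 = 0.
Hypothesis phS : forall r, r.+1 < N -> phi_arr (A r.+1).-1 = A r.

Notation pend := (plcp_end N tx phi_arr).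
Notation half := (N - N %/ 2).
Notation bflt := (bf_lt HV HS ph0 phS).
Notation bfle := (bf_le HV HS ph0 phS).

Definition plcp_code (p i : nat) := if i < p then pend i else pend i - half.

Definition is_threshold (p : nat) := forall i, i < N -> (pend i < half) = (i < p).

(** Since [plcp_end i < N] and [N <= 2 * half], a single subtraction of [half] is enough. *)
Lemma enc_lt p i : is_threshold p -> i < N -> plcp_code p i < half.
Proof. by move=> hp hi; have := bflt hi; have := hp _ hi; rewrite /plcp_code; case: ifP => _; lia. Qed.

Lemma plcps_ok s b Q : rg s 0 = N -> rg s 2 = N -> rg s 4 = 0 ->
  (forall i, i < N -> fb s i = phi_arr i) -> 2 * N <= b ->
  (forall s' b', b - 2 * N <= b' -> framed plcps s s' -> rg s' 7 = half -> is_threshold (rg s' 8) ->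
     (forall i, i < N -> fb s' i = plcp_code (rg s' 8) i) -> Q b' s') ->
  wp plcps Q b s.
Proof.
move=> e0 e2 e4 hfb hb hQ.
suff H : wp plcps (fun b' s' => [/\ b - 2 * N <= b', rg s' 7 = half, is_threshold (rg s' 8) &
     (forall i, i < N -> fb s' i = plcp_code (rg s' 8) i)]) b s.
  by apply: (wp_conseq H) => b' s' hf [h1 h2 h3 h4]; apply: hQ.
asg; first by rewrite /= e0; side.
rewrite /= e0.
asg => //=; asg => //=.
set s1 := setr 8 _ _.
pose prev i := if i is i'.+1 then pend i' else 0.
have hprev i : i < N -> prev i <= pend i.
  by case: i => //= i hi; apply: bfle => //; lia.
(* The comparison pointer only moves forward, from [prev i] to at most [plcp_end i]; its moves
   telescope to at most [N], and the outer iterations add another [N]. *)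
have hsum k : k <= N -> \sum_(i < k) (pend i - prev i).+1 <= k + prev k.
  elim: k => [|k IH] hk; first by rewrite big_ord0.
  have -> : \sum_(i < k.+1) (pend i - prev i).+1 =
      \sum_(i < k) (pend i - prev i).+1 + (pend k - prev k).+1 by rewrite big_ord_recr.
  have -> : prev k.+1 = pend k by [].
  have := IH (ltnW hk); have := hprev _ hk; lia.
have hsumN : \sum_(i < N) (pend i - prev i).+1 <= 2 * N.
  have := hsum N (leqnn N).
  have : prev N <= N by have := bflt (i := N.-1); rewrite /prev; case: (N) N0 => //= n _ h; have := h (leqnn _); lia.
  lia.
pose J i s2 := [/\ rg s2 6 = prev i, rg s2 7 = half,
   (rg s2 8 <= i /\ forall k, k < i -> (pend k < half) = (k < rg s2 8)),
   (forall k, k < i -> fb s2 k = plcp_code (rg s2 8) k) &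
   (forall k, i <= k < N -> fb s2 k = phi_arr k)].
apply: (wp_forw (w := fun i => pend i - prev i) (n := N) (J := J)) => //; try lia.
- move=> i s2 b2 hi ei hf [h6 h7 [h8 h8'] hlo hhi] hb2.
  have hbi := bflt hi; have hpi := hprev _ hi.
  have e42 : rg s2 4 = 0 by case: hf => ->.
  have e22 : rg s2 2 = N by case: hf => ->.
  have e02 : rg s2 0 = N by case: hf => ->.
  asg; first by rewrite /= ei.
  rewrite /= ei hhi; last by lia.
  set s3 := setr 10 _ s2.
  (* Comparison resumes at the previous end, or at [i] if that end lies before it. *)
  pose b0 := maxn (prev i) i.
  have hb0 : i <= b0 <= pend i by rewrite /b0; lia.
  have hb0' : prev i <= b0 by exact: leq_maxl.
  apply: wp_seq.
  have step1 s4 : rg s4 5 = i -> rg s4 6 = b0 -> rg s4 7 = half -> rg s4 8 = rg s2 8 ->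
    rg s4 10 = phi_arr i -> fb s4 = fb s2 -> rg s4 4 = 0 -> rg s4 2 = N -> rg s4 0 = N ->
    wp (Seq (If (EV 10)
            (While (EEq (EText (EV 6))
                        (EText (EAdd (ESub (EV 10) (EC 1)) (ESub (EV 6) (EV 5)))))
               (Asg 6 (EAdd (EV 6) (EC 1))))
            Skip)
         (If (ELt (EV 6) (EV 7))
            (Seq (Sto ALCP (EV 5) (EV 6)) (Asg 8 (EAdd (EV 5) (EC 1))))
            (Sto ALCP (EV 5) (ESub (EV 6) (EV 7)))))
      (fun b'' s' => [/\ b2 - (pend i - prev i) <= b'', rg s' 5 = i & J i.+1 (setr 5 i.+1 s')]) b2 s4.
    move=> f5 f6 f7 f8 f10 ffb f4 f2 f0.
    have fin s5 b5 : b2 - (pend i - prev i) <= b5 -> rg s5 5 = i -> rg s5 6 = pend i ->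
      rg s5 7 = half -> rg s5 8 = rg s2 8 -> fb s5 = fb s2 ->
      wp (If (ELt (EV 6) (EV 7))
            (Seq (Sto ALCP (EV 5) (EV 6)) (Asg 8 (EAdd (EV 5) (EC 1))))
            (Sto ALCP (EV 5) (ESub (EV 6) (EV 7))))
      (fun b'' s' => [/\ b2 - (pend i - prev i) <= b'', rg s' 5 = i & J i.+1 (setr 5 i.+1 s')]) b5 s5.
      move=> hb5 g5 g6 g7 g8 gfb; apply: wp_if => //=; rewrite g6 g7.
      case: (ltnP (pend i) half) => hh /=.
        sto => //=; first by rewrite g5.
        apply: wp_asg; first by rewrite /= g5; split=> //; lia.
        split=> //; split=> //=; simp_regs; rewrite ?g5 ?g6 ?addn1 //.
        - split=> // k hk; rewrite hk; apply: leq_ltn_trans hh; apply: bfle => //; lia.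
        - move=> k hk; rewrite /upd /plcp_code hk; case: eqP => [-> //|ne].
          rewrite gfb hlo; last by lia.
          rewrite /plcp_code -h8'; last by lia.
          have -> : pend k < half by apply: leq_ltn_trans hh; apply: bfle => //; lia.
          by [].
        - by move=> k hk; rewrite /upd; case: eqP => [|_]; [lia | rewrite gfb hhi //; lia].
      apply: wp_sto => /=; rewrite ?g5 ?g6 ?g7 //; first by side.
      split=> //; split=> //=; simp_regs; rewrite ?g8.
      - split; first by lia.
        move=> k hk; case: (k =P i) => [->|ne]; last by apply: h8'; lia.
        by lia.
      - move=> k hk; rewrite /upd; case: eqP => [->|ne]; last by rewrite gfb hlo //; lia.
        by rewrite /plcp_code ltnNge h8.
      - by move=> k hk; rewrite /upd; case: eqP => [|_]; [lia | rewrite gfb hhi //; lia].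
    wif => //=; rewrite f10; case: eqP => [hz|/eqP hnz].
      apply: wp_skip; apply: fin => //; first by lia.
      have ebf : pend i = i by rewrite /plcp_end /plcp hz /= addn0.
      by rewrite f6; lia.
    have [hj hne] := ph_spec HS ph0 phS hi hnz.
    apply: (@wp_while _ _ (fun b5 s5 => exists c, [/\ rg s5 6 = c, b0 <= c <= pend i & b2 - (c - b0) <= b5])).
      by exists b0; split=> //; lia.
    move=> b5 s5 [c [g6 hc hb5]] hf5.
    have hg r : r != 6 -> rg s5 r = rg s4 r by move=> hr; case: hf5 => -> //=; rewrite inE.
    have gfb : fb s5 = fb s2 by case: hf5 => _ _ ->.
    have htx k : txt tx s5 k = tx k by rewrite /txt hg // f4.
    have hts k : txt_safe N s5 k = (k < N) by rewrite /txt_safe hg // f4.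
    have hin : (phi_arr i).-1 + (c - i) < N.
      have [_ h _ _] := ln_spec HV hi hj hne; have : pend i = i + lcp_at N tx i (phi_arr i).-1.
        by rewrite /plcp_end /plcp (negbTE hnz).
      lia.
    have g5 : rg s5 5 = i by rewrite hg.
    have g10 : rg s5 10 = phi_arr i by rewrite hg.
    split.
      by rewrite /= !hts g6 g5 g10; side.
    rewrite /= !htx g6 g5 g10 subn1 (bf_next HV HS ph0 phS) //; last by lia.
    case: (ltnP c (pend i)) => hlt /=; last first.
      by apply: fin => //; [lia | rewrite g6; lia | rewrite hg | rewrite hg].
    split; first by lia.
    apply: wp_asg => /=; first by rewrite g6; split=> //; lia.
    by exists c.+1; split; rewrite ?g6 //=; simp_regs; lia.
  apply: wp_if => //=; simp_regs; rewrite h6 ei; case: (ltnP (prev i) i) => hpi2 /=.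
    apply: wp_asg => //; apply: step1 => //=; simp_regs => //; rewrite ?ei /b0 //; lia.
  apply: wp_skip; apply: step1 => //=; simp_regs => //; rewrite ?h6 /b0 //; lia.
- move=> s2 b2 hb2 hf ex [h6 h7 [h8 h8'] hlo hhi]; by split=> //; lia.
Qed.

Let pi x := (A x).-1.

Let piN x : x < N -> pi x < N.
Proof. by move=> hx; have := sa_val HS hx; rewrite /pi; lia. Qed.

Let pi_inj' x y : x < N -> y < N -> pi x = pi y -> x = y.
Proof.
move=> hx hy; have := sa_val HS hx; have := sa_val HS hy; rewrite /pi => h1 h2 e.
by apply: (sa_inj HS) => //; lia.
Qed.

Lemma permute_ok s b Q p : rg s 2 = N -> fa s = A -> rg s 7 = half -> is_threshold p ->
  (forall i, i < N -> fb s i = plcp_code p i) -> 2 * N <= b ->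
  (forall s' b', b - 2 * N <= b' -> framed permute s s' ->
     (forall i, i < N -> fb s' i = plcp_code p (pi i) + half) -> Q b' s') ->
  wp permute Q b s.
Proof.
move=> e2 ea e7 hp hfb hb hQ.
have henc i : i < N -> plcp_code p i < half by exact: enc_lt.
pose mk s1 x := half <= fb s1 x.
pose vals s1 := forall x, x < N -> fb s1 x = if mk s1 x then plcp_code p (pi x) + half else plcp_code p x.
(* The old content of a marked slot has already reached its destination, the slot that [pi] maps to
   it, so overwriting lost nothing. *)
pose clos s1 := forall x, x < N -> mk s1 x -> exists2 y, y < N & mk s1 y /\ pi y = x.
pose nm s1 := cnt N (mk s1).
suff H : wp permute (fun b' s' => b - 2 * N <= b' /\
    (forall i, i < N -> fb s' i = plcp_code p (pi i) + half)) b s.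
  by apply: (wp_conseq H) => b' s' hf [h1 h2]; apply: hQ.
asg => //=; set s0 := setr 5 0 s.
(* Every iteration, outer or inner, advances [x] or marks a slot, so [x + nm s1] serves as a clock
   bounded by [2 * N]. *)
apply: (@wp_while _ _ (fun b1 s1 => exists x, [/\ rg s1 5 = x, x <= N,
    b - (x + nm s1) <= b1, vals s1 & clos s1 /\ forall y, y < x -> mk s1 y])).
  exists 0; split=> //; first by lia.
    move=> x hx; rewrite /mk /s0 /= hfb //; have := henc _ hx.
    by case: leqP.
  split=> // x hx; rewrite /mk /s0 /= hfb //; have := henc _ hx; lia.
move=> b1 s1 [x [e5 hx hb1 hv [hc hmk]]] hf1.
have hf1' : framed permute s s1.
  case: hf1 => f1 f2 f3; split=> // r; rewrite /= inE negb_or => /andP[hr hr'].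
  by rewrite f1 /s0 //=; simp_regs; rewrite (negbTE hr).
have e21 : rg s1 2 = N by case: hf1' => ->.
have e71 : rg s1 7 = half by case: hf1' => ->.
have ea1 : fa s1 = A by case: hf1' => _ ->.
split=> //=; rewrite e5 e21; case: (ltnP x N) => hxN /=; last first.
  have hnm : nm s1 <= N by exact: cnt_le.
  split; first by lia.
  by move=> i hi; rewrite hv // hmk //; lia.
have hnm1 : nm s1 <= N by exact: cnt_le.
split; first by lia.
apply: wp_seq; asg; first by rewrite /= e5.
rewrite /= e5.
have fin s2 b2 : rg s2 5 = x -> b - (x.+1 + nm s2) <= b2 -> vals s2 -> clos s2 ->
    (forall y, y < x.+1 -> mk s2 y) ->
    wp (Asg 5 (EAdd (EV 5) (EC 1))) (fun b1 s1 => exists x, [/\ rg s1 5 = x, x <= N,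
    b - (x + nm s1) <= b1, vals s1 & clos s1 /\ forall y, y < x -> mk s1 y]) b2 s2.
  move=> h5 hb2 h1 h2 h3; apply: wp_asg; first by rewrite /= h5; split=> //; lia.
  by exists x.+1; split=> //=; simp_regs; lia.
apply: wp_if => //; simp_regs; rewrite e71.
case: (boolP (mk s1 x)) => hm.
  have -> : (fb s1 x < half) = false by apply/negbTE; rewrite -leqNgt.
  apply: wp_skip; apply: fin => //; rewrite ?/nm /=; try (rewrite -/(nm s1); lia).
  by move=> y hy; case: (y =P x) => [->//|ne]; apply: hmk; lia.
have -> : (fb s1 x < half) by rewrite ltnNge.
rewrite /=.
have hvx : fb s1 x = plcp_code p x by rewrite hv // (negbTE hm).
asg => //; simp_regs; rewrite e5.
have hAx := sa_val HS hxN.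
asg; first by simp_regs; rewrite ea1; side.
simp_regs; rewrite ea1 subn1 -/(pi x).
set s2 := setr 10 _ _.
(* The walk along the cycle of [x]: [r] is the slot to be filled next, its old value already moved
   on, or kept in register 6 if [r] is [x]. Except for [x], the marked slots and [r] have their
   preimages under [pi] marked. *)
pose I b3 s3 := exists r, [/\ rg s3 9 = r /\ r < N, rg s3 10 = pi r, ~~ mk s3 r /\ vals s3,
   b - (x.+1 + nm s3) <= b3 /\ (forall y, y < x -> mk s3 y) /\ (r != x -> mk s3 x) &
   (forall z, z < N -> mk s3 z || (z == r) -> z = x \/ exists2 y, y < N & mk s3 y /\ pi y = z)].
apply: wp_seq; apply: (@wp_while _ _ I).
  exists x; split=> //.
  - split; last by split=> //; rewrite eqxx.
    by rewrite -/(nm s1); rewrite /nm /s2 /=; rewrite -/(nm s1); lia.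
  - move=> z hz /orP[hmz|/eqP->]; last by left.
    by right; exact: hc.
move=> b3 s3 [r [[g9 hr] g10 [hmr hv3] [hb3 [hmk3 hmx]] hcl]] hf3.
have hg k : k \notin [:: 9; 10] -> rg s3 k = rg s2 k by move=> hk; case: hf3 => ->.
have g5 : rg s3 5 = x by rewrite hg.
have g6 : rg s3 6 = plcp_code p x by rewrite hg // /s2; simp_regs.
have g7 : rg s3 7 = half by rewrite hg // /s2; simp_regs.
have ga : fa s3 = A by case: hf3 => _ ->.
have hnm3 : nm s3 < N.
  have := @cnt_addone N (mk s3) (fun j => mk s3 j || (j == r)) r hr hmr (fun j _ => erefl).
  by have := cnt_le N (fun j => mk s3 j || (j == r)); rewrite /nm; lia.
have hpr := piN hr.
have mark v s4 : v < N -> v = plcp_code p (pi r) -> fb s4 = upd (fb s3) r (v + half) ->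
    [/\ forall z, z < N -> mk s4 z = mk s3 z || (z == r), vals s4 & nm s4 = (nm s3).+1].
  move=> hvN ev e; have h1 z : mk s4 z = mk s3 z || (z == r).
    by rewrite /mk e /upd; case: eqP => [->|_]; rewrite ?orbF // orbT leq_addl.
  split=> //; last by apply: (cnt_addone hr hmr).
  move=> z hz; rewrite h1 e /upd; case: eqP => [->|_]; first by rewrite orbT -ev.
  by rewrite orbF; exact: hv3.
split; first by rewrite /= g5 g10; split=> //; case: ifP; lia.
rewrite /= g10 g5; case: (pi r =P x) => [epx|nepx] /=.
  apply: wp_sto => //=; rewrite ?g9 ?g6 ?g7 //.
    by split=> //; have := henc _ hxN; lia.
  have henx := henc _ hxN.
  set s4 := St _ _ _.
  have [m1 m2 m3] := mark (plcp_code p x) s4 (ltac:(lia)) (ltac:(by rewrite epx)) erefl.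
  apply: fin => //; first by rewrite m3; lia.
    move=> z hz; rewrite m1 // => hmz; case: (hcl z hz hmz) => [->|[y hy [h1 h2]]].
      by exists r => //; rewrite m1 // eqxx orbT.
    by exists y => //; rewrite m1 // h1.
  move=> y hy; rewrite m1; last by lia.
  case: (y =P x) => [->|ne]; last by rewrite hmk3 //; lia.
  by case: (r =P x) => [->|/eqP /hmx ->] //; rewrite eqxx orbT.
(* The next slot of the cycle is fresh: were it marked, its only preimage under the injective [pi],
   the unmarked [r], would be marked. *)
have hmp : ~~ mk s3 (pi r).
  apply/negP => hmp; case: (hcl _ hpr); first by rewrite hmp.
    by [].
  move=> [y hy [h1 h2]]; have e := pi_inj' hy hr h2.
  by rewrite -e h1 in hmr.
have hvp : fb s3 (pi r) = plcp_code p (pi r) by rewrite hv3 // (negbTE hmp).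
have henp := henc _ hpr; have hApr := sa_val HS hpr.
split; first by lia.
sto => //=; rewrite ?g9 ?g10 ?g7 ?hvp //.
  by side.
set s4 := St _ _ _.
have [m1 m2 m3] := mark (plcp_code p (pi r)) s4 (ltac:(lia)) erefl erefl.
asg => //; apply: wp_asg.
  by simp_regs; rewrite g10 ga; side.
simp_regs; rewrite g10 ga subn1 -/(pi (pi r)).
have nepr : pi r != r.
  apply/eqP => e; have : mk s3 r || (r == r) by rewrite eqxx orbT.
  case/(hcl r hr) => [erx|[y hy [h1 h2]]]; first by rewrite e erx in nepx.
  have e3 : y = r by apply: pi_inj' => //; rewrite h2 e.
  by rewrite -e3 h1 in hmr.
exists (pi r); split=> //.
- by split=> //; rewrite -[mk _ _]/(mk s4 (pi r)) m1 // (negbTE hmp).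
- split; first by rewrite -[nm _]/(nm s4) m3; lia.
  split; first by move=> y hy; rewrite -[mk _ _]/(mk s4 y) m1 ?hmk3 //; lia.
  move=> _; rewrite -[mk _ _]/(mk s4 x) m1 //.
  by case: (r =P x) => [->|/eqP /hmx ->] //; rewrite eqxx orbT.
- move=> z hz; rewrite -[mk _ _]/(mk s4 z) m1 // => hmz.
  have [hmz'|ez] : (mk s3 z || (z == r)) \/ z = pi r.
    by case/orP: hmz => [->|/eqP ->]; [left | right].
    case: (hcl z hz hmz') => [->|[y hy [h1 h2]]]; first by left.
    by right; exists y => //; rewrite -[mk _ _]/(mk s4 y) m1 // h1.
  by right; exists r => //; rewrite -[mk _ _]/(mk s4 r) m1 // eqxx orbT.
Qed.

Lemma decode_ok s b Q p : rg s 2 = N -> fa s = A -> rg s 7 = half -> rg s 8 = p -> is_threshold p ->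
  (forall i, i < N -> fb s i = plcp_code p (pi i) + half) -> N <= b ->
  (forall s' b', b - N <= b' -> framed decode s s' ->
     (forall i, i < N -> fb s' i = plcp N tx phi_arr (pi i)) -> Q b' s') ->
  wp decode Q b s.
Proof.
move=> e2 ea e7 e8 hp hfb hb hQ.
apply: (@wp_for _ _ 5 2 _ (fun x s' => (forall i, i < x -> fb s' i = plcp N tx phi_arr (pi i)) /\
   forall i, x <= i < N -> fb s' i = plcp_code p (pi i) + half) _ _ _ N) => //.
- move=> x s1 b1 hx e5 hf [h1 h2]; have hpx := piN hx; have hAx := sa_val HS hx.
  have e71 : rg s1 7 = half by case: hf => ->.
  have e81 : rg s1 8 = p by case: hf => ->.
  have ea1 : fa s1 = A by case: hf => _ ->.
  have henx := enc_lt hp hpx.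
  have hv : fb s1 x = plcp_code p (pi x) + half by apply: h2; lia.
  asg; first by rewrite /= ea1 e5; side.
  rewrite /= ea1 e5 subn1 -/(pi x).
  asg; first by simp_regs; rewrite e5 e71 hv; side.
  simp_regs; rewrite e5 e71 hv addnK.
  have hbx := bflt hpx; have hpt := hp _ hpx.
  have fin s2 : rg s2 5 = x -> rg s2 6 = pend (pi x) -> rg s2 10 = pi x -> fb s2 = fb s1 ->
    wp (Sto ALCP (EV 5) (ESub (EV 6) (EV 10))) (fun b'' s' => [/\ b1 <= b'', rg s' 5 = x
      & (forall i, i < x.+1 -> fb (setr 5 x.+1 s') i = plcp N tx phi_arr (pi i)) /\
        (forall i, x < i < N -> fb (setr 5 x.+1 s') i = plcp_code p (pi i) + half)]) b1 s2.
    move=> g5 g6 g10 gb; apply: wp_sto => /=; rewrite ?g5 ?g6 ?g10 ?gb //; first by side.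
    split=> //; split=> i hi; rewrite /upd; case: eqP => [eix|ne].
    - by rewrite eix /plcp_end addKn.
    - by apply: h1; lia.
    - by lia.
    - by apply: h2; lia.
  wif => //; simp_regs; rewrite e81.
  rewrite /plcp_code; case: (ltnP (pi x) p) => hxp /=.
    by apply: wp_skip; apply: fin => //; simp_regs; rewrite hxp.
  apply: wp_asg; first by simp_regs; rewrite e71; split=> //; lia.
  apply: fin => //; simp_regs; rewrite e71; lia.
- by move=> s1 b1 hb1 hf _ [h1 h2]; apply: hQ.
Qed.

End LcpCode.

(** The four phases cost 1, 2, 2 and 1 times [N]. *)
Lemma lcp_prog_ok N tx A s b Q : vtext N tx -> sa_ok N (suffix_le N tx) A -> fa s = A ->
  rg s 0 = N -> 6 * N <= b ->
  (forall s' b', b - 6 * N <= b' -> fa s' = A ->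
     (forall r, r < N -> fb s' r =
        if r == 0 then 0 else lcp (suffix_from N tx (A r).-1) (suffix_from N tx (A r.-1).-1)) -> Q b' s') ->
  wp N tx lcp_prog Q b s.
Proof.
move=> hV hS ea e0 hb hQ.
suff H : wp N tx lcp_prog (fun b' s' => b - 6 * N <= b' /\
     forall r, r < N -> fb s' r =
        if r == 0 then 0 else lcp (suffix_from N tx (A r).-1) (suffix_from N tx (A r.-1).-1)) b s.
  apply: (wp_conseq H) => b' s' [_ hf _] [h1 h2]; apply: hQ => //.
  by rewrite hf.
asg => //; rewrite /= e0.
asg => //; set s1 := setr 4 _ _.
apply: wp_seq; apply: (phi_ok hV hS) => //; first by lia.
move=> s2 b2 hb2 [f2 f2a _] p0 pS.
have e22 : rg s2 2 = N by rewrite f2.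
have e02 : rg s2 0 = N by rewrite f2.
have e42 : rg s2 4 = 0 by rewrite f2.
have ea2 : fa s2 = A by rewrite f2a.
apply: wp_seq; apply: (plcps_ok hV hS p0 pS) => //; first by lia.
move=> s3 b3 hb3 [f3 f3a _] e73 ht hv3.
have e23 : rg s3 2 = N by rewrite f3.
have ea3 : fa s3 = A by rewrite f3a.
apply: wp_seq; apply: (permute_ok hV hS p0 pS e23 ea3 e73 ht hv3); first by lia.
move=> s4 b4 hb4 [f4 f4a _] hv4.
have e24 : rg s4 2 = N by rewrite f4.
have e74 : rg s4 7 = N - N %/ 2 by rewrite f4.
have e84 : rg s4 8 = rg s3 8 by rewrite f4.
have ea4 : fa s4 = A by rewrite f4a.
apply: (decode_ok hV hS p0 pS e24 ea4 e74 e84 ht hv4); first by lia.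
move=> s5 b5 hb5 _ hv5; split; first by lia.
case=> [|r] hr; rewrite hv5 // /plcp ?p0 // pS //=.
have := sa_val hS (ltnW hr); case: eqP => //; lia.
Qed.

(** * Word size, input conditions and assembly *)

Lemma pow_expn m n : Nat.pow m n = m ^ n.
Proof. by elim: n => //= n ->; rewrite expnS. Qed.

Lemma word_size_lt N : N < 2 ^ word_size N.
Proof.
case: (posnP N) => [->|N0]; first by rewrite expn_gt0.
have := (PeanoNat.Nat.log2_spec N (ltac:(lia))).2.
by rewrite pow_expn /word_size; lia.
Qed.

(** Every character of the alphabet occurs, so 1 does; nothing in the text being smaller, it can
    only be the strictly smallest last character. *)
Lemma vtext_valid sigma T : valid_text sigma T -> vtext (size T) (nth 0 T).
Proof.
move=> [hs ha hc hl].
have hr i : i < size T -> 1 <= nth 0 T i <= sigma by move=> hi; exact: (allP ha _ (mem_nth 0 hi)).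
split; first by lia.
  by move=> i hi; have := hr i hi; lia.
have h1 : 1 \in T by apply: hc; lia.
have hk : index 1 T < size T by rewrite index_mem.
have ek : nth 0 T (index 1 T) = 1 by rewrite nth_index.
have e : index 1 T = (size T).-1.
  case: (ltnP (index 1 T) (size T).-1) => h; last by lia.
  by have := hl _ h; have := hr (size T).-1; rewrite ek; lia.
rewrite e in ek.
move=> i hi; case: (ltnP i (size T).-1) => h; first by have := hl _ h; rewrite ek; lia.
by have -> : i = (size T).-1 by [lia]; rewrite ek !eqxx.
Qed.

Lemma psuf_drop T i : suffix_from (size T) (nth 0 T) i = drop i T.
Proof.
apply: (@eq_from_nth _ 0); first by rewrite size_map size_iota size_drop.
move=> k; rewrite size_map size_iota => hk.
by rewrite (nth_map 0) ?size_iota // nth_iota // nth_drop.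
Qed.

Definition sa_lcp_prog := Seq suffix_sort lcp_prog.

Theorem theorem2 :
  exists (P : program) (c : nat),
    forall (sigma : nat) (T : seq nat),
      valid_text sigma T ->
      forall SA0 LCP0 : seq nat,
        words_ok (word_size (size T)) (size T) SA0 ->
        words_ok (word_size (size T)) (size T) LCP0 ->
        exists s : state,
          [/\ exec (word_size (size T)) P T (c * size T)
                   (init_state (size T) sigma SA0 LCP0) = Some s,
              halted P s,
              is_suffix_array T (mSA s) &
              mLCP s = lcp_array T (mSA s)].
Proof.
(* Sorting takes at most 82 and the LCP phase 6 times [N] loop iterations; then [k.+1 <= 89 * N]
   because [N] is positive. *)
exists (compile_cmd sa_lcp_prog 0 ++ [:: IHalt]), (size_cmd sa_lcp_prog * 89).
move=> sigma T hvalid SA0 LCP0 /andP[/eqP hsa _] /andP[/eqP hlcp _].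
have hV := vtext_valid hvalid; set N := size T in hV hsa hlcp *.
have N0 := vt_pos hV.
pose s0 := St (fun x => if x == 0 then N else if x == 1 then sigma else 0) (nth 0 SA0) (nth 0 LCP0).
have [k [s1 [hrun hk [A [hS hA hL]]]]] : wp N (nth 0 T) sa_lcp_prog (fun _ s => exists A,
    [/\ sa_ok N (suffix_le N (nth 0 T)) A, fa s = A & forall r, r < N -> fb s r =
      if r == 0 then 0 else lcp (suffix_from N (nth 0 T) (A r).-1) (suffix_from N (nth 0 T) (A r.-1).-1)])
    (88 * N) s0.
  apply: wp_seq; apply: (suffix_sort_ok hV) => //; first by lia.
  move=> s1 b1 hb1 [hf _ _] hS; apply: (lcp_prog_ok hV hS erefl); first by rewrite hf.
    by lia.
  by move=> s2 b2 hb2 ea hL; exists (fa s1).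
have hsim : sim T s0 (init_state N sigma SA0 LCP0) by split.
have hB : size_cmd sa_lcp_prog * k.+1 <= size_cmd sa_lcp_prog * 89 * N.
  by rewrite -mulnA leq_mul2l; apply/orP; right; lia.
have [ms [hex hhalt [_ h1 h2 h3 h4]]] :=
  machine_run (word_size_lt N) (erefl : wf_cmd sa_lcp_prog) hsim erefl hrun hB.
exists ms; split=> //.
  have eSA : mSA ms = mkseq A N.
    apply: (@eq_from_nth _ 0); rewrite ?size_mkseq // => i hi.
    by rewrite h1 in hi; rewrite nth_mkseq // h3 // hA.
  rewrite /is_suffix_array eSA hS.1 /=; apply/(sortedP 0) => i.
  rewrite size_mkseq => hi; rewrite !nth_mkseq //; last by lia.
  have hle := hS.2 i i.+1; rewrite ltnSn hi in hle.
  have := hle isT; rewrite /suffix_le !psuf_drop /lex_le /suf => hlt.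
  (* [sa_ok] gives a weak order only; equal suffixes would have equal lengths, hence equal
     positions, against injectivity. *)
  case h: (lex_lt _ _) => //; have := lex_lt_total h (negbTE hlt).
  move=> /(congr1 size); rewrite !size_drop -/N.
  have hi' : i < N by lia.
  have v1 := sa_val hS hi; have v2 := sa_val hS hi' => e.
  by have := sa_inj hS hi' hi; lia.
apply: (@eq_from_nth _ 0); first by rewrite size_mkseq.
move=> r; rewrite h2 => hr; rewrite h4 // hL // nth_mkseq // !psuf_drop.
by case: eqP => // hr0; rewrite /suf !h3 ?hA //; lia.
Qed.
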